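(* Let $\beta,y\in\mathbb C$ with $\operatorname{Re}\beta>0$ and $y\notin 2\pi \mathrm{i}\mathbb Z$. Then $$ (e^{-y};e^{-\beta})_\infty = \exp\left(\frac{\beta(1-\coth(y/2))}{24}-\frac{\operatorname{Li}_2(e^{-y})}{\beta}\right) (1-e^{-y})^{1/2} \prod_{n\in\mathbb Z}\left(\frac{\sqrt{2\pi}}{\Gamma\left(\frac{y+2\pi \mathrm{i} n}{\beta}\right)} \left(\frac{y+2\pi \mathrm{i} n}{\beta}\right)^{\frac{y+2\pi \mathrm{i} n}{\beta}-\frac 12} \exp\left(\frac{\beta}{12(y+2\pi \mathrm{i} n)}-\frac{y+2\pi \mathrm{i} n}{\beta}\right)\right), $$ where the infinite product is absolutely convergent. The dilogarithm and the non-integer powers on the right-hand side have branch points at $y\in 2\pi\mathrm{i}\mathbb Z$; the identity holds for the standard branches, with $\operatorname{Li}_2(e^{-y})$ and $(1-e^{-y})^{1/2}$ positive for $y>0$ and $((y+2\pi\mathrm{i}n)/\beta)^{(y+2\pi\mathrm{i}n)/\beta-1/2}$ positive for $(y+2\pi\mathrm{i}n)/\beta>0$.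
   Context: For $|q|<1$ and $z\in\mathbb C$, $(z;q)_\infty=\prod_{j=0}^\infty(1-zq^j)$. $\Gamma$ is the gamma function, and $\operatorname{Li}_2$ is the dilogarithm, $\operatorname{Li}_2(z)=\sum_{k=1}^\infty z^k/k^2$ for $|z|\le 1$, continued analytically elsewhere. The standard branches of $\operatorname{Li}_2(e^{-y})$ and $(1-e^{-y})^{1/2}$ are those analytic for $y\notin 2\pi\mathrm{i}\mathbb Z+\mathbb R_{\le 0}$ and positive for $y>0$. The standard branch of $w^{w-1/2}$, where $w=(y+2\pi\mathrm{i}n)/\beta$, is $\exp((w-\tfrac12)\log w)$ with the principal logarithm, so that it is positive for $w>0$.
   Formalization: For non-real β the identity with principal powers fails when y lies between the rays 2πin−ℝ≥0 and 2πin−βℝ≥0; it is stated with principal powers off these closed wedges, and for all other y ∉ 2πiℤ with branches continued analytically from Re y>0. *)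

(* Defs.v *)
From Stdlib Require Import Reals ZArith.
From Coquelicot Require Import Coquelicot.

Open Scope C_scope.

Definition Clim_seq (u : nat -> C) : C :=
  (real (Lim_seq (fun n => Re (u n))), real (Lim_seq (fun n => Im (u n)))).

(* u 0 * ... * u (N - 1) *)
Fixpoint Cprod (u : nat -> C) (N : nat) : C :=
  match N with
  | O => 1
  | S N' => Cprod u N' * u N'
  end.

Definition Cexp (z : C) : C :=
  (exp (Re z) * cos (Im z), exp (Re z) * sin (Im z))%R.

(* Principal argument, with values in (-PI, PI]; meaningless at 0. *)
Definition Carg (z : C) : R :=
  if Rlt_dec (Im z) 0 then (- acos (Re z / Cmod z))%R
  else acos (Re z / Cmod z).

Definition Clog (z : C) : C := (ln (Cmod z), Carg z).

Definition Ccoth (z : C) : C :=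
  (Cexp z + Cexp (- z)) / (Cexp z - Cexp (- z)).

Definition qPochhammer (z q : C) : C :=
  Clim_seq (Cprod (fun j => 1 - z * q ^ j)).

(* Euler's limit n! n^z / (z (z + 1) ... (z + n)).  At the poles
   z = 0, -1, -2, ... the division convention / 0 = 0 gives Gamma z = 0, and
   hence / Gamma z = 0, which is the value there of the entire function
   1 / Gamma. *)
Definition Gamma (z : C) : C :=
  Clim_seq (fun n =>
    RtoC (INR (fact n)) * Cexp (z * RtoC (ln (INR n)))
    / Cprod (fun k => z + RtoC (INR k)) (S n)).

(* Absolute convergence of the product of the a n over n in Z.  Under it the
   product does not depend on the order of the factors, so that its value may
   be taken as the limit of the symmetric partial products. *)
Definition Zprod_abs_convergent (a : Z -> C) : Prop :=
  ex_series (fun k : nat => Cmod (a (Z.of_nat k) - 1)) /\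
  ex_series (fun k : nat => Cmod (a (- Z.of_nat k)%Z - 1)).

Definition Zprod (a : Z -> C) : C :=
  Clim_seq (fun N =>
    Cprod (fun k => a (Z.of_nat k - Z.of_nat N)%Z) (2 * N + 1)).

Definition analytic_at (f : C -> C) (z0 : C) : Prop :=
  exists (a : nat -> C) (r : R), (0 < r)%R /\
    forall z : C, (Cmod (z - z0) < r)%R ->
      is_pseries (K := C_AbsRing) (V := C_NormedModule) a (z - z0) (f z).

Definition analytic_on (U : C -> Prop) (f : C -> C) : Prop :=
  forall z, U z -> analytic_at f z.

(* 2 pi i n *)
Definition period (n : Z) : C := (0, 2 * PI * IZR n)%R.

Definition warg (beta y : C) (n : Z) : C := (y + period n) / beta.

(* The n-th factor; l stands for the value of log w at
   w = (y + 2 pi i n) / beta. *)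
Definition factor (beta y : C) (n : Z) (l : C) : C :=
  RtoC (sqrt (2 * PI)) / Gamma (warg beta y n)
  * Cexp ((warg beta y n - 1 / 2) * l)
  * Cexp (beta / (12 * (y + period n)) - warg beta y n).

(* D stands for the value of Li_2(e^{-y}), s for that of
   (1 - e^{-y})^{1/2}, and l n for that of log ((y + 2 pi i n) / beta). *)
Definition product_formula (beta y D s : C) (l : Z -> C) : Prop :=
  qPochhammer (Cexp (- y)) (Cexp (- beta)) =
  Cexp (beta * (1 - Ccoth (y / 2)) / 24 - D / beta) * s
  * Zprod (fun n => factor beta y n (l n)).

Definition is_Li2_branch (U : C -> Prop) (D : C -> C) : Prop :=
  analytic_on U D /\
  forall y, U y -> (Cmod (Cexp (- y)) <= 1)%R ->
    is_series (K := C_AbsRing) (V := C_NormedModule)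
      (fun k => Cexp (- y) ^ (k + 1) / RtoC (INR (k + 1)) ^ 2) (D y).

Definition is_sqrt_branch (U : C -> Prop) (s : C -> C) : Prop :=
  analytic_on U s /\
  (forall y, U y -> s y ^ 2 = 1 - Cexp (- y)) /\
  (forall x : R, (0 < x)%R -> exists r : R, (0 < r)%R /\ s (RtoC x) = RtoC r).

(* A branch on U of y |-> log w, w = (y + 2 pi i n) / beta, that is real for
   w > 0; exp ((w - 1/2) log w) is then the branch of w^{w - 1/2} that is
   positive for w > 0.  If Re beta > 0, then w > 0 entails Re y > 0. *)
Definition is_log_branch (beta : C) (n : Z) (U : C -> Prop) (l : C -> C)
    : Prop :=
  analytic_on U l /\
  (forall y, U y -> Cexp (l y) = warg beta y n) /\
  (forall (y : C) (x : R), U y -> (0 < x)%R -> warg beta y n = RtoC x ->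
     l y = RtoC (ln x)).

(* The complement of 2 pi i Z + R_{<= 0}. *)
Definition cut_plane (y : C) : Prop :=
  forall (n : Z) (t : R), (t <= 0)%R -> y <> period n + RtoC t.

(* The standard branches of Li_2(e^{-y}) and (1 - e^{-y})^{1/2} are cut along
   2 pi i n - R_{>= 0}, those of w^{w - 1/2} along 2 pi i n - beta R_{>= 0}.
   For non-real beta these are two different rays.  Crossing the former
   multiplies the first two factors of the right-hand side by
   - exp (2 pi i w) or its inverse, and crossing the latter multiplies the
   product by the inverse, so that between the two rays principal values
   belong to different sheets and do not satisfy the identity.  For real
   beta this is cut_plane. *)
Definition off_wedges (beta y : C) : Prop :=
  forall (n : Z) (s t : R), (0 <= s)%R -> (0 <= t)%R ->
    y <> period n - (RtoC s + RtoC t * beta).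

Definition connected (U : C -> Prop) : Prop :=
  forall V W : C -> Prop,
    open V -> open W ->
    (forall z, U z -> V z \/ W z) ->
    (forall z, U z -> ~ (V z /\ W z)) ->
    (forall z, U z -> V z) \/ (forall z, U z -> W z).

(* The domains to which the standard branches are continued from the right
   half-plane, where they are all analytic. *)
Definition branch_domain (U : C -> Prop) : Prop :=
  open U /\ connected U /\ (forall y, (0 < Re y)%R -> U y).

(* Main.v *)
Require Import Defs.
From Stdlib Require Import Reals ZArith Lra Lia Psatz ClassicalEpsilon FunctionalExtensionality.
From Coquelicot Require Import Coquelicot.
Open Scope C_scope.

(** Let w_n = (y + 2 pi i n) / beta and let mu be Binet's function, so that the
    n-th factor is exp (- (mu (w_n) - 1 / (12 w_n))).  By Gudermann's series,
    mu (w) - 1 / (12 w) is the sum over k >= 0 of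
      h (w + k),  h (w) = (w + 1/2) (log (w + 1) - log w) - 1
                          - 1 / (12 w (w + 1)),
    which is the error of the trapezoidal rule for log on [w, w + 1], corrected
    by its first Euler-Maclaurin term.  As h (w) = O (|w|^-4), the double series
    over n and k converges absolutely and may be summed over n first
    ([tannery]).

    Summing over n for fixed k turns log ((u + 2 pi i n) / beta) into
    log (1 - e^{-u}): both errors are integrals over the segment from
    u = y + k beta to u + beta of the same quadratic polynomial times the
    second derivative of the function, and
      sum over n of 1 / (u + 2 pi i n)^2 = e^u / (e^u - 1)^2
    ([partial_fractions], [bracket_sum]).  The antiderivative of
    log (1 - e^{-u}) is Li_2 (e^{-u}), so the error for log (1 - e^{-u}) is
      (F (u + beta) - F (u)) / beta - (f (u) + f (u + beta)) / 2
        + beta / 12 (f' (u + beta) - f' (u)),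
    with f = log (1 - e^{-u}) and F = Li_2 (e^{-u}).  The sum over k of these
    errors telescopes, except for the values of f, which give the logarithm of
    the infinite product (e^{-y}; e^{-beta})_oo.  This is the identity
    ([continued_formula]).

    The branches enter only through the data F, f and log (u + 2 pi i n) at the
    points u = y + k beta, and the argument applies to all data that arise from
    the principal ones by one common continuation along a polygon that avoids
    2 pi i Z ([continued]).
    On a domain U, the branches are such a common continuation at every point,
    because the set of points where they are is open and closed in U
    ([branches_continued]); for Li_2 this uses that its second derivative is
    1 / (e^y - 1) on all of U, by the identity theorem ([Li2_branch_ode]).
    Principal logarithms are branches of this kind off the wedges.

    Gamma is connected with Gudermann's series through Euler's limit and
    Stirling's formula ([gamma_factor], [stirling]), where only the exponentials
    of the logarithms of w + k matter, apart from k = 0 and k -> oo.  If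
    y + k beta lies in 2 pi i Z for some k, both sides of the identity vanish
    ([product_formula_zero]). *)

(** * Complex numbers *)

Ltac Csolve := apply injective_projections; simpl; try ring.

Ltac rmin H := eapply Rlt_le_trans; [exact H|];
  first [apply Rmin_l | apply Rmin_r
        | eapply Rle_trans; [apply Rmin_l|]; first [apply Rmin_l | apply Rmin_r]].

Lemma re_minus a b : Re (a - b) = (Re a - Re b)%R.
Proof. reflexivity. Qed.

Lemma im_minus a b : Im (a - b) = (Im a - Im b)%R.
Proof. reflexivity. Qed.

Lemma Re_le_Cmod z : (Rabs (Re z) <= Cmod z)%R.
Proof. eapply Rle_trans; [apply Rmax_l | apply (Rmax_Cmod z)]. Qed.

Lemma Im_le_Cmod z : (Rabs (Im z) <= Cmod z)%R.
Proof. eapply Rle_trans; [apply Rmax_r | apply (Rmax_Cmod z)]. Qed.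

Lemma Cmod_le_Re_Im z : (Cmod z <= Rabs (Re z) + Rabs (Im z))%R.
Proof.
replace z with (RtoC (Re z) + Ci * RtoC (Im z)) at 1.
- eapply Rle_trans; [apply Cmod_triangle|].
  rewrite Cmod_mult, Cmod_Ci, !Cmod_R. lra.
- destruct z; Csolve.
Qed.

Lemma Cmod_triangle_minus a b : (Cmod (a - b) <= Cmod a + Cmod b)%R.
Proof. unfold Cminus. rewrite <- (Cmod_opp b). apply Cmod_triangle. Qed.

Lemma Cmod_triangle_inv a b : (Cmod a - Cmod b <= Cmod (a + b))%R.
Proof.
replace a with ((a + b) - b) at 1 by ring.
generalize (Cmod_triangle_minus (a + b) b). lra.
Qed.

Lemma Cmod_sym a b : Cmod (a - b) = Cmod (b - a).
Proof. rewrite <- Cmod_opp. f_equal. ring. Qed.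

Lemma Cmod_RtoC_pos x : (0 <= x)%R -> Cmod (RtoC x) = x.
Proof. intros. rewrite Cmod_R. now apply Rabs_pos_eq. Qed.

Lemma Re_pos_neq_0 (z : C) : (0 < Re z)%R -> z <> 0.
Proof. intros H ->. simpl in H. lra. Qed.

Lemma RtoC_neq_0 x : x <> 0%R -> RtoC x <> 0.
Proof. intros H E. apply H. now apply RtoC_inj. Qed.

(** * Convergence of complex sequences *)

(** Convergence in modulus: estimates and the limits of real and imaginary
    parts ([cvg_comp]) are both at hand. *)
Definition cvg (u : nat -> C) (l : C) : Prop :=
  is_lim_seq (fun n => Cmod (u n - l)) 0.

Lemma cvg_le (u : nat -> C) (l : C) (b : nat -> R) (N : nat) :
  (forall n, (N <= n)%nat -> (Cmod (u n - l) <= b n)%R) -> is_lim_seq b 0 -> cvg u l.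
Proof.
intros H Hb. unfold cvg.
apply (is_lim_seq_le_le_loc (fun _ => 0%R) _ b).
- exists N. intros n Hn. split; [apply Cmod_ge_0 | auto].
- apply is_lim_seq_const.
- exact Hb.
Qed.

Lemma cvg_comp u l :
  cvg u l <-> is_lim_seq (fun n => Re (u n)) (Re l) /\ is_lim_seq (fun n => Im (u n)) (Im l).
Proof.
split.
- intros H. split; apply is_lim_seq_spec; intros eps; apply is_lim_seq_spec in H;
  destruct (H eps) as [N HN]; exists N; intros n Hn; specialize (HN n Hn);
  rewrite Rminus_0_r, Rabs_pos_eq in HN by apply Cmod_ge_0;
  (eapply Rle_lt_trans; [|exact HN]).
  + rewrite <- re_minus. apply Re_le_Cmod.
  + rewrite <- im_minus. apply Im_le_Cmod.
- intros [H1 H2].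
  apply cvg_le with (N := O) (b := fun n => (Rabs (Re (u n) - Re l) + Rabs (Im (u n) - Im l))%R).
  + intros n _. apply Cmod_le_Re_Im.
  + assert (L : forall v (x : R), is_lim_seq v x -> is_lim_seq (fun n => Rabs (v n - x)) 0).
    { intros v x Hv. replace 0%R with (Rabs (x - x)) by (rewrite Rminus_diag, Rabs_R0; auto).
      apply (is_lim_seq_abs (fun n => (v n - x)%R) (x - x)%R).
      apply is_lim_seq_minus'; [exact Hv | apply is_lim_seq_const]. }
    replace 0%R with (0 + 0)%R by ring.
    apply is_lim_seq_plus'; apply L; auto.
Qed.

Lemma cvg_Clim_seq u l : cvg u l -> Clim_seq u = l.
Proof.
intros H. apply cvg_comp in H. destruct H as [H1 H2]. unfold Clim_seq.
rewrite (is_lim_seq_unique _ _ H1), (is_lim_seq_unique _ _ H2). now destruct l.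
Qed.

Lemma cvg_unique u l l' : cvg u l -> cvg u l' -> l = l'.
Proof. intros H H'. now rewrite <- (cvg_Clim_seq _ _ H), <- (cvg_Clim_seq _ _ H'). Qed.

Lemma cvg_const l : cvg (fun _ => l) l.
Proof.
apply cvg_comp; split; apply is_lim_seq_const.
Qed.

Lemma cvg_ext_loc u v l N :
  (forall n, (N <= n)%nat -> u n = v n) -> cvg u l -> cvg v l.
Proof.
intros H Hu. apply cvg_le with (N := N) (b := fun n => Cmod (u n - l)); auto.
intros n Hn. rewrite H by auto. lra.
Qed.

Lemma cvg_ext u v l : (forall n, u n = v n) -> cvg u l -> cvg v l.
Proof. intros H. apply cvg_ext_loc with (N := O). auto. Qed.

Lemma cvg_plus u v l m : cvg u l -> cvg v m -> cvg (fun n => u n + v n) (l + m).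
Proof.
intros H1 H2. apply cvg_comp in H1, H2. apply cvg_comp.
split; simpl; apply is_lim_seq_plus'; tauto.
Qed.

Lemma cvg_opp u l : cvg u l -> cvg (fun n => - u n) (- l).
Proof.
intros H1. apply cvg_comp in H1. apply cvg_comp.
split; simpl; [apply (is_lim_seq_opp _ (Re l)) | apply (is_lim_seq_opp _ (Im l))]; tauto.
Qed.

Lemma cvg_minus u v l m : cvg u l -> cvg v m -> cvg (fun n => u n - v n) (l - m).
Proof. intros. apply cvg_plus; auto. now apply cvg_opp. Qed.

Lemma cvg_mult u v l m : cvg u l -> cvg v m -> cvg (fun n => u n * v n) (l * m).
Proof.
intros H1 H2. apply cvg_comp in H1, H2. apply cvg_comp. destruct H1, H2.
split; simpl.
- apply is_lim_seq_minus'; apply is_lim_seq_mult'; tauto.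
- apply is_lim_seq_plus'; apply is_lim_seq_mult'; tauto.
Qed.

Lemma cvg_incr u l N : cvg (fun n => u (n + N)%nat) l <-> cvg u l.
Proof. unfold cvg. symmetry. apply (is_lim_seq_incr_n (fun n => Cmod (u n - l)) N 0). Qed.

Lemma cvg_spec u l :
  cvg u l <-> (forall eps, (0 < eps)%R -> exists N, forall n, (N <= n)%nat -> (Cmod (u n - l) < eps)%R).
Proof.
unfold cvg. rewrite <- is_lim_seq_spec. split.
- intros H eps Heps. destruct (H (mkposreal _ Heps)) as [N HN]. exists N. intros n Hn.
  specialize (HN n Hn). simpl in HN. rewrite Rminus_0_r, Rabs_pos_eq in HN; auto. apply Cmod_ge_0.
- intros H eps. destruct (H eps (cond_pos eps)) as [N HN]. exists N. intros n Hn.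
  rewrite Rminus_0_r, Rabs_pos_eq by apply Cmod_ge_0. auto.
Qed.

Lemma cvg_le_limit u l b N :
  cvg u l -> (forall n, (N <= n)%nat -> (Cmod (u n) <= b)%R) -> (Cmod l <= b)%R.
Proof.
intros H Hb. apply Rnot_lt_le. intros Hl.
destruct (proj1 (cvg_spec u l) H (Cmod l - b)%R) as [M HM]; [lra|].
specialize (HM (N + M)%nat ltac:(lia)). specialize (Hb (N + M)%nat ltac:(lia)).
replace l with (u (N + M)%nat + (- (u (N + M)%nat - l))) in Hl by ring.
generalize (Cmod_triangle (u (N + M)%nat) (- (u (N + M)%nat - l))). rewrite Cmod_opp.
replace (u (N + M)%nat + (- (u (N + M)%nat - l))) with l by ring.
replace (u (N + M)%nat + (- (u (N + M)%nat - l))) with l in Hl by ring. lra.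
Qed.

(** * Partial sums *)

Fixpoint csum (u : nat -> C) (N : nat) : C :=
  match N with
  | O => 0
  | S N' => csum u N' + u N'
  end.

Fixpoint rsum (u : nat -> R) (N : nat) : R :=
  match N with
  | O => 0%R
  | S N' => (rsum u N' + u N')%R
  end.

Lemma csum_S u N : csum u (S N) = csum u N + u N.
Proof. reflexivity. Qed.

Lemma csum_ext u v N : (forall k, (k < N)%nat -> u k = v k) -> csum u N = csum v N.
Proof. induction N; intros H; simpl; auto. rewrite IHN, H by (intros; auto). auto. Qed.

Lemma csum_plus u v N : csum (fun k => u k + v k) N = csum u N + csum v N.
Proof. induction N; simpl; [ring|rewrite IHN; ring]. Qed.

Lemma csum_opp u N : csum (fun k => - u k) N = - csum u N.
Proof. induction N; simpl; [ring|rewrite IHN; ring]. Qed.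

Lemma csum_minus u v N : csum (fun k => u k - v k) N = csum u N - csum v N.
Proof. induction N; simpl; [ring|rewrite IHN; ring]. Qed.

Lemma csum_scal c u N : csum (fun k => c * u k) N = c * csum u N.
Proof. induction N; simpl; [ring|rewrite IHN; ring]. Qed.

Lemma csum_cat u N M : csum u (N + M) = csum u N + csum (fun k => u (N + k)%nat) M.
Proof.
induction M; simpl.
- rewrite Nat.add_0_r. ring.
- rewrite Nat.add_succ_r. simpl. rewrite IHM. ring.
Qed.

Lemma csum_le u b N :
  (forall k, (k < N)%nat -> (Cmod (u k) <= b k)%R) -> (Cmod (csum u N) <= rsum b N)%R.
Proof.
induction N; intros H; simpl.
- rewrite Cmod_0. lra.
- eapply Rle_trans; [apply Cmod_triangle|]. apply Rplus_le_compat; auto.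
Qed.

Lemma ex_series_dom (a b : nat -> R) :
  (forall n, (Rabs (a n) <= b n)%R) -> ex_series b -> ex_series a.
Proof. apply (ex_series_le (K := R_AbsRing) (V := R_CompleteNormedModule)). Qed.

Lemma ex_series_Rscal c (a : nat -> R) : ex_series a -> ex_series (fun n => (c * a n)%R).
Proof. apply (ex_series_scal_l (K := R_AbsRing) c a). Qed.

Lemma rsum_sum_n u N : rsum u (S N) = sum_n u N.
Proof.
induction N; [simpl; rewrite sum_O; ring|].
rewrite sum_Sn. rewrite <- IHN. reflexivity.
Qed.

Lemma rsum_lim b (l : R) : is_series b l -> is_lim_seq (rsum b) l.
Proof.
intros Hs. apply is_lim_seq_incr_1.
apply is_lim_seq_ext with (sum_n b); [intros; symmetry; apply rsum_sum_n|exact Hs].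
Qed.

Lemma rsum_le_Series b N : (forall k, (0 <= b k)%R) -> ex_series b -> (rsum b N <= Series b)%R.
Proof.
intros Hb Hs.
apply (is_lim_seq_incr_compare (rsum b)).
- apply rsum_lim, Series_correct, Hs.
- intros n. simpl. specialize (Hb n). lra.
Qed.

(** A finite part of the terms is left free, as bounds are only available far
    out in the lattice. *)
Lemma csum_cvg_dominated u b N0 :
  (forall k, (N0 <= k)%nat -> (Cmod (u k) <= b k)%R) -> (forall k, (0 <= b k)%R) ->
  ex_series b -> exists l, cvg (csum u) l.
Proof.
intros H Hb Hs.
assert (L : forall p : C -> R, (forall z, (Rabs (p z) <= Cmod z)%R) ->
   (forall a c, p (a + c) = (p a + p c)%R) -> p 0 = 0%R ->
   exists l : R, is_lim_seq (fun n => p (csum u n)) l).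
{ intros p Hp Hadd H0.
  assert (E : forall n, p (csum u n) = rsum (fun k => p (u k)) n).
  { induction n; simpl; auto. rewrite Hadd, IHn. auto. }
  assert (X : ex_series (fun k => p (u k))).
  { apply (ex_series_incr_n _ N0).
    apply (ex_series_le (fun k => p (u (N0 + k)%nat)) (fun k => b (N0 + k)%nat)).
    - intros n. eapply Rle_trans; [apply Hp|]. apply H. lia.
    - now apply (ex_series_incr_n b N0). }
  destruct X as [l Hl]. exists l.
  apply is_lim_seq_ext with (rsum (fun k => p (u k))); [intros; auto|].
  now apply rsum_lim. }
destruct (L Re) as [l1 H1]; [apply Re_le_Cmod|reflexivity|reflexivity|].
destruct (L Im) as [l2 H2]; [apply Im_le_Cmod|reflexivity|reflexivity|].
exists (l1, l2). apply cvg_comp. split; auto.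
Qed.

(** Tannery's theorem: dominated convergence for series.  It exchanges the sum
    over k with the limit of the symmetric sums over n. *)
Lemma tannery (S : nat -> nat -> C) (E : nat -> C) (b : nat -> R) (N0 : nat)
    (T : nat -> C) (X : C) :
  (forall k, cvg (fun M => S M k) (E k)) ->
  (forall M k, (N0 <= k)%nat -> (Cmod (S M k) <= b k)%R) ->
  (forall k, (0 <= b k)%R) -> ex_series b ->
  (forall M, cvg (csum (S M)) (T M)) -> cvg (csum E) X -> cvg T X.
Proof.
intros HS Hb Hb0 Hs HT HX.
assert (HEb : forall k, (N0 <= k)%nat -> (Cmod (E k) <= b k)%R).
{ intros k Hk. apply (cvg_le_limit (fun M => S M k) (E k) (b k) 0); auto. }
apply cvg_spec. intros eps Heps.
assert (Hl := rsum_lim b _ (Series_correct b Hs)). apply is_lim_seq_spec in Hl.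
destruct (Hl (mkposreal (eps / 4) ltac:(lra))) as [N1 HN1].
simpl in HN1.
set (N := (N0 + N1)%nat).
assert (tail : forall n, (rsum (fun k => b (N + k)%nat) n <= eps / 4)%R).
{ intros n.
  assert (E1 : rsum b (N + n) = (rsum b N + rsum (fun k => b (N + k)%nat) n)%R).
  { clear. induction n; simpl; [rewrite Nat.add_0_r; ring|].
    rewrite Nat.add_succ_r. simpl. rewrite IHn. ring. }
  specialize (HN1 N ltac:(unfold N; lia)). apply Rabs_def2 in HN1.
  generalize (rsum_le_Series b (N + n) Hb0 Hs). lra. }
assert (HSN : cvg (fun M => csum (S M) N) (csum E N)).
{ clear - HS. induction N; simpl; [apply cvg_const|]. now apply cvg_plus. }
assert (B : forall (u : nat -> C) l, cvg (csum u) l ->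
   (forall k, (N0 <= k)%nat -> (Cmod (u k) <= b k)%R) -> (Cmod (l - csum u N) <= eps / 4)%R).
{ intros u l Hu Hub.
  apply (cvg_le_limit (fun n => csum u (n + N)%nat - csum u N) _ _ 0).
  - apply cvg_minus; [now apply cvg_incr | apply cvg_const].
  - intros n _. rewrite Nat.add_comm, csum_cat.
    replace (csum u N + csum (fun k => u (N + k)%nat) n - csum u N)
      with (csum (fun k => u (N + k)%nat) n) by ring.
    eapply Rle_trans; [|apply (tail n)]. apply csum_le. intros k _. apply Hub. unfold N; lia. }
destruct (proj1 (cvg_spec _ _) HSN (eps / 4)%R ltac:(lra)) as [M0 HM0].
exists M0. intros M HM.
generalize (HM0 M HM) (B _ _ (HT M) (Hb M)) (B _ _ HX HEb). intros A1 A2 A3.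
replace (T M - X) with ((T M - csum (S M) N) + ((csum (S M) N - csum E N) - (X - csum E N))) by ring.
eapply Rle_lt_trans; [apply Cmod_triangle|].
generalize (Cmod_triangle_minus (csum (S M) N - csum E N) (X - csum E N)). lra.
Qed.

(** * Differentiable paths in C *)

(** The derivative of a path, taken on real and imaginary parts.  All complex
    analysis below is done along paths, where the mean value inequality and
    the uniqueness of antiderivatives are real-variable facts. *)
Definition Dt (f : R -> C) (t : R) (l : C) : Prop :=
  is_derive (fun x => Re (f x)) t (Re l) /\ is_derive (fun x => Im (f x)) t (Im l).

Lemma Dt_eq f t l l' : Dt f t l -> l = l' -> Dt f t l'.
Proof. intros H <-. exact H. Qed.

Lemma Dt_ext f g t l : (forall x, f x = g x) -> Dt f t l -> Dt g t l.
Proof.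
intros H [H1 H2]. split.
- apply is_derive_ext with (2 := H1). intros; now rewrite H.
- apply is_derive_ext with (2 := H2). intros; now rewrite H.
Qed.

Lemma Dt_unique f t l l' : Dt f t l -> Dt f t l' -> l = l'.
Proof.
intros [H1 H2] [H3 H4]. apply is_derive_unique in H1, H2, H3, H4.
destruct l, l'. simpl in *. now rewrite <- H1, <- H2, <- H3, <- H4.
Qed.

Lemma Dt_const c t : Dt (fun _ => c) t 0.
Proof. split; apply @is_derive_const. Qed.

Lemma Dt_affine (a d : C) t : Dt (fun x => a + RtoC x * d) t d.
Proof. split; simpl; auto_derive; trivial; unfold Re, Im; ring. Qed.

Lemma Dt_plus f g t l m : Dt f t l -> Dt g t m -> Dt (fun x => f x + g x) t (l + m).
Proof. intros [H1 H2] [H3 H4]. split; simpl; apply @is_derive_plus; auto. Qed.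

Lemma Dt_opp f t l : Dt f t l -> Dt (fun x => - f x) t (- l).
Proof. intros [H1 H2]. split; simpl; apply @is_derive_opp; auto. Qed.

Lemma Dt_minus f g t l m : Dt f t l -> Dt g t m -> Dt (fun x => f x - g x) t (l - m).
Proof. intros. apply Dt_plus; auto. now apply Dt_opp. Qed.

Lemma is_derive_Rmult (f g : R -> R) x df dg :
  is_derive f x df -> is_derive g x dg ->
  is_derive (fun t => (f t * g t)%R) x (df * g x + f x * dg)%R.
Proof. intros. apply (is_derive_mult f g); auto. intros; apply Rmult_comm. Qed.

Lemma Dt_mult f g t l m :
  Dt f t l -> Dt g t m -> Dt (fun x => f x * g x) t (l * g t + f t * m).
Proof.
intros [H1 H2] [H3 H4]. split; simpl; evar_last.
- apply @is_derive_minus; apply is_derive_Rmult; eauto.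
- unfold minus, plus, opp; simpl. unfold Re, Im. ring.
- apply @is_derive_plus; apply is_derive_Rmult; eauto.
- unfold minus, plus, opp; simpl. unfold Re, Im. ring.
Qed.

Lemma Dt_scal c f t l : Dt f t l -> Dt (fun x => c * f x) t (c * l).
Proof.
intros H. eapply Dt_eq; [apply (Dt_mult _ _ _ _ _ (Dt_const c t) H)|]. ring.
Qed.

Lemma Cnorm2_neq_0 (z : C) : z <> 0 -> (Re z * Re z + Im z * Im z <> 0)%R.
Proof.
intros Hz E. apply Hz. destruct z as [a b]. simpl in E.
assert (a = 0 /\ b = 0)%R as [-> ->] by (split; nra). reflexivity.
Qed.

Lemma Dt_inv (f : R -> C) t (l : C) : f t <> 0 -> Dt f t l -> Dt (fun x => / f x) t (- l / (f t * f t)).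
Proof.
intros Hf [H1 H2].
assert (N : (Re (f t) * Re (f t) + Im (f t) * Im (f t) <> 0)%R).
{ now apply Cnorm2_neq_0. }
assert (Hd : is_derive (fun x => (Re (f x) * Re (f x) + Im (f x) * Im (f x))%R) t
   (2 * (Re (f t) * Re l + Im (f t) * Im l))%R).
{ evar_last. apply @is_derive_plus; apply is_derive_Rmult; eauto.
  unfold plus; simpl. ring. }
assert (Hi := is_derive_inv _ _ _ Hd N).
assert (Hr := is_derive_Rmult _ _ _ _ _ H1 Hi).
assert (Hm := is_derive_Rmult _ _ _ _ _ (is_derive_opp _ _ _ H2) Hi).
split.
- eapply is_derive_ext; [|evar_last; [exact Hr|]].
  + intros x. simpl. unfold Re, Im, Rdiv. f_equal. f_equal. ring.
  + cbv beta. clear - Hf N. revert Hf N. generalize (f t). intros [a b] Hf N. destruct l as [c d].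
    simpl in *. field. repeat split; auto; nra.
- eapply is_derive_ext; [|evar_last; [exact Hm|]].
  + intros x. simpl. unfold Re, Im, opp, Rdiv; simpl. f_equal. f_equal. ring.
  + cbv beta. clear - Hf N. revert Hf N. generalize (f t). intros [a b] Hf N. destruct l as [c d].
    unfold opp; simpl in *. field. repeat split; auto; nra.
Qed.

Lemma Dt_exp f t l : Dt f t l -> Dt (fun x => Cexp (f x)) t (l * Cexp (f t)).
Proof.
intros [H1 H2].
assert (He := is_derive_comp exp _ _ _ _ (is_derive_exp _) H1).
assert (Hc := is_derive_comp cos _ _ _ _ (is_derive_cos _) H2).
assert (Hs := is_derive_comp sin _ _ _ _ (is_derive_sin _) H2).
split; simpl; evar_last.
- apply (is_derive_Rmult _ _ _ _ _ He Hc).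
- unfold scal; simpl; unfold mult; simpl. unfold Re, Im. ring.
- apply (is_derive_Rmult _ _ _ _ _ He Hs).
- unfold scal; simpl; unfold mult; simpl. unfold Re, Im. ring.
Qed.

Lemma MVT_Rabs (f df : R -> R) a b B :
  (a <= b)%R -> (forall t, (a <= t <= b)%R -> is_derive f t (df t)) ->
  (forall t, (a <= t <= b)%R -> (Rabs (df t) <= B)%R) -> (Rabs (f b - f a) <= B * (b - a))%R.
Proof.
intros Hab Hd HB.
destruct (MVT_gen f a b df) as [c [Hc E]].
- rewrite Rmin_left, Rmax_right by lra. intros; apply Hd; lra.
- rewrite Rmin_left, Rmax_right by lra. intros x Hx. apply continuity_pt_filterlim.
  apply (ex_derive_continuous f). exists (df x). apply Hd; lra.
- rewrite Rmin_left, Rmax_right in Hc by lra.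
  rewrite E, Rabs_mult, (Rabs_pos_eq (b - a)) by lra.
  apply Rmult_le_compat_r; [lra|]. auto.
Qed.

Lemma Dt_bound f df a b B :
  (a <= b)%R -> (forall t, (a <= t <= b)%R -> Dt f t (df t)) ->
  (forall t, (a <= t <= b)%R -> (Cmod (df t) <= B)%R) ->
  (Cmod (f b - f a) <= 2 * B * (b - a))%R.
Proof.
intros Hab Hd HB. eapply Rle_trans; [apply Cmod_le_Re_Im|].
assert (H1 := MVT_Rabs (fun x => Re (f x)) (fun x => Re (df x)) a b B Hab
   (fun t Ht => proj1 (Hd t Ht)) (fun t Ht => Rle_trans _ _ _ (Re_le_Cmod _) (HB t Ht))).
assert (H2 := MVT_Rabs (fun x => Im (f x)) (fun x => Im (df x)) a b B Hab
   (fun t Ht => proj2 (Hd t Ht)) (fun t Ht => Rle_trans _ _ _ (Im_le_Cmod _) (HB t Ht))).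
simpl in H1, H2. rewrite re_minus, im_minus. lra.
Qed.

Lemma Dt_zero_const f :
  (forall t, (0 <= t <= 1)%R -> Dt f t 0) -> f 1%R = f 0%R.
Proof.
intros H. apply Ceq_minus, Cmod_eq_0. apply Rle_antisym; [|apply Cmod_ge_0].
eapply Rle_trans; [apply (Dt_bound f (fun _ => 0) 0 1 0); auto; try lra|].
- intros. rewrite Cmod_0. lra.
- lra.
Qed.

(** Replaces monodromy arguments: two branches of a logarithm along a segment
    that agree at one end agree at the other. *)
Lemma Dt_same_end f g df :
  (forall t, (0 <= t <= 1)%R -> Dt f t (df t)) -> (forall t, (0 <= t <= 1)%R -> Dt g t (df t)) ->
  f 0%R = g 0%R -> f 1%R = g 1%R.
Proof.
intros Hf Hg E0.
apply Ceq_minus.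
rewrite (Dt_zero_const (fun t => f t - g t)).
- rewrite E0. ring.
- intros t Ht. eapply Dt_eq; [apply Dt_minus; eauto|ring].
Qed.

(** * The exponential *)

Lemma Cexp_plus a b : Cexp (a + b) = Cexp a * Cexp b.
Proof.
unfold Cexp. destruct a as [a a'], b as [b b']. simpl.
rewrite exp_plus, cos_plus, sin_plus. Csolve.
Qed.

Lemma Cexp_0 : Cexp 0 = 1.
Proof. unfold Cexp. simpl. rewrite exp_0, cos_0, sin_0. Csolve. Qed.

Lemma Cexp_opp_l a : Cexp (- a) * Cexp a = 1.
Proof. rewrite <- Cexp_plus. replace (- a + a) with (RtoC 0) by ring. apply Cexp_0. Qed.

Lemma Cexp_neq_0 a : Cexp a <> 0.
Proof. intros E. generalize (Cexp_opp_l a). rewrite E, Cmult_0_r. intros H. now apply C1_nz. Qed.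

Lemma Cexp_opp a : Cexp (- a) = / Cexp a.
Proof.
replace (Cexp (- a)) with (Cexp (- a) * Cexp a / Cexp a).
- rewrite Cexp_opp_l. unfold Cdiv. ring.
- field. apply Cexp_neq_0.
Qed.

Lemma Cexp_shift_pow a b k : Cexp (- a) * Cexp (- b) ^ k = Cexp (- (a + RtoC (INR k) * b)).
Proof.
induction k.
- simpl. rewrite Cmult_1_r. f_equal. ring.
- rewrite Cpow_S, S_INR, RtoC_plus, Cmult_assoc, (Cmult_comm (Cexp (- a))), <- Cmult_assoc, IHk, <- Cexp_plus.
  f_equal. ring.
Qed.

Lemma Cexp_minus a b : Cexp (a - b) = Cexp a / Cexp b.
Proof. unfold Cminus. now rewrite Cexp_plus, Cexp_opp. Qed.

Lemma Cexp_RtoC x : Cexp (RtoC x) = RtoC (exp x).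
Proof. unfold Cexp. simpl. rewrite cos_0, sin_0. Csolve. Qed.

Lemma Cmod_Cexp z : Cmod (Cexp z) = exp (Re z).
Proof.
transitivity (sqrt (Rsqr (exp (Re z)))); [|apply sqrt_Rsqr, Rlt_le, exp_pos].
unfold Cmod, Cexp. simpl fst; simpl snd. f_equal.
generalize (sin2_cos2 (Im z)). unfold Rsqr. intros H.
replace (exp (Re z) * exp (Re z))%R
  with (exp (Re z) * exp (Re z) * (sin (Im z) * sin (Im z) + cos (Im z) * cos (Im z)))%R
  by (rewrite H; ring).
ring.
Qed.

Lemma Cexp_period n : Cexp (period n) = 1.
Proof.
unfold Cexp, period. simpl. rewrite exp_0.
assert (E : cos (2 * PI * IZR n) = 1%R /\ sin (2 * PI * IZR n) = 0%R).
{ replace (2 * PI * IZR n)%R with (2 * IZR n * PI)%R by ring.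
  assert (H : exists m : nat, n = Z.of_nat m \/ n = (- Z.of_nat m)%Z)
    by (exists (Z.abs_nat n); lia).
  destruct H as [m [-> | ->]].
  - rewrite <- INR_IZR_INZ.
    replace (2 * INR m * PI)%R with (0 + 2 * INR m * PI)%R by ring.
    rewrite cos_period, sin_period, cos_0, sin_0. auto.
  - rewrite opp_IZR, <- INR_IZR_INZ.
    replace (2 * - INR m * PI)%R with (- (0 + 2 * INR m * PI))%R by ring.
    rewrite cos_neg, sin_neg, cos_period, sin_period, cos_0, sin_0. split; ring. }
destruct E as [-> ->]. Csolve.
Qed.

Lemma Cexp_eq_1 z : Cexp z = 1 -> exists n, z = period n.
Proof.
intros E. assert (Hm := Cmod_Cexp z). rewrite E, Cmod_1 in Hm.
assert (Hr : Re z = 0%R). { apply exp_inv. now rewrite exp_0. }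
assert (Hs : sin (Im z) = 0%R /\ cos (Im z) = 1%R).
{ injection E. unfold Re in Hr. unfold Re, Im. rewrite Hr, exp_0. intros. lra. }
destruct Hs as [Hs Hc]. destruct (sin_eq_0_0 _ Hs) as [k Hk].
destruct (Z.Even_or_Odd k) as [[m Hm']|[m Hm']].
- exists m. rewrite Hm', mult_IZR in Hk.
  apply injective_projections; simpl; [exact Hr|].
  change (snd z) with (Im z). rewrite Hk. ring.
- exfalso.
  assert (X := Cexp_period m). unfold Cexp, period in X. injection X. simpl.
  rewrite exp_0. intros _ Xc.
  rewrite Hk, Hm', plus_IZR, mult_IZR in Hc.
  replace ((2 * IZR m + 1) * PI)%R with (2 * PI * IZR m + PI)%R in Hc by ring.
  rewrite neg_cos in Hc. lra.
Qed.

Lemma Cexp_eq a b : Cexp a = Cexp b -> exists n, a = b + period n.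
Proof.
intros E. destruct (Cexp_eq_1 (a - b)) as [n Hn].
- rewrite Cexp_minus, E. field. apply Cexp_neq_0.
- exists n. rewrite <- Hn. ring.
Qed.

(** The periods of the exponential are the multiples of 2 pi i, and 0 is the
    only one in the open strip. *)
Lemma Cexp_inj_strip a b :
  Cexp a = Cexp b -> (Rabs (Im a - Im b) < 2 * PI)%R -> a = b.
Proof.
intros E H. destruct (Cexp_eq a b E) as [n ->].
assert (n = 0%Z) as ->.
{ rewrite im_plus in H. simpl in H.
  replace (Im b + 2 * PI * IZR n - Im b)%R with (2 * PI * IZR n)%R in H by ring.
  generalize PI_RGT_0. intros Hpi. apply Rabs_def2 in H.
  assert (IZR n < 1)%R by nra. assert (-1 < IZR n)%R by nra.
  apply lt_IZR in H0, H1. lia. }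
unfold period. rewrite Rmult_0_r. change (0, 0)%R with (RtoC 0). ring.
Qed.

Lemma Cexp_minus_1_le z : (Cmod z <= 1)%R -> (Cmod (Cexp z - 1) <= 6 * Cmod z)%R.
Proof.
intros Hz.
assert (B := Dt_bound (fun t => Cexp (RtoC t * z)) (fun t => z * Cexp (RtoC t * z)) 0 1 (3 * Cmod z)).
cbv beta in B. rewrite !Cmult_0_l, Cmult_1_l, Cexp_0 in B.
eapply Rle_trans; [apply B|lra]; try lra.
- intros t _. eapply Dt_eq; [apply Dt_exp|reflexivity].
  apply Dt_ext with (fun x => 0 + RtoC x * z); [intros; ring|]. apply Dt_affine.
- intros t Ht. rewrite Cmod_mult, Cmod_Cexp, Rmult_comm.
  apply Rmult_le_compat_r; [apply Cmod_ge_0|].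
  apply Rle_trans with (exp 1); [|apply exp_le_3].
  assert (Hr := Re_le_Cmod z).
  assert (Re (RtoC t * z) <= 1)%R.
  { rewrite re_scal_l. generalize (Rle_abs (Re z)). nra. }
  destruct (Req_dec (Re (RtoC t * z)) 1) as [->|]; [lra|]. apply Rlt_le, exp_increasing. lra.
Qed.

Lemma cvg_exp u l : cvg u l -> cvg (fun n => Cexp (u n)) (Cexp l).
Proof.
intros H.
destruct (proj1 (cvg_spec u l) H 1%R ltac:(lra)) as [N HN].
apply cvg_le with (N := N) (b := fun n => (Cmod (Cexp l) * 6 * Cmod (u n - l))%R).
- intros n Hn. replace (Cexp (u n) - Cexp l) with (Cexp l * (Cexp (u n - l) - 1)).
  + rewrite Cmod_mult, Rmult_assoc. apply Rmult_le_compat_l; [apply Cmod_ge_0|].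
    apply Cexp_minus_1_le. apply Rlt_le, HN, Hn.
  + rewrite Cexp_minus. field. apply Cexp_neq_0.
- replace (Finite 0) with (Rbar_mult (Cmod (Cexp l) * 6)%R 0).
  + apply is_lim_seq_scal_l. exact H.
  + simpl. f_equal. ring.
Qed.

Lemma cvg_inv (u : nat -> C) (l : C) : l <> 0 -> cvg u l -> cvg (fun n => / u n) (/ l).
Proof.
intros Hl H.
assert (Hp : (0 < Cmod l)%R) by now apply Cmod_gt_0.
destruct (proj1 (cvg_spec u l) H (Cmod l / 2)%R ltac:(lra)) as [N HN].
apply cvg_le with (N := N) (b := fun n => (2 / (Cmod l * Cmod l) * Cmod (u n - l))%R).
- intros n Hn. specialize (HN n Hn).
  assert (Hu : (Cmod l / 2 <= Cmod (u n))%R).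
  { assert (A := Cmod_triangle_inv l (u n - l)). replace (l + (u n - l)) with (u n) in A by ring. lra. }
  assert (u n <> 0) by (apply Cmod_gt_0; lra).
  replace (/ u n - / l) with (- ((u n - l) / (u n * l))) by (field; auto).
  rewrite Cmod_opp, Cmod_div, Cmod_mult by (apply Cmult_neq_0; auto).
  rewrite (Rmult_comm (2 / _)). apply Rmult_le_compat_l; [apply Cmod_ge_0|].
  replace (2 / (Cmod l * Cmod l))%R with (/ (Cmod l / 2 * Cmod l))%R by (field; lra).
  apply Rinv_le_contravar; nra.
- replace (Finite 0) with (Rbar_mult (2 / (Cmod l * Cmod l))%R 0).
  + apply is_lim_seq_scal_l. exact H.
  + simpl. f_equal. ring.
Qed.

(** * The principal logarithm *)

Lemma Cmod_sqr (z : C) : (Cmod z * Cmod z = Re z * Re z + Im z * Im z)%R.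
Proof. generalize (Cmod2_alt z). simpl. rewrite !Rmult_1_r. auto. Qed.

Lemma Carg_spec (z : C) : z <> 0 ->
  (cos (Carg z) = Re z / Cmod z /\ sin (Carg z) = Im z / Cmod z /\ - PI < Carg z <= PI)%R.
Proof.
intros Hz.
assert (Hm : (0 < Cmod z)%R) by now apply Cmod_gt_0.
assert (Hs := Cmod_sqr z).
assert (Hr : (-1 <= Re z / Cmod z <= 1)%R).
{ split; [apply Rle_div_r | apply Rle_div_l]; auto; nra. }
assert (Hsq : sqrt (1 - (Re z / Cmod z)²) = (Rabs (Im z) / Cmod z)%R).
{ rewrite <- (sqrt_Rsqr (Rabs (Im z) / Cmod z)).
  - f_equal. unfold Rsqr. unfold Rdiv.
    replace (Rabs (Im z) * / Cmod z * (Rabs (Im z) * / Cmod z))%R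
      with ((Rabs (Im z) * Rabs (Im z)) * (/ Cmod z * / Cmod z))%R by ring.
    rewrite <- Rabs_mult, Rabs_pos_eq by nra.
    replace (Im z * Im z)%R with (Cmod z * Cmod z - Re z * Re z)%R by lra. field. lra.
  - apply Rdiv_le_0_compat; auto. apply Rabs_pos. }
unfold Carg. destruct (Rlt_dec (Im z) 0) as [Hi|Hi].
- assert (Hr' : (-1 < Re z / Cmod z < 1)%R).
  { split; [apply Rlt_div_r | apply Rlt_div_l]; auto; nra. }
  rewrite cos_neg, sin_neg, cos_acos, sin_acos by auto.
  rewrite Hsq, Rabs_left by auto.
  generalize (acos_bound_lt _ Hr'). intros. repeat split; try lra.
- rewrite cos_acos, sin_acos by auto.
  rewrite Hsq, Rabs_pos_eq by lra.
  generalize (acos_bound (Re z / Cmod z)) PI_RGT_0. intros. repeat split; try lra.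
Qed.

Lemma Cexp_Clog (z : C) : z <> 0 -> Cexp (Clog z) = z.
Proof.
intros Hz. assert (Hm : (0 < Cmod z)%R) by now apply Cmod_gt_0.
destruct (Carg_spec z Hz) as [Hc [Hs _]].
unfold Cexp, Clog. simpl. rewrite Hc, Hs, exp_ln by auto.
destruct z as [a b]. simpl. Csolve; field; lra.
Qed.

Lemma Clog_unique (a z : C) : Cexp a = z -> (- PI < Im a <= PI)%R -> a = Clog z.
Proof.
intros E H.
assert (Hz : z <> 0) by (rewrite <- E; apply Cexp_neq_0).
apply Cexp_inj_strip; [now rewrite Cexp_Clog|].
destruct (Carg_spec z Hz) as [_ [_ Hb]]. simpl.
apply Rabs_def1; lra.
Qed.

Lemma Clog_RtoC x : (0 < x)%R -> Clog (RtoC x) = RtoC (ln x).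
Proof.
intros Hx. symmetry. apply Clog_unique.
- rewrite Cexp_RtoC, exp_ln; auto.
- simpl. generalize PI_RGT_0. lra.
Qed.

(** On the right half-plane the argument is an arctangent, which can be
    differentiated without the case distinction at the real axis. *)
Lemma Clog_right (z : C) : (0 < Re z)%R -> Clog z = (ln (Cmod z), atan (Im z / Re z)).
Proof.
intros Hr.
assert (Hz : z <> 0) by (intros ->; simpl in Hr; lra).
assert (Hm : (0 < Cmod z)%R) by now apply Cmod_gt_0.
symmetry. apply Clog_unique.
- unfold Cexp. simpl. rewrite exp_ln, cos_atan, sin_atan by auto.
  assert (E : sqrt (1 + (Im z / Re z)²) = (Cmod z / Re z)%R).
  { rewrite <- (sqrt_Rsqr (Cmod z / Re z)) by (apply Rlt_le, Rdiv_lt_0_compat; auto).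
    f_equal. unfold Rsqr.
    replace (Cmod z / Re z * (Cmod z / Re z))%R with (Cmod z * Cmod z / (Re z * Re z))%R by (field; lra).
    rewrite Cmod_sqr. field. lra. }
  rewrite E. destruct z as [a b]; simpl in *. Csolve; field; lra.
- simpl. generalize (atan_bound (Im z / Re z)) PI_RGT_0. lra.
Qed.

Lemma Im_Clog_right (z : C) : (0 < Re z)%R -> (Rabs (Im (Clog z)) < PI / 2)%R.
Proof.
intros H. rewrite Clog_right by auto. simpl.
generalize (atan_bound (Im z / Re z)). intros. apply Rabs_def1; lra.
Qed.

Lemma Cexp_half_turn : Cexp (0, PI / 2)%R = Ci.
Proof. unfold Cexp. simpl. rewrite exp_0, cos_PI2, sin_PI2. Csolve. Qed.

(** A quarter turn brings the upper half-plane to the right half-plane. *)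
Lemma Clog_upper (z : C) : (0 < Im z)%R -> Clog z = Clog (- Ci * z) + (0, PI / 2)%R.
Proof.
intros H. symmetry. apply Clog_unique.
- rewrite Cexp_plus, Cexp_half_turn, Cexp_Clog.
  + destruct z; Csolve.
  + intros E. apply (f_equal Re) in E. destruct z; simpl in *. lra.
- assert (B : (0 < Re (- Ci * z))%R) by (destruct z; simpl in *; lra).
  apply Im_Clog_right in B. apply Rabs_def2 in B. rewrite im_plus. simpl (Im (_, _)). lra.
Qed.

Lemma Clog_lower (z : C) : (Im z < 0)%R -> Clog z = Clog (Ci * z) - (0, PI / 2)%R.
Proof.
intros H. symmetry. apply Clog_unique.
- rewrite Cexp_minus, Cexp_half_turn, Cexp_Clog.
  + field. apply Ci_nz.
  + intros E. apply (f_equal Re) in E. destruct z; simpl in *. lra.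
- assert (B : (0 < Re (Ci * z))%R) by (destruct z; simpl in *; lra).
  apply Im_Clog_right in B. apply Rabs_def2 in B. rewrite im_minus. simpl (Im (_, _)). lra.
Qed.

Lemma is_derive_pos_loc (f : R -> R) t l :
  is_derive f t l -> (0 < f t)%R -> locally t (fun x => (0 < f x)%R).
Proof.
intros Hd Hp.
assert (Hc : continuous f t) by (apply (ex_derive_continuous f); exists l; exact Hd).
apply (Hc (fun y => (0 < y)%R)). apply (open_gt 0). exact Hp.
Qed.

Lemma Dt_Clog_right g t l :
  Dt g t l -> (0 < Re (g t))%R -> Dt (fun x => Clog (g x)) t (l / g t).
Proof.
intros [H1 H2] Hr.
assert (Hloc := is_derive_pos_loc _ _ _ H1 Hr).
assert (Hq : is_derive (fun x => (Im (g x) * / Re (g x))%R) t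
   (Im l * / Re (g t) + Im (g t) * (- Re l / Re (g t) ^ 2))%R).
{ apply (is_derive_Rmult (fun x => Im (g x)) (fun x => (/ Re (g x))%R)); auto.
  apply is_derive_inv; auto. lra. }
assert (Ha := is_derive_comp atan _ _ _ _ (is_derive_atan _) Hq).
assert (Hn : is_derive (fun x => (Re (g x) * Re (g x) + Im (g x) * Im (g x))%R) t
   (2 * (Re (g t) * Re l + Im (g t) * Im l))%R).
{ evar_last. apply @is_derive_plus; apply is_derive_Rmult; eauto.
  unfold plus; simpl. ring. }
assert (Hln := is_derive_comp ln _ _ _ _ (is_derive_ln (Re (g t) * Re (g t) + Im (g t) * Im (g t))%R ltac:(nra)) Hn).
assert (Hl2 := is_derive_scal _ _ (/ 2)%R _ Hln).
split.
- apply is_derive_ext_loc with (fun x => (/ 2 * ln (Re (g x) * Re (g x) + Im (g x) * Im (g x)))%R).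
  + apply filter_imp with (2 := Hloc). intros x Hx. simpl. rewrite <- Cmod_sqr.
    assert (0 < Cmod (g x))%R by (generalize (Re_le_Cmod (g x)) (Rle_abs (Re (g x))); lra).
    rewrite ln_mult by auto. field.
  + evar_last; [exact Hl2|]. clear - Hr. unfold scal; simpl; unfold mult; simpl.
    revert Hr. generalize (g t). intros [a b] Hr. destruct l as [c d]. simpl in *. field. nra.
- apply is_derive_ext_loc with (fun x => atan (Im (g x) * / Re (g x))%R).
  + apply filter_imp with (2 := Hloc). intros x Hx. rewrite Clog_right by auto. reflexivity.
  + evar_last; [exact Ha|]. clear - Hr. unfold scal; simpl; unfold mult; simpl.
    revert Hr. generalize (g t). intros [a b] Hr. destruct l as [c d]. simpl in *. unfold Rsqr.
    field. repeat split; nra.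
Qed.

Definition slit (z : C) : Prop := (0 < Re z)%R \/ Im z <> 0%R.

Lemma slit_neq_0 z : slit z -> z <> 0.
Proof. intros [H|H] ->; simpl in H; lra. Qed.

Lemma slit_div_right (a b : C) : (0 < Re a)%R -> (0 < Re b)%R -> slit (a / b).
Proof.
intros Ha Hb. assert (Hb0 := Re_pos_neq_0 b Hb). unfold slit.
destruct (Req_dec (Im (a / b)) 0) as [E|E]; [left|now right].
replace a with (a / b * b) in Ha by (field; exact Hb0).
rewrite re_mult, E in Ha. nra.
Qed.

Lemma Dt_Clog g t l : Dt g t l -> slit (g t) -> Dt (fun x => Clog (g x)) t (l / g t).
Proof.
intros Hg Hs. assert (Hz := slit_neq_0 _ Hs).
destruct Hs as [Hr|Hi]; [now apply Dt_Clog_right|].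
assert (Hrot : forall c c' : C, c <> 0 -> (0 < Re (c * g t))%R ->
   locally t (fun x => Clog (g x) = Clog (c * g x) + c') ->
   Dt (fun x => Clog (g x)) t (l / g t)).
{ intros c c' Hc Hp Hloc.
  assert (D : Dt (fun x => Clog (c * g x) + c') t (l / g t)).
  { eapply Dt_eq.
    - apply Dt_plus; [|apply Dt_const]. apply Dt_Clog_right; auto. apply Dt_scal; eauto.
    - cbv beta. field. auto. }
  destruct D as [D1 D2]. split.
  - eapply is_derive_ext_loc; [|exact D1].
    apply filter_imp with (2 := Hloc). intros x ->. reflexivity.
  - eapply is_derive_ext_loc; [|exact D2].
    apply filter_imp with (2 := Hloc). intros x ->. reflexivity. }
destruct Hg as [H1 H2].
destruct (Rtotal_order (Im (g t)) 0) as [Hn|[He|Hp]]; [|contradiction|].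
- apply (Hrot Ci (- (0, PI / 2)%R)).
  + apply Ci_nz.
  + rewrite re_mult. simpl. lra.
  + assert (L := is_derive_pos_loc _ _ _ (is_derive_opp _ _ _ H2)).
    unfold opp in L; simpl in L. specialize (L ltac:(lra)).
    apply filter_imp with (2 := L). intros x Hx. apply Clog_lower. lra.
- apply (Hrot (- Ci) (0, PI / 2)%R).
  + intros E. apply Ci_nz. replace Ci with (- (- Ci)) by ring. rewrite E. ring.
  + rewrite re_mult. simpl. lra.
  + assert (L := is_derive_pos_loc _ _ _ H2 Hp).
    apply filter_imp with (2 := L). intros x Hx. now apply Clog_upper.
Qed.

Lemma cvg_Cmod u l : cvg u l -> is_lim_seq (fun n => Cmod (u n)) (Cmod l).
Proof.
intros H. apply is_lim_seq_spec. intros eps.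
destruct (proj1 (cvg_spec u l) H eps (cond_pos eps)) as [N HN]. exists N. intros n Hn.
eapply Rle_lt_trans; [|apply (HN n Hn)].
apply Rabs_le. generalize (Cmod_triangle_inv l (u n - l)) (Cmod_triangle_inv (u n) (l - u n)).
replace (l + (u n - l)) with (u n) by ring. replace (u n + (l - u n)) with l by ring.
rewrite (Cmod_sym l). lra.
Qed.

Lemma cvg_Clog u l : (0 < Re l)%R -> cvg u l -> cvg (fun n => Clog (u n)) (Clog l).
Proof.
intros Hl H.
destruct (proj1 (cvg_spec u l) H (Re l) Hl) as [N HN].
assert (Hr : forall n, (N <= n)%nat -> (0 < Re (u n))%R).
{ intros n Hn. specialize (HN n Hn). assert (A := Re_le_Cmod (u n - l)). rewrite re_minus in A.
  assert (B := Rle_lt_trans _ _ _ A HN). apply Rabs_def2 in B. lra. }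
apply cvg_ext_loc with (N := N) (u := fun n => (ln (Cmod (u n)), atan (Im (u n) / Re (u n)))).
- intros n Hn. symmetry. now apply Clog_right, Hr.
- rewrite Clog_right by auto. assert (Hm := cvg_Cmod _ _ H).
  apply cvg_comp in H. destruct H as [H1 H2]. apply cvg_comp. simpl. split.
  + apply is_lim_seq_continuous; auto.
    apply continuity_pt_filterlim, (ex_derive_continuous ln). eexists. apply is_derive_ln.
    generalize (Re_le_Cmod l) (Rle_abs (Re l)). lra.
  + apply (is_lim_seq_continuous atan (fun n => (Im (u n) / Re (u n))%R)).
    * apply continuity_pt_filterlim, (ex_derive_continuous atan). eexists. apply is_derive_atan.
    * apply is_lim_seq_div'; auto. lra.
Qed.

Lemma Clog_scal_pos (x : R) (z : C) :
  (0 < x)%R -> z <> 0 -> Clog (RtoC x * z) = RtoC (ln x) + Clog z.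
Proof.
intros Hx Hz. symmetry. apply Clog_unique.
- rewrite Cexp_plus, Cexp_RtoC, exp_ln, Cexp_Clog; auto.
- rewrite im_plus. destruct (Carg_spec z Hz) as [_ [_ Hb]]. simpl. lra.
Qed.

Lemma Clog_div_right (a b : C) :
  (0 < Re a)%R -> (0 < Re b)%R -> Clog (a / b) = Clog a - Clog b.
Proof.
intros Ha Hb. symmetry.
assert (a <> 0) by (intros ->; simpl in Ha; lra).
assert (b <> 0) by (intros ->; simpl in Hb; lra).
apply Clog_unique.
- rewrite Cexp_minus, !Cexp_Clog; auto.
- apply Im_Clog_right in Ha, Hb. apply Rabs_def2 in Ha, Hb. rewrite im_minus. lra.
Qed.

(** * Complex power series *)

Lemma le_div (a b c : R) : (0 < c)%R -> (a * c <= b)%R -> (a <= b / c)%R.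
Proof. intros Hc H. now apply Rle_div_r. Qed.

Lemma open_C_iff (U : C -> Prop) :
  open U <-> forall z, U z -> exists d : R, (0 < d)%R /\ forall z', (Cmod (z' - z) < d)%R -> U z'.
Proof.
split; intros H z Hz.
- destruct (H z Hz) as [d Hd]. exists d. split; [apply cond_pos|].
  intros z' Hz'. apply Hd. split; simpl; unfold AbsRing_ball; simpl; unfold abs, minus, plus, opp; simpl.
  + eapply Rle_lt_trans; [|exact Hz']. apply (Re_le_Cmod (z' - z)).
  + eapply Rle_lt_trans; [|exact Hz']. apply (Im_le_Cmod (z' - z)).
- destruct (H z Hz) as [d [Hd Hb]]. exists (mkposreal (d / 2) ltac:(lra)).
  intros z' [H1 H2]. apply Hb. eapply Rle_lt_trans; [apply Cmod_le_Re_Im|].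
  assert (A1 : (Rabs (Re (z' - z)) < d / 2)%R) by exact H1.
  assert (A2 : (Rabs (Im (z' - z)) < d / 2)%R) by exact H2. lra.
Qed.

Lemma csum_sum_n (u : nat -> C) N : csum u (S N) = sum_n (G := C_AbelianMonoid) u N.
Proof.
induction N; [simpl; rewrite sum_O; ring|].
rewrite sum_Sn, <- IHN. reflexivity.
Qed.

Lemma is_series_cvg (u : nat -> C) (l : C) :
  is_series (K := C_AbsRing) (V := C_NormedModule) u l -> cvg (csum u) l.
Proof.
intros H. apply (cvg_incr _ _ 1).
apply cvg_ext with (u := sum_n (G := C_AbelianMonoid) u).
{ intros n. rewrite Nat.add_1_r. symmetry. apply csum_sum_n. }
assert (Hb : forall eps : posreal, exists N, forall n, (N <= n)%nat ->
   ball (M := C_UniformSpace) l eps (sum_n (G := C_AbelianMonoid) u n)).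
{ intros eps. apply (H (fun y => ball (M := C_UniformSpace) l eps y)).
  exists eps. intros y Hy; exact Hy. }
apply cvg_comp. split; apply is_lim_seq_spec; intros eps;
  destruct (Hb eps) as [N HN]; exists N; intros n Hn; destruct (HN n Hn) as [A1 A2].
- exact A1.
- exact A2.
Qed.

Lemma pow_n_Cpow (z : C) k : pow_n (K := C_Ring) z k = z ^ k.
Proof. induction k; simpl; [reflexivity|]. rewrite IHk. reflexivity. Qed.

(** [a k * rho ^ k] is bounded for every [rho < r], that is, [r] is at most the
    radius of convergence. *)
Definition rad (a : nat -> C) (r : R) : Prop :=
  forall rho, (0 <= rho < r)%R -> exists M, forall k, (Cmod (a k) * rho ^ k <= M)%R.

Definition CPS (a : nat -> C) (z : C) : C := Clim_seq (csum (fun k => a k * z ^ k)).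

Lemma rad_summable a r rho : rad a r -> (0 <= rho < r)%R ->
  ex_series (fun k => (Cmod (a k) * rho ^ k)%R).
Proof.
intros Ha Hr.
set (s := ((rho + r) / 2)%R).
assert (Hs : (0 < s < r /\ rho < s)%R) by (unfold s; lra).
destruct (Ha s ltac:(lra)) as [M HM].
assert (Hq : (0 <= rho / s < 1)%R).
{ split; [apply Rdiv_le_0_compat; lra|]. apply Rlt_div_l; lra. }
apply (ex_series_dom _ (fun k => (M * (rho / s) ^ k)%R)).
- intros n.
  rewrite Rabs_pos_eq by (apply Rmult_le_pos; [apply Cmod_ge_0|apply pow_le; lra]).
  replace (rho ^ n)%R with (s ^ n * (rho / s) ^ n)%R.
  + rewrite <- Rmult_assoc. apply Rmult_le_compat_r; auto. apply pow_le; lra.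
  + rewrite <- Rpow_mult_distr. f_equal. field. lra.
- apply ex_series_Rscal. apply ex_series_geom. rewrite Rabs_pos_eq; lra.
Qed.

Lemma CPS_cvg a r z : rad a r -> (Cmod z < r)%R -> cvg (csum (fun k => a k * z ^ k)) (CPS a z).
Proof.
intros Ha Hz.
destruct (csum_cvg_dominated (fun k => a k * z ^ k) (fun k => (Cmod (a k) * Cmod z ^ k)%R) 0) as [l Hl].
- intros k _. rewrite Cmod_mult, Cmod_pow. lra.
- intros k. apply Rmult_le_pos; [apply Cmod_ge_0|apply pow_le, Cmod_ge_0].
- apply rad_summable with r; auto. split; auto. apply Cmod_ge_0.
- unfold CPS. now rewrite (cvg_Clim_seq _ _ Hl).
Qed.

Lemma CPS_eq a z l : cvg (csum (fun k => a k * z ^ k)) l -> CPS a z = l.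
Proof. apply cvg_Clim_seq. Qed.

Lemma cvg_csum_term u l : cvg (csum u) l -> cvg u 0.
Proof.
intros H. replace (RtoC 0) with (l - l) by ring.
apply cvg_ext with (u := fun n => csum u (n + 1) - csum u n).
- intros n. rewrite Nat.add_1_r. simpl. ring.
- apply cvg_minus; auto. now apply cvg_incr.
Qed.

Lemma cvg_bounded u l : cvg u l -> exists M, forall n, (Cmod (u n) <= M)%R.
Proof.
intros H. destruct (proj1 (cvg_spec u l) H 1%R ltac:(lra)) as [N HN].
assert (B : forall K, exists M, forall n, (n < K)%nat -> (Cmod (u n) <= M)%R).
{ induction K as [|K [M HM]]; [exists 0%R; intros; lia|].
  exists (Rmax M (Cmod (u K))). intros n Hn.
  destruct (Nat.eq_dec n K) as [->|]; [apply Rmax_r|].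
  eapply Rle_trans; [apply HM; lia|apply Rmax_l]. }
destruct (B N) as [M HM]. exists (Rmax M (Cmod l + 1)). intros n.
destruct (le_lt_dec N n) as [Hn|Hn].
- eapply Rle_trans; [|apply Rmax_r]. specialize (HN n Hn).
  generalize (Cmod_triangle l (u n - l)). replace (l + (u n - l)) with (u n) by ring. lra.
- eapply Rle_trans; [now apply HM|apply Rmax_l].
Qed.

Lemma rad_of_cvg a r :
  (forall z : C, (Cmod z < r)%R -> exists l, cvg (csum (fun k => a k * z ^ k)) l) -> rad a r.
Proof.
intros H rho Hr. destruct (H (RtoC rho)) as [l Hl].
- rewrite Cmod_RtoC_pos; lra.
- destruct (cvg_bounded _ _ (cvg_csum_term _ _ Hl)) as [M HM]. exists M. intros k.
  specialize (HM k). rewrite Cmod_mult, Cmod_pow, Cmod_RtoC_pos in HM by lra. exact HM.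
Qed.

Lemma bernoulli_geom q k : (0 <= q < 1)%R -> (INR k * q ^ k <= / (1 - q))%R.
Proof.
intros Hq.
assert (Hi : (1 <= / (1 - q))%R).
{ rewrite <- Rinv_1 at 1. apply Rinv_le_contravar; lra. }
assert (A : (INR k * (1 - q) * q ^ k <= 1 - q ^ k)%R).
{ induction k; [simpl; lra|]. rewrite S_INR. simpl.
  assert (P : (0 <= q ^ k)%R) by (apply pow_le; lra).
  assert (P1 : (q ^ k <= 1)%R) by (rewrite <- (pow1 k); apply pow_incr; lra).
  generalize (pos_INR k). intros.
  assert (q * (INR k * (1 - q) * q ^ k) <= q * (1 - q ^ k))%R by (apply Rmult_le_compat_l; lra).
  assert (0 <= (1 - q) * (1 - q * q ^ k))%R by (apply Rmult_le_pos; nra). nra. }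
assert (P : (0 <= q ^ k)%R) by (apply pow_le; lra).
replace (INR k * q ^ k)%R with (INR k * (1 - q) * q ^ k * / (1 - q))%R by (field; lra).
rewrite <- (Rmult_1_l (/ (1 - q))) at 2. apply Rmult_le_compat_r; lra.
Qed.

(** The factor k costs an arbitrarily small loss of radius, as k q^k is bounded
    for q < 1. *)
Lemma rad_INR a r : rad a r -> rad (fun k => RtoC (INR k) * a k) r.
Proof.
intros Ha rho Hr.
set (s := ((rho + r) / 2)%R).
assert (Hs : (0 < s < r /\ rho < s)%R) by (unfold s; lra).
destruct (Ha s ltac:(lra)) as [M HM].
assert (Hq : (0 <= rho / s < 1)%R).
{ split; [apply Rdiv_le_0_compat; lra|]. apply Rlt_div_l; lra. }
exists (M * / (1 - rho / s))%R. intros k.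
rewrite Cmod_mult, Cmod_RtoC_pos by apply pos_INR.
replace (rho ^ k)%R with (s ^ k * (rho / s) ^ k)%R
  by (rewrite <- Rpow_mult_distr; f_equal; field; lra).
replace (INR k * Cmod (a k) * (s ^ k * (rho / s) ^ k))%R
  with ((Cmod (a k) * s ^ k) * (INR k * (rho / s) ^ k))%R by ring.
apply Rmult_le_compat; auto.
- apply Rmult_le_pos; [apply Cmod_ge_0|apply pow_le; lra].
- apply Rmult_le_pos; [apply pos_INR|apply pow_le; lra].
- now apply bernoulli_geom.
Qed.

Lemma rad_shift a r : (0 < r)%R -> rad a r -> rad (fun k => a (S k)) r.
Proof.
intros Hr Ha rho Hrho.
set (s := ((rho + r) / 2)%R).
assert (Hs : (0 < s < r /\ rho < s)%R) by (unfold s; lra).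
destruct (Ha s ltac:(lra)) as [M HM].
exists (M / s)%R. intros k. specialize (HM (S k)). simpl in HM.
apply le_div; [lra|].
eapply Rle_trans; [|exact HM].
rewrite Rmult_assoc. apply Rmult_le_compat_l; [apply Cmod_ge_0|].
rewrite Rmult_comm. apply Rmult_le_compat_l; [lra|]. apply pow_incr; lra.
Qed.

Definition der (a : nat -> C) (k : nat) : C := RtoC (INR (S k)) * a (S k).

Lemma rad_der a r : (0 < r)%R -> rad a r -> rad (der a) r.
Proof. intros Hr Ha. apply (rad_shift _ _ Hr (rad_INR _ _ Ha)). Qed.

(** The remainder is required to be quadratic in [h], as it is for power series;
    the chain rule along a path then needs no further limit. *)
Definition Cder (f : C -> C) (z l : C) : Prop :=
  exists K d : R, (0 < d)%R /\
    forall h, (Cmod h < d)%R -> (Cmod (f (z + h)%C - f z - l * h)%C <= K * (Cmod h * Cmod h))%R.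

(** Induction on [k] through (z + h)^(k+1) = (z + h) (z + h)^k.  Both sides are
    multiplied by rho^2, so that no negative power of rho occurs for k < 2. *)
Lemma Cpow_taylor (z h : C) rho k : (0 < rho)%R -> (Cmod z <= rho)%R -> (Cmod (z + h) <= rho)%R ->
  (Cmod ((z + h) ^ k - z ^ k - RtoC (INR k) * z ^ (k - 1) * h) * (rho * rho)
   <= INR k * INR k * rho ^ k * (Cmod h * Cmod h))%R.
Proof.
intros H0 Hz Hzh. induction k.
- simpl. replace (1 - 1 - 0 * 1 * h) with (RtoC 0) by ring. rewrite Cmod_0. lra.
- replace ((z + h) ^ S k - z ^ S k - RtoC (INR (S k)) * z ^ (S k - 1) * h)
    with ((z + h) * ((z + h) ^ k - z ^ k - RtoC (INR k) * z ^ (k - 1) * h)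
          + RtoC (INR k) * z ^ (k - 1) * (h * h)).
  + assert (P2 : (Cmod (RtoC (INR k) * z ^ (k - 1) * (h * h)) * (rho * rho)
               <= INR k * rho ^ S k * (Cmod h * Cmod h))%R).
    { rewrite !Cmod_mult, Cmod_pow, Cmod_RtoC_pos by apply pos_INR.
      destruct k as [|k]; [simpl; lra|].
      replace (S k - 1)%nat with k by lia.
      replace (INR (S k) * Cmod z ^ k * (Cmod h * Cmod h) * (rho * rho))%R
        with (INR (S k) * (Cmod h * Cmod h) * (rho * rho) * Cmod z ^ k)%R by ring.
      replace (INR (S k) * rho ^ S (S k) * (Cmod h * Cmod h))%R
        with (INR (S k) * (Cmod h * Cmod h) * (rho * rho) * rho ^ k)%R by (simpl; ring).
      apply Rmult_le_compat_l.
      - generalize (pos_INR (S k)) (Cmod_ge_0 h). intros. apply Rmult_le_pos; nra.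
      - apply pow_incr. split; auto. apply Cmod_ge_0. }
    eapply Rle_trans.
    { apply Rmult_le_compat_r; [nra|]. apply Cmod_triangle. }
    rewrite Rmult_plus_distr_r, Cmod_mult.
    set (X := Cmod ((z + h) ^ k - z ^ k - RtoC (INR k) * z ^ (k - 1) * h)) in *.
    assert (P1 : (Cmod (z + h) * X * (rho * rho) <= INR k * INR k * rho ^ S k * (Cmod h * Cmod h))%R).
    { replace (INR k * INR k * rho ^ S k * (Cmod h * Cmod h))%R
        with (rho * (INR k * INR k * rho ^ k * (Cmod h * Cmod h)))%R by (simpl; ring).
      rewrite Rmult_assoc. apply Rmult_le_compat; auto; try apply Cmod_ge_0.
      apply Rmult_le_pos; [apply Cmod_ge_0|nra]. }
    assert (P3 : (0 <= rho ^ S k * (Cmod h * Cmod h))%R).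
    { apply Rmult_le_pos; [apply pow_le; lra|]. generalize (Cmod_ge_0 h); nra. }
    rewrite S_INR. generalize (pos_INR k). intros.
    replace ((INR k + 1) * (INR k + 1) * rho ^ S k * (Cmod h * Cmod h))%R
      with (INR k * INR k * rho ^ S k * (Cmod h * Cmod h) + INR k * rho ^ S k * (Cmod h * Cmod h)
            + (INR k + 1) * (rho ^ S k * (Cmod h * Cmod h)))%R by ring.
    nra.
  + replace (S k - 1)%nat with k by lia. rewrite S_INR, RtoC_plus.
    destruct k as [|k]; [simpl; ring|].
    replace (S k - 1)%nat with k by lia. simpl. ring.
Qed.

(** The remainders of the single powers add up to at most a multiple of |h|^2,
    since k^2 |a k| rho^k is summable. *)
Lemma CPS_Cder a r z : rad a r -> (Cmod z < r)%R -> Cder (CPS a) z (CPS (der a) z).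
Proof.
intros Ha Hz.
assert (Hz0 := Cmod_ge_0 z).
set (rho := ((Cmod z + r) / 2)%R).
assert (Hrho : (0 < rho < r /\ Cmod z < rho)%R) by (unfold rho; lra).
assert (Hs := rad_summable _ _ rho (rad_INR _ _ (rad_INR _ _ Ha)) ltac:(lra)).
set (b := fun k => (Cmod (RtoC (INR k) * (RtoC (INR k) * a k)) * rho ^ k)%R) in *.
assert (Hb0 : forall k, (0 <= b k)%R).
{ intros k. apply Rmult_le_pos; [apply Cmod_ge_0|apply pow_le; lra]. }
exists (Series b / (rho * rho))%R, (rho - Cmod z)%R. split; [lra|].
intros h Hh.
assert (Hzh : (Cmod (z + h) <= rho)%R) by (generalize (Cmod_triangle z h); lra).
assert (L : cvg (fun N => csum (fun k => a k * ((z + h) ^ k - z ^ k - RtoC (INR k) * z ^ (k - 1) * h)) N)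
               (CPS a (z + h) - CPS a z - CPS (der a) z * h)).
{ apply (cvg_incr _ _ 1).
  apply cvg_ext with (u := fun N => csum (fun k => a k * (z + h) ^ k) (N + 1)
     - csum (fun k => a k * z ^ k) (N + 1) - csum (fun k => der a k * z ^ k) N * h).
  - intros N. rewrite Nat.add_1_r.
    assert (E : csum (fun k => der a k * z ^ k) N * h
       = csum (fun k => a k * (RtoC (INR k) * z ^ (k - 1) * h)) (S N)).
    { induction N; [simpl; ring|]. 
      rewrite !(csum_S _ (S N)). rewrite <- IHN. clear IHN.
      rewrite !(csum_S _ N). unfold der.
      replace (S N - 1)%nat with N by lia. ring. }
    rewrite E, <- !csum_minus. apply csum_ext. intros. ring.
  - apply cvg_minus; [apply cvg_minus|apply cvg_mult; [|apply cvg_const]].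
    + apply (cvg_incr (csum (fun k => a k * (z + h) ^ k))). apply CPS_cvg with r; auto. lra.
    + apply (cvg_incr (csum (fun k => a k * z ^ k))). apply CPS_cvg with r; auto.
    + apply CPS_cvg with r; auto. apply rad_der; auto. lra. }
apply (cvg_le_limit _ _ _ 0 L). intros N _.
eapply Rle_trans; [apply csum_le with (b := fun k => (b k * (Cmod h * Cmod h / (rho * rho)))%R)|].
- intros k _. rewrite Cmod_mult. unfold b.
  rewrite !Cmod_mult, !Cmod_RtoC_pos by apply pos_INR.
  assert (T := Cpow_taylor z h rho k ltac:(lra) ltac:(lra) Hzh).
  set (X := Cmod ((z + h) ^ k - z ^ k - RtoC (INR k) * z ^ (k - 1) * h)) in *.
  replace (INR k * (INR k * Cmod (a k)) * rho ^ k * (Cmod h * Cmod h / (rho * rho)))%R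
    with (Cmod (a k) * ((INR k * INR k * rho ^ k * (Cmod h * Cmod h)) / (rho * rho)))%R by (field; lra).
  apply Rmult_le_compat_l; [apply Cmod_ge_0|].
  apply le_div; [nra|]. exact T.
- replace (rsum (fun k => (b k * (Cmod h * Cmod h / (rho * rho)))%R) N)
    with (rsum b N * (Cmod h * Cmod h / (rho * rho)))%R.
  + replace (Series b / (rho * rho) * (Cmod h * Cmod h))%R
      with (Series b * (Cmod h * Cmod h / (rho * rho)))%R by (field; lra).
    apply Rmult_le_compat_r; [|now apply rsum_le_Series].
    apply Rdiv_le_0_compat; [|nra]. generalize (Cmod_ge_0 h); nra.
  + clear. induction N; simpl; [ring|]. rewrite <- IHN. ring.
Qed.

Lemma is_derive_Lipschitz (f : R -> R) t l : is_derive f t l ->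
  exists d : R, (0 < d)%R /\ forall h, (Rabs h < d)%R -> (Rabs (f (t + h)%R - f t) <= (Rabs l + 1) * Rabs h)%R.
Proof.
intros H. apply is_derive_Reals in H.
destruct (H 1%R ltac:(lra)) as [d Hd]. exists d. split; [apply cond_pos|].
intros h Hh. destruct (Req_dec h 0) as [->|Hn].
- rewrite Rplus_0_r, Rminus_diag, Rabs_R0. lra.
- specialize (Hd h Hn Hh).
  replace (f (t + h)%R - f t)%R with (((f (t + h)%R - f t) / h - l) * h + l * h)%R by (field; auto).
  eapply Rle_trans; [apply Rabs_triang|]. rewrite !Rabs_mult.
  generalize (Rabs_pos h) (Rabs_pos l). nra.
Qed.

Lemma Dt_Lipschitz f t l : Dt f t l ->
  exists K d : R, (0 < d)%R /\ (0 <= K)%R /\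
    forall h, (Rabs h < d)%R -> (Cmod (f (t + h)%R - f t)%C <= K * Rabs h)%R.
Proof.
intros [H1 H2].
destruct (is_derive_Lipschitz _ _ _ H1) as [d1 [Hd1 B1]].
destruct (is_derive_Lipschitz _ _ _ H2) as [d2 [Hd2 B2]].
exists (Rabs (Re l) + 1 + (Rabs (Im l) + 1))%R, (Rmin d1 d2).
split; [now apply Rmin_glb_lt|].
split; [generalize (Rabs_pos (Re l)) (Rabs_pos (Im l)); lra|].
intros h Hh. eapply Rle_trans; [apply Cmod_le_Re_Im|].
rewrite Rmult_plus_distr_r. apply Rplus_le_compat.
- apply B1. rmin Hh.
- apply B2. rmin Hh.
Qed.

Lemma is_derive_0_quadratic (r : R -> R) t K d : (0 < d)%R -> r t = 0%R ->
  (forall h, (Rabs h < d)%R -> (Rabs (r (t + h)%R) <= K * (Rabs h * Rabs h))%R) ->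
  is_derive r t 0%R.
Proof.
intros Hd H0 H. apply is_derive_Reals. intros eps Heps.
assert (HK := Rabs_pos K).
assert (Hd' : (0 < Rmin d (eps / (Rabs K + 1)))%R).
{ apply Rmin_glb_lt; auto. apply Rdiv_lt_0_compat; lra. }
exists (mkposreal _ Hd'). simpl. intros h Hn Hh.
assert (Hh1 : (Rabs h < d)%R) by (rmin Hh).
assert (Hh2 : (Rabs h < eps / (Rabs K + 1))%R) by (rmin Hh).
assert (Hp : (0 < Rabs h)%R) by now apply Rabs_pos_lt.
rewrite H0. replace ((r (t + h)%R - 0) / h - 0)%R with (r (t + h)%R / h)%R by (field; auto).
unfold Rdiv. rewrite Rabs_mult, Rabs_inv.
apply Rle_lt_trans with (K * (Rabs h * Rabs h) * / Rabs h)%R.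
{ apply Rmult_le_compat_r; auto. apply Rlt_le, Rinv_0_lt_compat, Hp. }
replace (K * (Rabs h * Rabs h) * / Rabs h)%R with (K * Rabs h)%R by (field; lra).
apply Rlt_div_r in Hh2; [|lra]. generalize (Rle_abs K). nra.
Qed.

Lemma Cder_Dt f g t l m : Cder f (g t) l -> Dt g t m -> Dt (fun x => f (g x)) t (l * m).
Proof.
intros [K [d [Hd HK]]] Hg.
destruct (Dt_Lipschitz _ _ _ Hg) as [K2 [d2 [Hd2 [HK2 HL]]]].
set (r := fun x => f (g x) - f (g t) - l * (g x - g t)).
assert (Hr : Dt r t 0).
{ assert (Hd3 : (0 < Rmin d2 (d / (K2 + 1)))%R).
  { apply Rmin_glb_lt; auto. apply Rdiv_lt_0_compat; lra. }
  assert (B : forall h, (Rabs h < Rmin d2 (d / (K2 + 1)))%R ->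
     (Cmod (r (t + h)%R) <= (Rabs K * (K2 * K2)) * (Rabs h * Rabs h))%R).
  { intros h Hh.
    assert (Hh1 : (Rabs h < d2)%R) by (rmin Hh).
    assert (Hh2 : (Rabs h < d / (K2 + 1))%R) by (rmin Hh).
    apply Rlt_div_r in Hh2; [|lra]. specialize (HL h Hh1).
    assert (Hc := Cmod_ge_0 (g (t + h)%R - g t)). assert (Ha := Rabs_pos h).
    unfold r. specialize (HK (g (t + h)%R - g t)).
    replace (g t + (g (t + h)%R - g t)) with (g (t + h)%R) in HK by ring.
    eapply Rle_trans; [apply HK; nra|].
    set (c := Cmod (g (t + h)%R - g t)) in *.
    assert (c * c <= (K2 * Rabs h) * (K2 * Rabs h))%R by (apply Rmult_le_compat; auto).
    generalize (Rle_abs K) (Rabs_pos K). intros.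
    apply Rle_trans with (Rabs K * (c * c))%R; [apply Rmult_le_compat_r; nra|].
    replace (Rabs K * (K2 * K2) * (Rabs h * Rabs h))%R
      with (Rabs K * ((K2 * Rabs h) * (K2 * Rabs h)))%R by ring.
    apply Rmult_le_compat_l; auto. }
  assert (R0 : r t = 0) by (unfold r; ring).
  split; (eapply is_derive_0_quadratic; [exact Hd3| |]).
  - now rewrite R0.
  - intros h Hh. eapply Rle_trans; [apply Re_le_Cmod|]. now apply B.
  - now rewrite R0.
  - intros h Hh. eapply Rle_trans; [apply Im_le_Cmod|]. now apply B. }
apply Dt_ext with (fun x => r x + f (g t) + l * (g x - g t)).
- intros x. unfold r. ring.
- eapply Dt_eq.
  + apply Dt_plus; [apply Dt_plus; [exact Hr|apply Dt_const]|].
    apply Dt_scal. apply Dt_minus; [exact Hg|apply Dt_const].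
  + ring.
Qed.

Lemma Cder_unique f z l l' : Cder f z l -> Cder f z l' -> l = l'.
Proof.
intros H H'.
assert (A : forall l, Cder f z l -> Dt (fun x => f (z + RtoC x * 1)) 0%R (l * 1)).
{ intros m Hm. apply (Cder_Dt f (fun x => z + RtoC x * 1) 0%R m 1).
  - replace (z + 0 * 1) with z by ring. exact Hm.
  - apply Dt_affine. }
assert (E := Dt_unique _ _ _ _ (A _ H) (A _ H')).
now rewrite !Cmult_1_r in E.
Qed.

Lemma Cder_ext_loc f g z l d : (0 < d)%R ->
  (forall z', (Cmod (z' - z) < d)%R -> f z' = g z') -> Cder f z l -> Cder g z l.
Proof.
intros Hd H [K [d' [Hd' HK]]]. exists K, (Rmin d d'). split; [now apply Rmin_glb_lt|].
intros h Hh. rewrite <- !H.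
- apply HK. rmin Hh.
- replace (z - z) with (RtoC 0) by ring. now rewrite Cmod_0.
- replace (z + h - z) with h by ring. rmin Hh.
Qed.

Lemma Cder_translate f c z l : Cder f (z - c) l -> Cder (fun w => f (w - c)) z l.
Proof.
intros [K [d [Hd HK]]]. exists K, d. split; auto. intros h Hh.
replace (z + h - c) with (z - c + h) by ring. now apply HK.
Qed.

(** * Analytic functions and the identity theorem *)

Definition locally_CPS (f : C -> C) (z0 : C) : Prop :=
  exists (a : nat -> C) (r : R), (0 < r)%R /\ rad a r /\
    forall z, (Cmod (z - z0) < r)%R -> f z = CPS a (z - z0).

Lemma analytic_at_CPS f z0 : analytic_at f z0 -> locally_CPS f z0.
Proof.
intros [a [r [Hr H]]].
assert (L : forall z, (Cmod (z - z0) < r)%R -> cvg (csum (fun k => a k * (z - z0) ^ k)) (f z)).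
{ intros z Hz. specialize (H z Hz).
  apply cvg_ext with (u := csum (fun k => scal (pow_n (K := C_Ring) (z - z0) k) (a k))).
  - intros N. apply csum_ext. intros k _. rewrite pow_n_Cpow. apply Cmult_comm.
  - apply is_series_cvg. exact H. }
exists a, r. split; auto. split.
- apply rad_of_cvg. intros z Hz. exists (f (z0 + z)).
  specialize (L (z0 + z)). replace (z0 + z - z0) with z in L by ring. auto.
- intros z Hz. symmetry. apply CPS_eq. auto.
Qed.

Lemma CPS_0 a : CPS a 0 = a O.
Proof.
apply CPS_eq. apply cvg_ext_loc with (N := 1%nat) (u := fun _ => a O).
- intros n Hn. destruct n as [|n]; [lia|]. clear. induction n.
  + simpl. ring.
  + rewrite !(csum_S _ (S n)). rewrite <- IHn. simpl. ring.
- apply cvg_const.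
Qed.

Lemma CPS_neq_0_near a r : (0 < r)%R -> rad a r -> a O <> 0 ->
  exists d, (0 < d)%R /\ forall z, (0 < Cmod z < d)%R -> CPS a z <> 0.
Proof.
intros Hr Ha Hm.
assert (H0 : (Cmod 0 < r)%R) by (rewrite Cmod_0; auto).
destruct (CPS_Cder a r 0 Ha H0) as [K [d [Hd HK]]].
set (l := CPS (der a) 0) in *.
assert (Hp : (0 < Cmod (a O))%R) by now apply Cmod_gt_0.
assert (Hc := Cmod_ge_0 l). assert (HK0 := Rabs_pos K).
set (e := (Cmod (a O) / (2 * (Cmod l + Rabs K + 1)))%R).
assert (He : (0 < e)%R) by (apply Rdiv_lt_0_compat; lra).
exists (Rmin (Rmin d 1) e). split; [repeat apply Rmin_glb_lt; lra|].
intros z [Hz0 Hz] E.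
assert (Z1 : (Cmod z < d)%R) by (rmin Hz).
assert (Z2 : (Cmod z < 1)%R) by (rmin Hz).
assert (Z3 : (Cmod z < e)%R) by (rmin Hz).
specialize (HK z Z1). rewrite Cplus_0_l, CPS_0, E in HK.
apply Rlt_div_r in Z3; [|lra].
assert (T := Cmod_triangle_inv (a O) (l * z)).
replace (0 - a O - l * z) with (- (a O + l * z)) in HK by ring.
rewrite Cmod_opp in HK. rewrite Cmod_mult in T.
assert (K * (Cmod z * Cmod z) <= Rabs K * Cmod z)%R.
{ apply Rle_trans with (Rabs K * (Cmod z * Cmod z))%R.
  - apply Rmult_le_compat_r; [nra|apply Rle_abs].
  - apply Rmult_le_compat_l; auto. nra. }
nra.
Qed.

(** After division by the largest possible power of [z] the constant term is
    nonzero, and the quotient is continuous. *)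
Lemma CPS_isolated_zero a r m : (0 < r)%R -> rad a r -> a m <> 0 ->
  exists d, (0 < d)%R /\ forall z, (0 < Cmod z < d)%R -> CPS a z <> 0.
Proof.
intros Hr. revert a. induction m as [|m IH]; intros a Ha Hm.
- now apply CPS_neq_0_near with r.
- destruct (excluded_middle_informative (a O = 0)) as [H0|H0].
  + destruct (IH _ (rad_shift _ _ Hr Ha) Hm) as [d [Hd Hz]].
    exists (Rmin d r). split; [now apply Rmin_glb_lt|].
    intros z [Z0 Z1].
    assert (Zd : (Cmod z < d)%R) by (rmin Z1).
    assert (Zr : (Cmod z < r)%R) by (rmin Z1).
    replace (CPS a z) with (z * CPS (fun k => a (S k)) z).
    * apply Cmult_neq_0; [now apply Cmod_gt_0|]. apply Hz. lra.
    * symmetry. apply CPS_eq. apply (cvg_incr _ _ 1).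
      apply cvg_ext with (u := fun N => z * csum (fun k => a (S k) * z ^ k) N).
      -- intros N. rewrite Nat.add_1_r. induction N.
         ++ simpl. rewrite H0. ring.
         ++ rewrite !(csum_S _ (S N)). rewrite <- IHN. simpl. ring.
      -- apply cvg_mult; [apply cvg_const|]. apply CPS_cvg with r; auto. now apply rad_shift.
  + now apply CPS_neq_0_near with r.
Qed.

Lemma rsum_sum_f_R0 f n : sum_f_R0 f n = rsum f (S n).
Proof. induction n; simpl; [ring|]. rewrite IHn. reflexivity. Qed.

Lemma is_series_rsum u (l : R) : is_lim_seq (rsum u) l -> is_series u l.
Proof.
intros H. apply is_lim_seq_incr_1 in H.
change (is_lim_seq (sum_n u) l).
apply is_lim_seq_ext with (2 := H). intros. apply rsum_sum_n.
Qed.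

Lemma Re_csum u N : Re (csum u N) = rsum (fun k => Re (u k)) N.
Proof. induction N; simpl; [reflexivity|]. rewrite <- IHN. reflexivity. Qed.

Lemma Im_csum u N : Im (csum u N) = rsum (fun k => Im (u k)) N.
Proof. induction N; simpl; [reflexivity|]. rewrite <- IHN. reflexivity. Qed.

Lemma rsum_ext u v N : (forall k, u k = v k) -> rsum u N = rsum v N.
Proof. intros H. induction N; simpl; [auto|]. now rewrite IHN, H. Qed.

Lemma rsum_plus u v N : rsum (fun k => (u k + v k)%R) N = (rsum u N + rsum v N)%R.
Proof. induction N; simpl; [ring|rewrite IHN; ring]. Qed.

Lemma rsum_minus u v N : rsum (fun k => (u k - v k)%R) N = (rsum u N - rsum v N)%R.
Proof. induction N; simpl; [ring|rewrite IHN; ring]. Qed.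

Definition conv (a b : nat -> C) (n : nat) : C := csum (fun k => a k * b (n - k)%nat) (S n).

(** The real Cauchy product theorem, applied to real and imaginary parts. *)
Lemma csum_conv a b la lb :
  ex_series (fun k => Cmod (a k)) -> ex_series (fun k => Cmod (b k)) ->
  cvg (csum a) la -> cvg (csum b) lb -> cvg (csum (conv a b)) (la * lb).
Proof.
intros Ea Eb Ha Hb.
apply cvg_comp in Ha, Hb. destruct Ha as [Ha1 Ha2], Hb as [Hb1 Hb2].
assert (P : forall u, ex_series (fun k => Cmod (u k)) ->
   ex_series (fun k => Rabs (Re (u k))) /\ ex_series (fun k => Rabs (Im (u k)))).
{ intros u Hu. split; apply (ex_series_dom _ (fun k => Cmod (u k))); auto;
  intros n; rewrite Rabs_Rabsolu;
  [apply Re_le_Cmod|apply Im_le_Cmod]. }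
assert (Q : forall u v (l m : R), is_lim_seq (rsum u) l -> is_lim_seq (rsum v) m ->
   ex_series (fun k => Rabs (u k)) -> ex_series (fun k => Rabs (v k)) ->
   is_lim_seq (rsum (fun n => rsum (fun k => (u k * v (n - k)%nat)%R) (S n))) (l * m)%R).
{ intros u v l m Hu Hv Xu Xv. apply rsum_lim.
  apply is_series_ext with (fun n => sum_f_R0 (fun k => (u k * v (n - k)%nat)%R) n).
  - intros n. apply rsum_sum_f_R0.
  - apply is_series_mult; auto; now apply is_series_rsum. }
assert (L : forall p u l, (forall N, p (csum u N) = rsum (fun k => p (u k)) N) ->
   is_lim_seq (fun n => p (csum u n)) l -> is_lim_seq (rsum (fun k => p (u k))) l).
{ intros p u l E H. apply is_lim_seq_ext with (2 := H). auto. }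
apply (L Re) in Ha1, Hb1; try (intros; apply Re_csum).
apply (L Im) in Ha2, Hb2; try (intros; apply Im_csum).
destruct (P a Ea) as [Ea1 Ea2], (P b Eb) as [Eb1 Eb2].
apply cvg_comp. split.
- eapply is_lim_seq_ext; [|apply is_lim_seq_minus'; [apply (Q _ _ _ _ Ha1 Hb1 Ea1 Eb1)|apply (Q _ _ _ _ Ha2 Hb2 Ea2 Eb2)]].
  intros N. cbv beta. rewrite Re_csum, <- rsum_minus. apply rsum_ext. intros k.
  unfold conv. rewrite Re_csum, <- rsum_minus. apply rsum_ext. reflexivity.
- eapply is_lim_seq_ext; [|apply is_lim_seq_plus'; [apply (Q _ _ _ _ Ha1 Hb2 Ea1 Eb2)|apply (Q _ _ _ _ Ha2 Hb1 Ea2 Eb1)]].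
  intros N. cbv beta. rewrite Im_csum, <- rsum_plus. apply rsum_ext. intros k.
  unfold conv. rewrite Im_csum, <- rsum_plus. apply rsum_ext. reflexivity.
Qed.

Lemma CPS_conv a b r z : rad a r -> rad b r -> (Cmod z < r)%R ->
  cvg (csum (fun k => conv a b k * z ^ k)) (CPS a z * CPS b z).
Proof.
intros Ha Hb Hz.
assert (E : forall c, rad c r -> ex_series (fun k => Cmod (c k * z ^ k))).
{ intros c Hc. apply ex_series_ext with (fun k => (Cmod (c k) * Cmod z ^ k)%R).
  - intros n. now rewrite Cmod_mult, Cmod_pow.
  - apply rad_summable with r; auto. split; auto. apply Cmod_ge_0. }
eapply cvg_ext; [|apply (csum_conv _ _ _ _ (E a Ha) (E b Hb)); apply CPS_cvg with r; auto].
intros N. apply csum_ext. intros n _. unfold conv.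
rewrite (Cmult_comm (csum _ _)), <- csum_scal. apply csum_ext. intros k Hk.
replace n with (k + (n - k))%nat at 3 by lia. rewrite Cpow_add_r. ring.
Qed.

Lemma locally_CPS_mult f g z0 : locally_CPS f z0 -> locally_CPS g z0 -> locally_CPS (fun z => f z * g z) z0.
Proof.
intros [a [r [Hr [Ra Ha]]]] [b [r' [Hr' [Rb Hb]]]].
set (s := Rmin r r').
assert (Hs : (0 < s)%R) by now apply Rmin_glb_lt.
assert (W : forall c q, (s <= q)%R -> rad c q -> rad c s).
{ intros c q Hq Hc rho Hrho. apply Hc. lra. }
assert (L : forall z, (Cmod z < s)%R -> cvg (csum (fun k => conv a b k * z ^ k)) (CPS a z * CPS b z)).
{ intros z Hz. apply CPS_conv with s; auto.
  - apply (W a r); auto. apply Rmin_l.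
  - apply (W b r'); auto. apply Rmin_r. }
exists (conv a b), s. split; auto. split.
- apply rad_of_cvg. intros z Hz. eexists. now apply L.
- intros z Hz. rewrite Ha, Hb.
  + symmetry. apply CPS_eq. now apply L.
  + rmin Hz.
  + rmin Hz.
Qed.

Lemma locally_CPS_add_const f c z0 : locally_CPS f z0 -> locally_CPS (fun z => f z + c) z0.
Proof.
intros [a [r [Hr [Ra Ha]]]].
set (b := fun k => match k with O => a O + c | S _ => a k end).
assert (L : forall z, (Cmod z < r)%R -> cvg (csum (fun k => b k * z ^ k)) (CPS a z + c)).
{ intros z Hz.
  apply cvg_ext_loc with (N := 1%nat) (u := fun N => csum (fun k => a k * z ^ k) N + c).
  - intros n Hn. destruct n as [|n]; [lia|]. clear Hn. induction n.
    + simpl. ring.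
    + rewrite !(csum_S _ (S n)). rewrite <- IHn. simpl. ring.
  - apply cvg_plus; [|apply cvg_const]. now apply CPS_cvg with r. }
exists b, r. split; auto. split.
- apply rad_of_cvg. intros z Hz. eexists. now apply L.
- intros z Hz. rewrite Ha by auto. symmetry. apply CPS_eq. now apply L.
Qed.

Definition exp_coef (k : nat) : C := RtoC (/ INR (fact k)).

Lemma exp_coef_rad r : rad exp_coef r.
Proof.
intros rho Hr. exists (exp rho). intros k.
assert (Hs := is_exp_Reals rho).
assert (Hp : forall n, (0 < / INR (fact n))%R) by (intros; apply Rinv_0_lt_compat, INR_fact_lt_0).
unfold exp_coef. rewrite Cmod_RtoC_pos by (apply Rlt_le, Hp).
set (u := fun n => (/ INR (fact n) * rho ^ n)%R).
assert (Hu : is_series u (exp rho)).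
{ eapply is_series_ext; [|exact Hs]. intros n. simpl.
  unfold u. rewrite pow_n_pow. unfold scal; simpl; unfold mult; simpl. ring. }
assert (Hu0 : forall n, (0 <= u n)%R).
{ intros n. apply Rmult_le_pos; [apply Rlt_le, Hp|apply pow_le; lra]. }
assert (B := rsum_le_Series u (S k) Hu0 (ex_intro _ _ Hu)).
rewrite (is_series_unique _ _ Hu) in B. simpl in B.
assert (0 <= rsum u k)%R by (clear - Hu0; induction k; simpl; [lra|]; specialize (Hu0 k); lra).
fold (u k). lra.
Qed.

(** The series solves g' = g, so its product with e^{-z} is constant along the
    segment from 0 to z. *)
Lemma CPS_exp_coef z : CPS exp_coef z = Cexp z.
Proof.
assert (D : forall w, Cder (CPS exp_coef) w (CPS exp_coef w)).
{ intros w. replace (CPS exp_coef w) with (CPS (der exp_coef) w) at 1.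
  - apply CPS_Cder with (Cmod w + 1)%R; [apply exp_coef_rad|lra].
  - unfold CPS. f_equal. apply functional_extensionality. intros N.
    apply csum_ext. intros k _. f_equal. unfold der, exp_coef.
    rewrite <- RtoC_mult. f_equal. rewrite fact_simpl, mult_INR. field.
    split; [apply INR_fact_neq_0|apply not_0_INR; lia]. }
assert (E : CPS exp_coef (RtoC 1 * z) * Cexp (- (RtoC 1 * z)) = CPS exp_coef (RtoC 0 * z) * Cexp (- (RtoC 0 * z))).
{ apply (Dt_zero_const (fun t => CPS exp_coef (RtoC t * z) * Cexp (- (RtoC t * z)))).
  intros t _.
  assert (Dz : Dt (fun t => RtoC t * z) t z).
  { apply Dt_ext with (fun x => 0 + RtoC x * z); [intros; ring|]. apply Dt_affine. }
  eapply Dt_eq.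
  - apply Dt_mult; [apply Cder_Dt; [apply D|exact Dz]|].
    apply Dt_exp. apply Dt_opp. exact Dz.
  - cbv beta. ring. }
rewrite Cmult_0_l, Cmult_1_l, CPS_0, Copp_0, Cexp_0 in E.
unfold exp_coef at 2 in E. simpl in E. rewrite Rinv_1 in E.
replace (CPS exp_coef z) with (CPS exp_coef z * Cexp (- z) * Cexp z).
- rewrite E. ring.
- rewrite <- Cmult_assoc, Cexp_opp_l. ring.
Qed.

Lemma locally_CPS_exp z0 : locally_CPS Cexp z0.
Proof.
exists (fun k => Cexp z0 * exp_coef k), 1%R. split; [lra|]. split.
- intros rho Hr. destruct (exp_coef_rad 1%R rho Hr) as [M HM].
  exists (Cmod (Cexp z0) * M)%R. intros k. rewrite Cmod_mult, Rmult_assoc.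
  apply Rmult_le_compat_l; auto. apply Cmod_ge_0.
- intros z Hz. symmetry. apply CPS_eq.
  apply cvg_ext with (u := fun N => Cexp z0 * csum (fun k => exp_coef k * (z - z0) ^ k) N).
  + intros N. rewrite <- csum_scal. apply csum_ext. intros. ring.
  + replace (Cexp z) with (Cexp z0 * CPS exp_coef (z - z0)).
    * apply cvg_mult; [apply cvg_const|]. apply CPS_cvg with 1%R; auto. apply exp_coef_rad.
    * rewrite CPS_exp_coef, <- Cexp_plus. f_equal. ring.
Qed.

(** A choice of the derivative wherever there is one, so that derivatives can be
    iterated. *)
Definition Cdrv (f : C -> C) (z : C) : C := epsilon (inhabits (RtoC 0)) (Cder f z).

Lemma Cdrv_eq f z l : Cder f z l -> Cdrv f z = l.
Proof.
intros H. apply Cder_unique with f z; auto. unfold Cdrv. apply epsilon_spec. now exists l.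
Qed.

Lemma locally_CPS_disc_Cder f z0 : locally_CPS f z0 -> exists (a : nat -> C) (r : R), (0 < r)%R /\ rad a r /\ forall z, (Cmod (z - z0) < r)%R -> Cder f z (CPS (der a) (z - z0)).
Proof.
intros [a [r [Hr [Ra Ha]]]]. exists a, r. repeat split; auto.
intros z Hz. apply Cder_ext_loc with (fun w => CPS a (w - z0)) (r - Cmod (z - z0))%R; [lra| |].
- intros z' Hz'. symmetry. apply Ha. replace (z' - z0) with ((z' - z) + (z - z0)) by ring.
  generalize (Cmod_triangle (z' - z) (z - z0)). lra.
- apply Cder_translate. now apply CPS_Cder with r.
Qed.

Lemma locally_CPS_Cder f z0 : locally_CPS f z0 -> Cder f z0 (Cdrv f z0).
Proof.
intros H. destruct (locally_CPS_disc_Cder f z0 H) as [a [r [Hr [Ra Ha]]]].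
assert (Hd : Cder f z0 (CPS (der a) (z0 - z0))).
{ apply Ha. replace (z0 - z0) with (RtoC 0) by ring. now rewrite Cmod_0. }
now rewrite (Cdrv_eq _ _ _ Hd).
Qed.

Lemma locally_CPS_Cdrv f z0 : locally_CPS f z0 -> locally_CPS (Cdrv f) z0.
Proof.
intros H. destruct (locally_CPS_disc_Cder f z0 H) as [a [r [Hr [Ra Ha]]]].
exists (der a), r. split; auto. split; [now apply rad_der|].
intros z Hz. now apply Cdrv_eq, Ha.
Qed.

(** Either the power series at a point vanishes identically, or the point is
    not a limit of other zeros: this separates the domain into two open sets. *)
Lemma identity_theorem (U : C -> Prop) (f : C -> C) (z1 : C) (d1 : R) :
  open U -> connected U -> (forall z, U z -> locally_CPS f z) ->
  U z1 -> (0 < d1)%R -> (forall z, (Cmod (z - z1) < d1)%R -> f z = 0) ->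
  forall z, U z -> f z = 0.
Proof.
intros HU Hc Ha Hz1 Hd1 H1.
rewrite open_C_iff in HU.
set (V := fun z => U z /\ exists d, (0 < d)%R /\ forall z', (Cmod (z' - z) < d)%R -> f z' = 0).
set (W := fun z => U z /\ exists d, (0 < d)%R /\ forall z', (0 < Cmod (z' - z) < d)%R -> f z' <> 0).
destruct (Hc V W) as [HV|HW].
- apply open_C_iff. intros z [Hz [d [Hd Hv]]]. destruct (HU z Hz) as [e [He Hue]].
  exists (Rmin d e). split; [now apply Rmin_glb_lt|]. intros z' Hz'.
  assert (Hz'd : (Cmod (z' - z) < d)%R) by (rmin Hz').
  split; [apply Hue; rmin Hz'|].
  exists (d - Cmod (z' - z))%R. split; [lra|]. intros w Hw. apply Hv.
  replace (w - z) with ((w - z') + (z' - z)) by ring.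
  generalize (Cmod_triangle (w - z') (z' - z)). lra.
- apply open_C_iff. intros z [Hz [d [Hd Hv]]]. destruct (HU z Hz) as [e [He Hue]].
  exists (Rmin d e). split; [now apply Rmin_glb_lt|]. intros z' Hz'.
  assert (Hz'd : (Cmod (z' - z) < d)%R) by (rmin Hz').
  split; [apply Hue; rmin Hz'|].
  destruct (Req_dec (Cmod (z' - z)) 0) as [E|E].
  + apply Cmod_eq_0, (proj2 (Ceq_minus _ _)) in E. subst z'. exists d. auto.
  + assert (E' := Cmod_ge_0 (z' - z)).
    exists (Rmin (d - Cmod (z' - z)) (Cmod (z' - z))). split; [apply Rmin_glb_lt; lra|].
    intros w [W0 W1]. apply Hv.
    assert (A1 : (Cmod (w - z') < d - Cmod (z' - z))%R) by (rmin W1).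
    assert (A2 : (Cmod (w - z') < Cmod (z' - z))%R) by (rmin W1).
    replace (w - z) with ((z' - z) + (w - z')) by ring.
    generalize (Cmod_triangle (z' - z) (w - z')) (Cmod_triangle_inv (z' - z) (w - z')). lra.
- intros z Hz. destruct (Ha z Hz) as [a [r [Hr [Ra Hf]]]].
  destruct (excluded_middle_informative (exists m, a m <> 0)) as [[m Hm]|Hn].
  + right. split; auto. destruct (CPS_isolated_zero a r m Hr Ra Hm) as [d [Hd Hnz]].
    exists (Rmin d r). split; [now apply Rmin_glb_lt|]. intros z' [Z0 Z1].
    rewrite Hf by (rmin Z1).
    apply Hnz. split; auto. rmin Z1.
  + left. split; auto. exists r. split; auto. intros z' Hz'. rewrite Hf by auto.
    apply CPS_eq. apply cvg_ext with (u := fun _ => RtoC 0); [|apply cvg_const].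
    intros N. induction N; simpl; auto. rewrite <- IHN.
    assert (a N = 0) as -> by (apply NNPP; intros X; apply Hn; eauto). ring.
- intros z Hz [[_ [d [Hd Hv]]] [_ [e [He Hw]]]].
  assert (Hm : (0 < Rmin d e)%R) by now apply Rmin_glb_lt.
  generalize (Rmin_l d e) (Rmin_r d e). intros.
  assert (E : z + RtoC (Rmin d e / 2) - z = RtoC (Rmin d e / 2)) by ring.
  apply (Hw (z + RtoC (Rmin d e / 2))); [|apply Hv]; rewrite E, Cmod_RtoC_pos; lra.
- intros z Hz. destruct (HV z Hz) as [_ [d [Hd Hv]]]. apply Hv.
  replace (z - z) with (RtoC 0) by ring. now rewrite Cmod_0.
- exfalso. destruct (HW z1 Hz1) as [_ [d [Hd Hw]]].
  assert (Hm : (0 < Rmin d d1)%R) by now apply Rmin_glb_lt.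
  generalize (Rmin_l d d1) (Rmin_r d d1). intros.
  assert (E : z1 + RtoC (Rmin d d1 / 2) - z1 = RtoC (Rmin d d1 / 2)) by ring.
  apply (Hw (z1 + RtoC (Rmin d d1 / 2))); [|apply H1]; rewrite E, Cmod_RtoC_pos; lra.
Qed.

(** * The dilogarithm and the logarithm on the right half-plane *)

Definition li2_coef (k : nat) : C := match k with O => 0 | S _ => RtoC (/ (INR k * INR k)) end.
Definition log_coef (k : nat) : C := match k with O => 0 | S _ => RtoC (- / INR k) end.

Lemma rad_of_bounded a : (forall k, (Cmod (a k) <= 1)%R) -> rad a 1.
Proof.
intros H rho Hr. exists 1%R. intros k.
assert (0 <= rho ^ k)%R by (apply pow_le; lra).
assert (rho ^ k <= 1)%R by (rewrite <- (pow1 k); apply pow_incr; lra).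
specialize (H k). generalize (Cmod_ge_0 (a k)). nra.
Qed.

Lemma INR_S_ge_1 k : (1 <= INR (S k))%R.
Proof. rewrite S_INR. generalize (pos_INR k). lra. Qed.

Lemma li2_coef_rad : rad li2_coef 1.
Proof.
apply rad_of_bounded. intros [|k]; unfold li2_coef; [rewrite Cmod_0; lra|].
generalize (INR_S_ge_1 k). intros. rewrite Cmod_RtoC_pos.
- rewrite <- Rinv_1. apply Rinv_le_contravar; nra.
- apply Rlt_le, Rinv_0_lt_compat. nra.
Qed.

Lemma log_coef_rad : rad log_coef 1.
Proof.
apply rad_of_bounded. intros [|k]; unfold log_coef; [rewrite Cmod_0; lra|].
generalize (INR_S_ge_1 k). intros. rewrite RtoC_opp, Cmod_opp, Cmod_RtoC_pos.
- rewrite <- Rinv_1. apply Rinv_le_contravar; nra.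
- apply Rlt_le, Rinv_0_lt_compat. nra.
Qed.

Lemma Cder_log_series (x : C) : (Cmod x < 1)%R -> Cder (CPS log_coef) x (- / (1 - x)).
Proof.
intros Hx.
assert (Hn : 1 - x <> 0).
{ intros E. assert (x = 1) by (replace x with (1 - (1 - x)) by ring; rewrite E; ring).
  subst x. rewrite Cmod_1 in Hx. lra. }
replace (- / (1 - x)) with (CPS (der log_coef) x).
{ apply CPS_Cder with 1%R; auto. apply log_coef_rad. }
assert (L := CPS_cvg _ _ _ (rad_der _ _ Rlt_0_1 log_coef_rad) Hx).
assert (E : forall N, csum (fun k => der log_coef k * x ^ k) N = (x ^ N - 1) / (1 - x)).
{ intros N. induction N; [simpl; field; auto|].
  rewrite !(csum_S _ N). rewrite IHN.
  replace (der log_coef N) with (- RtoC 1).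
  - simpl. field. auto.
  - unfold der, log_coef. rewrite <- RtoC_mult, <- RtoC_opp. f_equal. field. apply not_0_INR. lia. }
apply (cvg_unique _ _ _ L).
apply cvg_ext with (u := fun N => (x ^ N - 1) / (1 - x)); [intros; now rewrite E|].
replace (- / (1 - x)) with ((0 - 1) * / (1 - x)) by (field; auto).
apply cvg_mult; [|apply cvg_const]. apply cvg_minus; [|apply cvg_const].
apply cvg_le with (N := O) (b := fun N => (Cmod x ^ N)%R).
- intros n _. replace (x ^ n - 0) with (x ^ n) by ring. rewrite Cmod_pow. lra.
- apply is_lim_seq_geom. rewrite Rabs_pos_eq; auto. apply Cmod_ge_0.
Qed.

(** x Li_2' (x) = - log (1 - x); at x = 0 division by x is not possible. *)
Lemma Cder_li2_series (x : C) : (Cmod x < 1)%R ->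
  exists l, Cder (CPS li2_coef) x l /\ l * x = - CPS log_coef x.
Proof.
intros Hx. exists (CPS (der li2_coef) x). split.
{ apply CPS_Cder with 1%R; auto. apply li2_coef_rad. }
assert (L := CPS_cvg _ _ _ (rad_der _ _ Rlt_0_1 li2_coef_rad) Hx).
symmetry. replace (CPS (der li2_coef) x * x) with (- (- (CPS (der li2_coef) x * x))) by ring.
f_equal. apply CPS_eq. apply (cvg_incr _ _ 1).
apply cvg_ext with (u := fun N => - (csum (fun k => der li2_coef k * x ^ k) N * x)).
- intros N. rewrite Nat.add_1_r. induction N; [simpl; ring|].
  rewrite !(csum_S _ (S N)). rewrite <- IHN.
  rewrite !(csum_S _ N).
  replace (log_coef (S N)) with (- der li2_coef N); [simpl; ring|].
  unfold der, li2_coef, log_coef. rewrite <- RtoC_mult, <- RtoC_opp. f_equal. field.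
  apply not_0_INR. lia.
- apply cvg_opp. apply cvg_mult; auto. apply cvg_const.
Qed.

(** (1 - x t) exp (- log (1 - x t)) has derivative zero in t. *)
Lemma Cexp_log_series (x : C) : (Cmod x < 1)%R -> Cexp (CPS log_coef x) = 1 - x.
Proof.
intros Hx.
assert (E : Cexp (- CPS log_coef (RtoC 1 * x)) * (1 - RtoC 1 * x)
          = Cexp (- CPS log_coef (RtoC 0 * x)) * (1 - RtoC 0 * x)).
{ apply (Dt_zero_const (fun t => Cexp (- CPS log_coef (RtoC t * x)) * (1 - RtoC t * x))).
  intros t Ht.
  assert (Dz : Dt (fun t => RtoC t * x) t x).
  { apply Dt_ext with (fun s => 0 + RtoC s * x); [intros; ring|]. apply Dt_affine. }
  assert (Hm : (Cmod (RtoC t * x) < 1)%R).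
  { rewrite Cmod_mult, Cmod_RtoC_pos by lra. generalize (Cmod_ge_0 x). nra. }
  eapply Dt_eq.
  - apply Dt_mult.
    + apply Dt_exp, Dt_opp, Cder_Dt; [now apply Cder_log_series|exact Dz].
    + apply Dt_minus; [apply Dt_const|exact Dz].
  - cbv beta. field. intros E.
    assert (E1 : RtoC t * x = 1) by (replace (RtoC t * x) with (1 - (1 - RtoC t * x)) by ring; rewrite E; ring).
    rewrite E1, Cmod_1 in Hm. lra. }
rewrite Cmult_1_l, Cmult_0_l, CPS_0 in E.
unfold log_coef at 2 in E. rewrite Copp_0, Cexp_0 in E.
replace (1 - x) with (Cexp (CPS log_coef x) * (Cexp (- CPS log_coef x) * (1 - x))).
- rewrite E. ring.
- rewrite Cmult_assoc, (Cmult_comm (Cexp _)), Cexp_opp_l. ring.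
Qed.

(** [Li_2 (e^{-u})], followed by its derivative [log (1 - e^{-u})]. *)
Definition li2exp (u : C) : C := CPS li2_coef (Cexp (- u)).
Definition log1exp (u : C) : C := CPS log_coef (Cexp (- u)).

Lemma Cmod_Cexp_opp_lt (u : C) : (0 < Re u)%R -> (Cmod (Cexp (- u)) < 1)%R.
Proof. intros H. rewrite Cmod_Cexp, <- exp_0. apply exp_increasing. rewrite re_opp. lra. Qed.

Lemma Cexp_minus_1_neq_0 (u : C) : (0 < Re u)%R -> Cexp u - 1 <> 0.
Proof.
intros H E. assert (E' : Cexp u = 1) by (replace (Cexp u) with (Cexp u - 1 + 1) by ring; rewrite E; ring).
assert (M := Cmod_Cexp u). rewrite E', Cmod_1 in M.
generalize (exp_increasing 0 (Re u) H). rewrite exp_0. lra.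
Qed.

Lemma Dt_li2exp g t d : Dt g t d -> (0 < Re (g t))%R -> Dt (fun x => li2exp (g x)) t (d * log1exp (g t)).
Proof.
intros Hg Hr. assert (Hx := Cmod_Cexp_opp_lt _ Hr).
destruct (Cder_li2_series _ Hx) as [l [Hl E]].
eapply Dt_eq.
- apply (Cder_Dt (CPS li2_coef) (fun x => Cexp (- g x))); [exact Hl|].
  apply Dt_exp, Dt_opp, Hg.
- unfold log1exp. replace (CPS log_coef (Cexp (- g t))) with (- (l * Cexp (- g t))) by (rewrite E; ring). ring.
Qed.

Lemma Dt_log1exp g t d : Dt g t d -> (0 < Re (g t))%R -> Dt (fun x => log1exp (g x)) t (d / (Cexp (g t) - 1)).
Proof.
intros Hg Hr. assert (Hx := Cmod_Cexp_opp_lt _ Hr).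
eapply Dt_eq.
- apply (Cder_Dt (CPS log_coef) (fun x => Cexp (- g x))); [now apply Cder_log_series|].
  apply Dt_exp, Dt_opp, Hg.
- cbv beta. rewrite Cexp_opp. assert (H := Cexp_minus_1_neq_0 _ Hr).
  field. split; auto. apply Cexp_neq_0.
Qed.

Lemma Cexp_log1exp (u : C) : (0 < Re u)%R -> Cexp (log1exp u) = 1 - Cexp (- u).
Proof. intros H. apply Cexp_log_series. now apply Cmod_Cexp_opp_lt. Qed.

Lemma Cder_cvg f z l u : Cder f z l -> cvg u z -> cvg (fun n => f (u n)) (f z).
Proof.
intros [K [d [Hd HK]]] Hu.
destruct (proj1 (cvg_spec u z) Hu (Rmin d 1)%R ltac:(apply Rmin_glb_lt; lra)) as [N HN].
apply cvg_le with (N := N) (b := fun n => ((Rabs K + Cmod l) * Cmod (u n - z))%R).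
- intros n Hn. specialize (HN n Hn).
  assert (H1 : (Cmod (u n - z) < d)%R) by (rmin HN).
  assert (H2 : (Cmod (u n - z) < 1)%R) by (rmin HN).
  specialize (HK _ H1). replace (z + (u n - z)) with (u n) in HK by ring.
  replace (f (u n) - f z) with ((f (u n) - f z - l * (u n - z)) + l * (u n - z)) by ring.
  eapply Rle_trans; [apply Cmod_triangle|]. rewrite Cmod_mult.
  generalize (Rle_abs K) (Rabs_pos K) (Cmod_ge_0 (u n - z)). intros.
  set (c := Cmod (u n - z)) in *.
  assert (K * (c * c) <= Rabs K * (c * c))%R by (apply Rmult_le_compat_r; nra).
  assert (Rabs K * (c * c) <= Rabs K * c)%R by (apply Rmult_le_compat_l; nra). nra.
- replace (Finite 0) with (Rbar_mult (Rabs K + Cmod l)%R 0) by (simpl; f_equal; ring).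
  apply is_lim_seq_scal_l. exact Hu.
Qed.

Lemma li2exp_cvg_0 u : cvg (fun n => Cexp (- u n)) 0 -> cvg (fun n => li2exp (u n)) 0.
Proof.
intros H. destruct (Cder_li2_series 0) as [l [Hl _]]; [rewrite Cmod_0; lra|].
assert (A := Cder_cvg _ _ _ _ Hl H). rewrite CPS_0 in A. exact A.
Qed.

Lemma log1exp_cvg_0 u : cvg (fun n => Cexp (- u n)) 0 -> cvg (fun n => log1exp (u n)) 0.
Proof.
intros H. assert (Hl : Cder (CPS log_coef) 0 (- / (1 - 0))) by (apply Cder_log_series; rewrite Cmod_0; lra).
assert (A := Cder_cvg _ _ _ _ Hl H). rewrite CPS_0 in A. exact A.
Qed.

(** The two series differ by a shift of the index: the coefficients here start
    with a term of degree 0, which is zero. *)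
Lemma Li2_branch_right U D y : is_Li2_branch U D -> U y -> (0 < Re y)%R -> D y = li2exp y.
Proof.
intros [_ H] Hy Hr. symmetry. apply CPS_eq. apply (cvg_incr _ _ 1).
specialize (H y Hy (Rlt_le _ _ (Cmod_Cexp_opp_lt _ Hr))). apply is_series_cvg in H.
eapply cvg_ext; [|exact H].
intros N. rewrite Nat.add_1_r. induction N; [simpl; ring|].
rewrite !(csum_S _ (S N)). rewrite <- IHN.
rewrite !(csum_S _ N). f_equal.
cbv beta. rewrite Nat.add_1_r. unfold li2_coef. rewrite Rinv_mult, RtoC_mult, RtoC_inv by (apply not_0_INR; lia).
generalize (Cexp (- y) ^ S N). intros q. rewrite Cpow_S, Cpow_1_r. field. apply RtoC_neq_0, not_0_INR. lia.
Qed.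

Lemma Im_csum_real u N : (forall k, Im (u k) = 0%R) -> Im (csum u N) = 0%R.
Proof. intros H. induction N; simpl; [reflexivity|]. change (Im (csum u N) + Im (u N) = 0)%R. rewrite IHN, H. ring. Qed.

Lemma Im_log1exp_RtoC x : (0 < x)%R -> Im (log1exp (RtoC x)) = 0%R.
Proof.
intros Hx.
assert (Hm := Cmod_Cexp_opp_lt (RtoC x) Hx).
assert (L := CPS_cvg _ _ _ log_coef_rad Hm). fold (log1exp (RtoC x)) in L.
apply cvg_comp in L. destruct L as [_ L].
apply is_lim_seq_unique in L.
rewrite (Lim_seq_ext _ (fun _ => 0%R)) in L.
- rewrite Lim_seq_const in L. now injection L.
- intros N. apply Im_csum_real. intros k.
  rewrite <- RtoC_opp, Cexp_RtoC.
  assert (P : forall r k, RtoC r ^ k = RtoC (r ^ k)).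
  { intros r j. induction j; simpl; auto. rewrite IHj, RtoC_mult. reflexivity. }
  rewrite P. destruct k as [|k]; unfold log_coef; rewrite <- RtoC_mult; reflexivity.
Qed.

(** * Symmetric sums over Z *)

Fixpoint zsum (a : Z -> C) (N : nat) : C :=
  match N with
  | O => a 0%Z
  | S N' => zsum a N' + (a (Z.of_nat N) + a (- Z.of_nat N)%Z)
  end.

Lemma zsum_ext a b N : (forall n, a n = b n) -> zsum a N = zsum b N.
Proof. intros H. induction N; cbn [zsum]; [apply H|]. now rewrite IHN, !H. Qed.

Lemma zsum_scal c a N : zsum (fun n => c * a n) N = c * zsum a N.
Proof. induction N; cbn [zsum]; [ring|]. rewrite IHN. ring. Qed.

Lemma csum_shift u N : csum u (S N) = u O + csum (fun k => u (S k)) N.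
Proof.
induction N; [simpl; ring|].
rewrite !(csum_S _ (S N)). rewrite IHN. simpl. ring.
Qed.

Lemma csum_rev u N : csum u N = csum (fun k => u (N - 1 - k)%nat) N.
Proof.
induction N; [reflexivity|].
rewrite (csum_shift (fun k => u (S N - 1 - k)%nat)). cbn [csum].
rewrite IHN, Cplus_comm. f_equal; [f_equal; lia|].
apply csum_ext. intros k Hk. f_equal. lia.
Qed.

Lemma zsum_halves f H :
  zsum f H = csum (fun k => f (Z.of_nat k)) H + csum (fun k => f (- Z.of_nat (S k))%Z) H + f (Z.of_nat H).
Proof.
induction H as [|H IH]; [simpl; ring|].
cbn [zsum csum]. rewrite IH. ring.
Qed.

(** * The partial fraction expansion of [1 / (4 sinh (u / 2) ^ 2)] *)

(** Minus the derivative of 1 / (e^u - 1), which is 1 / (4 sinh (u / 2) ^ 2);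
    accordingly [pole_sq] is minus the derivative of 1 / (u + 2 pi i n). *)
Definition phi (u : C) : C := Cexp u / ((Cexp u - 1) * (Cexp u - 1)).
Definition pole_sq (u : C) (n : Z) : C := / ((u + period n) * (u + period n)).

Lemma period_plus n m : period (n + m) = period n + period m.
Proof. unfold period. rewrite plus_IZR. Csolve. Qed.

Lemma period_opp n : period (- n) = - period n.
Proof. unfold period. rewrite opp_IZR. Csolve. Qed.

Lemma Cmod_period n : Cmod (period n) = (2 * PI * Rabs (IZR n))%R.
Proof.
replace (period n) with (Ci * RtoC (2 * PI * IZR n)) by (unfold period; Csolve).
rewrite Cmod_mult, Cmod_Ci, Cmod_R, !Rabs_mult, (Rabs_pos_eq 2), (Rabs_pos_eq PI); try lra.
apply Rlt_le, PI_RGT_0.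
Qed.

Definition nonpole (u : C) : Prop := forall n, u + period n <> 0.

Lemma nonpole_exp u : nonpole u <-> Cexp u - 1 <> 0.
Proof.
split.
- intros H E.
  destruct (Cexp_eq_1 u) as [n Hn].
  { replace (Cexp u) with (Cexp u - 1 + 1) by ring. rewrite E. ring. }
  apply (H (- n)%Z). rewrite period_opp, Hn. ring.
- intros H n E. apply H. replace u with (- period n).
  + rewrite Cexp_opp, Cexp_period. field.
  + replace u with (u + period n - period n) by ring. rewrite E. ring.
Qed.

Lemma phi_periodic u n : phi (u + period n) = phi u.
Proof. unfold phi. rewrite Cexp_plus, Cexp_period, Cmult_1_r. reflexivity. Qed.

(** With a = e^{u/2} this is 4 a^2 / (1 - a^2)^2 = a / (1 - a)^2 - a / (1 + a)^2;
    adding pi i to u / 2 changes the sign of a. *)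
Lemma phi_double u : nonpole u -> phi u = (phi (u / 2) + phi ((u + period 1) / 2)) / 4.
Proof.
intros H. apply nonpole_exp in H. unfold phi.
set (a := Cexp (u / 2)).
assert (Ea : Cexp u = a * a) by (unfold a; rewrite <- Cexp_plus; f_equal; field).
assert (Eb : Cexp ((u + period 1) / 2) = - a).
{ replace ((u + period 1) / 2) with (u / 2 + ((0, PI / 2)%R + (0, PI / 2)%R)).
  - rewrite !Cexp_plus, Cexp_half_turn. fold a.
    replace (a * (Ci * Ci)) with (- a) by (replace (Ci * Ci) with (- (RtoC 1)) by (Csolve); ring).
    reflexivity.
  - unfold period. unfold Cdiv. destruct u. Csolve; field. }
rewrite Ea, Eb. rewrite Ea in H.
assert (a - 1 <> 0). { intros E. apply H. replace (a * a - 1) with ((a - 1) * (a + 1)) by ring. rewrite E. ring. }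
assert (a + 1 <> 0). { intros E. apply H. replace (a * a - 1) with ((a - 1) * (a + 1)) by ring. rewrite E. ring. }
field. repeat split; auto.
replace (- a - 1) with (- (a + 1)) by ring. intros E. apply H1. 
replace (a + 1) with (- - (a + 1)) by ring. rewrite E. ring.
Qed.

Lemma csum_even_odd g N : csum g (2 * N) = csum (fun k => g (2 * k)%nat) N + csum (fun k => g (2 * k + 1)%nat) N.
Proof.
induction N; [simpl; ring|].
replace (2 * S N)%nat with (S (S (2 * N))) by lia.
cbn [csum]. rewrite IHN. replace (2 * N + 1)%nat with (S (2 * N)) by lia. ring.
Qed.

Lemma pow2_neq_0 m : RtoC (2 ^ m) <> 0.
Proof. apply RtoC_neq_0. apply pow_nonzero. lra. Qed.

Lemma phi_dyadic m : forall u, nonpole u ->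
  phi u = csum (fun j => phi ((u + period (Z.of_nat j)) / RtoC (2 ^ m))) (2 ^ m) / RtoC (4 ^ m).
Proof.
induction m; intros u Hu.
- simpl. unfold period. simpl. replace (u + (0, 2 * PI * 0)%R) with u by (destruct u; Csolve).
  replace (u / 1) with u by field. field.
- rewrite phi_double by auto.
  assert (H2 : forall w k, nonpole w -> nonpole ((w + period k) / 2)).
  { intros w k Hw n E. apply (Hw (k + 2 * n)%Z).
    rewrite period_plus. replace (2 * n)%Z with (n + n)%Z by lia. rewrite period_plus.
    replace (w + (period k + (period n + period n))) with (2 * ((w + period k) / 2 + period n)) by field.
    rewrite E. ring. }
  assert (E0 : u / 2 = (u + period 0) / 2).
  { f_equal. unfold period. rewrite Rmult_0_r. change (0, 0)%R with (RtoC 0). ring. }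
  rewrite E0, (IHm ((u + period 0) / 2)), (IHm ((u + period 1) / 2)) by auto.
  change (2 ^ S m)%nat with (2 * 2 ^ m)%nat. rewrite csum_even_odd.
  assert (HA : forall k j, (u + period k) / 2 + period j = (u + period (2 * j + k)) / 2).
  { intros k j. rewrite period_plus. replace (2 * j)%Z with (j + j)%Z by lia. rewrite period_plus. field. }
  rewrite (csum_ext (fun j => phi (((u + period 0) / 2 + period (Z.of_nat j)) / RtoC (2 ^ m)))
    (fun k => phi ((u + period (Z.of_nat (2 * k))) / RtoC (2 ^ S m)))).
  rewrite (csum_ext (fun j => phi (((u + period 1) / 2 + period (Z.of_nat j)) / RtoC (2 ^ m)))
    (fun k => phi ((u + period (Z.of_nat (2 * k + 1))) / RtoC (2 ^ S m)))).
  + simpl (4 ^ S m)%R. rewrite RtoC_mult. field.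
    apply RtoC_neq_0. apply pow_nonzero. lra.
  + intros k _. f_equal. rewrite HA. replace (2 * Z.of_nat k + 1)%Z with (Z.of_nat (2 * k + 1)) by lia.
    simpl (2 ^ S m)%R. rewrite RtoC_mult. field. apply pow2_neq_0.
  + intros k _. f_equal. rewrite HA. replace (2 * Z.of_nat k + 0)%Z with (Z.of_nat (2 * k)) by lia.
    simpl (2 ^ S m)%R. rewrite RtoC_mult. field. apply pow2_neq_0.
Qed.

Lemma Dt_bound_0 (f df : R -> C) B : f 0%R = RtoC 0 ->
  (forall t, (0 <= t <= 1)%R -> Dt f t (df t)) ->
  (forall t, (0 <= t <= 1)%R -> (Cmod (df t) <= B)%R) ->
  forall t, (0 <= t <= 1)%R -> (Cmod (f t) <= 2 * B)%R.
Proof.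
intros H0 Hd HB t Ht.
assert (A := Dt_bound f df 0 t B (proj1 Ht) (fun s Hs => Hd s ltac:(lra)) (fun s Hs => HB s ltac:(lra))).
rewrite H0 in A. replace (f t - 0) with (f t) in A by ring.
assert (0 <= B)%R by (eapply Rle_trans; [apply Cmod_ge_0|apply (HB 0%R); lra]).
nra.
Qed.

Lemma Dt_line (x : C) t : Dt (fun s => RtoC s * x) t x.
Proof. apply Dt_ext with (fun s => 0 + RtoC s * x); [intros; ring|]. apply Dt_affine. Qed.

Lemma exp_1_bound a : (a <= 1)%R -> (exp a <= 3)%R.
Proof.
intros H. apply Rle_trans with (exp 1); [|apply exp_le_3].
destruct (Req_dec a 1) as [->|]; [lra|]. apply Rlt_le, exp_increasing. lra.
Qed.

(** The fourth derivative of e^{tx} + e^{-tx} in t is bounded by 6 |x|^4, and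
    each of the four integrations from 0 costs at most a factor 2. *)
Lemma cosh_taylor (x : C) : (Rabs (Re x) <= 1)%R ->
  (Cmod (Cexp x + Cexp (- x) - 2 - x * x) <= 96 * (Cmod x * Cmod x * (Cmod x * Cmod x)))%R.
Proof.
intros Hx.
set (e := fun t : R => Cexp (RtoC t * x)). set (e' := fun t : R => Cexp (- (RtoC t * x))).
assert (De : forall t, Dt e t (x * e t)) by (intros t; apply Dt_exp, Dt_line).
assert (De' : forall t, Dt e' t (- x * e' t)) by (intros t; apply Dt_exp, Dt_opp, Dt_line).
assert (E0 : e 0%R = 1) by (unfold e; rewrite Cmult_0_l; apply Cexp_0).
assert (E0' : e' 0%R = 1) by (unfold e'; rewrite Cmult_0_l, Copp_0; apply Cexp_0).
set (M := (Cmod x * Cmod x * (Cmod x * Cmod x))%R).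
assert (B4 : forall t, (0 <= t <= 1)%R -> (Cmod (x * x * (x * x) * (e t + e' t)) <= 6 * M)%R).
{ intros t Ht. rewrite !Cmod_mult. fold M. rewrite Rmult_comm.
  apply Rmult_le_compat_r; [unfold M; generalize (Cmod_ge_0 x); intros; repeat apply Rmult_le_pos; auto|].
  eapply Rle_trans; [apply Cmod_triangle|]. unfold e, e'. rewrite !Cmod_Cexp.
  assert (A := Rabs_le_between (Re x) 1). destruct A as [A _]. specialize (A Hx).
  assert (exp (Re (RtoC t * x)) <= 3)%R by (apply exp_1_bound; rewrite re_scal_l; nra).
  assert (exp (Re (- (RtoC t * x))) <= 3)%R by (apply exp_1_bound; rewrite re_opp, re_scal_l; nra).
  lra. }
assert (B3 : forall t, (0 <= t <= 1)%R -> (Cmod (x * x * x * (e t - e' t)) <= 2 * (6 * M))%R).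
{ apply Dt_bound_0 with (2 := fun t _ => Dt_scal (x * x * x) _ _ _ (Dt_minus _ _ _ _ _ (De t) (De' t))).
  - rewrite E0, E0'. ring.
  - intros t Ht. replace (x * x * x * (x * e t - - x * e' t)) with (x * x * (x * x) * (e t + e' t)) by ring. auto. }
assert (B2 : forall t, (0 <= t <= 1)%R -> (Cmod (x * x * (e t + e' t - 2)) <= 2 * (2 * (6 * M)))%R).
{ apply Dt_bound_0 with (2 := fun t _ => Dt_scal (x * x) _ _ _
    (Dt_minus _ _ _ _ _ (Dt_plus _ _ _ _ _ (De t) (De' t)) (Dt_const 2 t))).
  - rewrite E0, E0'. replace (1 + 1 - 2) with (RtoC 0) by ring. ring.
  - intros t Ht. replace (x * x * (x * e t + - x * e' t - 0)) with (x * x * x * (e t - e' t)) by ring. auto. }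
assert (B1 : forall t, (0 <= t <= 1)%R -> (Cmod (x * (e t - e' t) - 2 * (RtoC t * x) * x) <= 2 * (2 * (2 * (6 * M))))%R).
{ apply (Dt_bound_0 (fun t => x * (e t - e' t) - 2 * (RtoC t * x) * x) (fun t => x * x * (e t + e' t - 2))).
  - rewrite E0, E0'. ring.
  - intros t Ht. eapply Dt_eq.
    + apply Dt_minus; [apply Dt_scal, Dt_minus; auto|].
      apply (Dt_mult (fun t => 2 * (RtoC t * x)) (fun _ => x)); [apply Dt_scal, Dt_line|apply Dt_const].
    + cbv beta. ring.
  - auto. }
assert (B0 : forall t, (0 <= t <= 1)%R -> (Cmod (e t + e' t - 2 - (RtoC t * x) * (RtoC t * x)) <= 2 * (2 * (2 * (2 * (6 * M)))))%R).
{ apply (Dt_bound_0 (fun t => e t + e' t - 2 - (RtoC t * x) * (RtoC t * x)) (fun t => x * (e t - e' t) - 2 * (RtoC t * x) * x)).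
  - rewrite E0, E0'. ring.
  - intros t Ht. eapply Dt_eq.
    + apply Dt_minus; [apply Dt_minus; [apply Dt_plus; auto|apply Dt_const]|].
      apply Dt_mult; apply Dt_line.
    + cbv beta. ring.
  - auto. }
specialize (B0 1%R ltac:(lra)). unfold e, e' in B0. rewrite !Cmult_1_l in B0. lra.
Qed.

Lemma sin_lower b : (0 <= b <= 9 / 4)%R -> (3 / 20 * b <= sin b)%R.
Proof.
intros Hb. assert (A := proj1 (pre_sin_bound b 0 ltac:(lra) ltac:(lra))).
unfold sin_approx, sum_f_R0, sin_term in A. simpl in A.
assert (b * b <= 81 / 16)%R by nra. 
assert (E : (b - b * (b * b) / 6 <= sin b)%R).
{ eapply Rle_trans; [|exact A]. apply Req_le. field. }
nra.
Qed.

(** |2 sinh (a + i b)|^2 = (e^a - e^{-a})^2 + 4 sin^2 b, and the sine is bounded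
    below by a multiple of b as long as b stays away from pi. *)
Lemma sinh_lower (x : C) : (Rabs (Im x) <= 9 / 2)%R ->
  (/ 50 * (Cmod x * Cmod x) <= Cmod (Cexp x + Cexp (- x) - 2))%R.
Proof.
intros Hx.
assert (E : Cexp x + Cexp (- x) - 2 = (Cexp (x / 2) - Cexp (- (x / 2))) * (Cexp (x / 2) - Cexp (- (x / 2)))).
{ replace (Cexp x) with (Cexp (x / 2) * Cexp (x / 2)) by (rewrite <- Cexp_plus; f_equal; field).
  replace (Cexp (- x)) with (Cexp (- (x / 2)) * Cexp (- (x / 2))) by (rewrite <- Cexp_plus; f_equal; field).
  assert (X := Cexp_opp_l (x / 2)). set (A := Cexp (x / 2)) in *. set (B := Cexp (- (x / 2))) in *.
  replace ((A - B) * (A - B)) with (A * A + B * B - 2 * (B * A)) by ring. rewrite X. ring. }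
rewrite E, Cmod_mult, !Cmod_sqr. clear E.
set (a := (Re x / 2)%R). set (b := (Im x / 2)%R).
assert (Ea : x / 2 = (a, b)) by (unfold a, b; destruct x; unfold Cdiv; Csolve; field).
rewrite Ea. unfold Cexp. simpl. rewrite cos_neg, sin_neg.
replace (Re x) with (2 * a)%R by (unfold a; field). replace (Im x) with (2 * b)%R by (unfold b; field).
replace ((exp a * cos b + - (exp (- a) * cos b)) * (exp a * cos b + - (exp (- a) * cos b)) +
  (exp a * sin b + - (exp (- a) * - sin b)) * (exp a * sin b + - (exp (- a) * - sin b)))%R
  with ((exp a - exp (- a)) * (exp a - exp (- a)) + 4 * (sin b * sin b))%R.
- assert (H1 : (a * a <= (exp a - exp (- a)) * (exp a - exp (- a)))%R).
  { assert (P : forall c, (0 <= c)%R -> (c <= exp c - exp (- c))%R).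
    { intros c Hc. generalize (exp_ineq1_le c) (exp_1_bound (-c)). intros.
      assert (exp (- c) <= 1)%R. { rewrite <- exp_0. destruct (Req_dec c 0) as [->|]; [rewrite Ropp_0; lra|].
        apply Rlt_le, exp_increasing. lra. } lra. }
    destruct (Rle_lt_dec 0 a) as [Ha|Ha].
    - specialize (P a Ha). nra.
    - specialize (P (- a)%R ltac:(lra)). rewrite Ropp_involutive in P. nra. }
  assert (H2 : (9 / 400 * (b * b) <= sin b * sin b)%R).
  { assert (Hb : (Rabs b <= 9 / 4)%R).
    { unfold b, Rdiv. rewrite Rabs_mult, (Rabs_pos_eq (/ 2)) by lra. lra. }
    destruct (Rle_lt_dec 0 b) as [Hb0|Hb0].
    - rewrite Rabs_pos_eq in Hb by auto. assert (S := sin_lower b ltac:(lra)). nra.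
    - rewrite Rabs_left in Hb by auto. assert (S := sin_lower (- b) ltac:(lra)).
      rewrite sin_neg in S. nra. }
  nra.
- assert (X : (exp a * exp (- a) = 1)%R) by (rewrite <- exp_plus, Rplus_opp_r; apply exp_0).
  assert (Y : (cos b * cos b = 1 - sin b * sin b)%R) by (generalize (sin2_cos2 b); unfold Rsqr; lra).
  replace ((exp a * cos b + - (exp (- a) * cos b)) * (exp a * cos b + - (exp (- a) * cos b)))%R
    with ((exp a - exp (- a)) * (exp a - exp (- a)) * (cos b * cos b))%R by ring.
  rewrite Y.
  replace ((exp a * sin b + - (exp (- a) * - sin b)) * (exp a * sin b + - (exp (- a) * - sin b)))%R
    with (((exp a - exp (- a)) * (exp a - exp (- a)) + 4 * (exp a * exp (- a))) * (sin b * sin b))%R by ring.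
  rewrite X. ring.
Qed.

(** The quotient (x^2 - 4 sinh^2 (x/2)) / (4 x^2 sinh^2 (x/2)) has numerator and
    denominator of order |x|^4. *)
Lemma phi_near_pole (x : C) : x <> 0 -> (Rabs (Re x) <= 1)%R -> (Rabs (Im x) <= 9 / 2)%R ->
  (Cmod (phi x - / (x * x)) <= 4800)%R.
Proof.
intros H0 Hr Hi.
assert (T := cosh_taylor x Hr). assert (L := sinh_lower x Hi).
set (s := Cexp x + Cexp (- x) - 2) in *.
assert (Hx : (0 < Cmod x)%R) by now apply Cmod_gt_0.
assert (Hx2 : (0 < Cmod x * Cmod x)%R) by nra.
assert (Hs0 : s <> 0) by (apply Cmod_gt_0; lra).
assert (He := Cexp_neq_0 x).
assert (Es : s * Cexp x = (Cexp x - 1) * (Cexp x - 1)).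
{ unfold s. rewrite Cexp_opp. field. auto. }
assert (Ep : phi x = / s).
{ unfold phi. rewrite <- Es. field. auto. }
rewrite Ep. replace (/ s - / (x * x)) with (- ((s - x * x) / (s * (x * x)))) by (field; auto).
rewrite Cmod_opp, Cmod_div by (repeat apply Cmult_neq_0; auto).
rewrite !Cmod_mult. set (m := (Cmod x * Cmod x)%R) in *.
apply Rle_div_l; [apply Rmult_lt_0_compat; lra|].
apply Rle_trans with (1 := T). 
apply Rle_trans with (4800 * ((/ 50 * m) * m))%R; [apply Req_le; field|].
apply Rmult_le_compat_l; [lra|]. apply Rmult_le_compat_r; lra.
Qed.

Lemma PI_ge_1 : (1 <= PI)%R.
Proof. generalize PI2_1. lra. Qed.

Lemma pole_lower u n : (Cmod u <= Rabs (IZR n))%R -> (Rabs (IZR n) <= Cmod (u + period n))%R.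
Proof.
intros H. assert (A := Cmod_triangle_inv (period n) u). rewrite Cmod_period in A.
rewrite Cplus_comm. generalize PI_ge_1 (Rabs_pos (IZR n)). intros. nra.
Qed.

Lemma pole_sq_bound u n : (Cmod u <= Rabs (IZR n))%R -> (0 < Rabs (IZR n))%R ->
  (Cmod (pole_sq u n) <= / (IZR n * IZR n))%R.
Proof.
intros H H0. assert (A := pole_lower u n H). unfold pole_sq.
assert (u + period n <> 0) by (apply Cmod_gt_0; lra).
rewrite Cmod_inv, Cmod_mult by (apply Cmult_neq_0; auto).
replace (IZR n * IZR n)%R with (Rabs (IZR n) * Rabs (IZR n))%R
  by (rewrite <- Rabs_mult; apply Rabs_pos_eq; nra).
apply Rinv_le_contravar; nra.
Qed.

Lemma INR_pow2 p : INR (2 ^ p) = (2 ^ p)%R.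
Proof. rewrite pow_INR. simpl (INR 2). reflexivity. Qed.

Lemma Rabs_IZR_nat k : Rabs (IZR (Z.of_nat k)) = INR k.
Proof. rewrite <- INR_IZR_INZ. apply Rabs_pos_eq, pos_INR. Qed.

Lemma Rabs_IZR_opp_nat k : Rabs (IZR (- Z.of_nat k)) = INR k.
Proof. rewrite opp_IZR, Rabs_Ropp. apply Rabs_IZR_nat. Qed.

(** 1 / N^2 <= 1 / (N - 1) - 1 / N makes the bound telescope. *)
Lemma zsum_pole_tail u M K : (0 < M)%nat -> (Cmod u <= INR M)%R ->
  (Cmod (zsum (pole_sq u) (M + K) - zsum (pole_sq u) M) <= 2 / INR M - 2 / INR (M + K))%R.
Proof.
intros HM Hu. assert (HM' : (0 < INR M)%R) by now apply lt_0_INR.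
induction K.
- rewrite Nat.add_0_r. replace (zsum (pole_sq u) M - zsum (pole_sq u) M) with (RtoC 0) by ring.
  rewrite Cmod_0. lra.
- rewrite Nat.add_succ_r. cbn [zsum].
  set (N := (M + K)%nat) in *.
  replace (zsum (pole_sq u) N + (pole_sq u (Z.of_nat (S N)) + pole_sq u (- Z.of_nat (S N))%Z) - zsum (pole_sq u) M)
    with ((zsum (pole_sq u) N - zsum (pole_sq u) M) + (pole_sq u (Z.of_nat (S N)) + pole_sq u (- Z.of_nat (S N))%Z)) by ring.
  eapply Rle_trans; [apply Cmod_triangle|].
  assert (HN : (INR M <= INR N)%R) by (apply le_INR; unfold N; lia).
  assert (B : forall n, Rabs (IZR n) = INR (S N) -> (Cmod (pole_sq u n) <= / (INR (S N) * INR (S N)))%R).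
  { intros n Hn. eapply Rle_trans; [apply pole_sq_bound; rewrite Hn, S_INR; lra|].
    replace (IZR n * IZR n)%R with (Rabs (IZR n) * Rabs (IZR n))%R
      by (rewrite <- Rabs_mult; apply Rabs_pos_eq; nra). rewrite Hn. lra. }
  generalize (B _ (Rabs_IZR_nat (S N))) (B _ (Rabs_IZR_opp_nat (S N))).
  generalize (Cmod_triangle (pole_sq u (Z.of_nat (S N))) (pole_sq u (- Z.of_nat (S N))%Z)).
  assert (E : (2 * / (INR (S N) * INR (S N)) <= 2 / INR N - 2 / INR (S N))%R).
  { rewrite S_INR. replace (2 / INR N - 2 / (INR N + 1))%R with (2 * / (INR N * (INR N + 1)))%R by (field; lra).
    apply Rmult_le_compat_l; [lra|]. apply Rinv_le_contravar; nra. }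
  lra.
Qed.

(** In the sum of the 2^(p+1) values of [phi] given by [phi_dyadic], the points
    are moved by periods into the strip |Im x| <= 9/2, where replacing each
    value by its double pole costs at most 4800 / 4^(p+1).  The symmetric sum
    has one term more, at n = 2^p, than this range of n. *)
Lemma zsum_pole_dyadic u p : nonpole u -> (2 * Cmod u <= 2 ^ S p)%R ->
  (Cmod (zsum (pole_sq u) (2 ^ p) - pole_sq u (Z.of_nat (2 ^ p)) - phi u) <= 4800 / 2 ^ S p)%R.
Proof.
intros Hu Hm.
assert (H2 : (1 <= 2 ^ S p)%R) by (apply pow_R1_Rle; lra).
set (q := (2 ^ S p)%R) in *.
assert (Hq : RtoC q <> 0) by (apply RtoC_neq_0; lra).
set (g := fun n : Z => phi ((u + period n) / RtoC q)).
assert (EP : phi u = (csum (fun k => g (Z.of_nat k)) (2 ^ p) + csum (fun k => g (- Z.of_nat (S k))%Z) (2 ^ p)) / RtoC (q * q)).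
{ rewrite (phi_dyadic (S p) u Hu). replace (2 ^ S p)%nat with (2 ^ p + 2 ^ p)%nat by (simpl; lia).
  rewrite csum_cat. f_equal; [|f_equal; f_equal; unfold q; rewrite <- Rpow_mult_distr; f_equal; lra].
  f_equal. rewrite (csum_rev (fun k => g (- Z.of_nat (S k))%Z)). apply csum_ext.
  intros k Hk. unfold g. fold q.
  rewrite <- (phi_periodic ((u + period (- Z.of_nat (S (2 ^ p - 1 - k)))) / RtoC q) 1).
  f_equal. replace (Z.of_nat (2 ^ p + k)) with (- Z.of_nat (S (2 ^ p - 1 - k)) + Z.of_nat (2 ^ S p))%Z.
  - rewrite period_plus.
    replace (period (Z.of_nat (2 ^ S p))) with (RtoC q * period 1).
    + field. auto.
    + unfold period, q. rewrite <- INR_IZR_INZ, pow_INR. simpl (INR 2). Csolve.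
      replace (1 + 1)%R with 2%R by ring. ring.
  - clear - Hk. change (2 ^ S p)%nat with (2 * 2 ^ p)%nat.
    revert Hk. generalize (2 ^ p)%nat. intros; lia. }
assert (EZ : zsum (pole_sq u) (2 ^ p) - pole_sq u (Z.of_nat (2 ^ p))
  = csum (fun k => pole_sq u (Z.of_nat k)) (2 ^ p) + csum (fun k => pole_sq u (- Z.of_nat (S k))%Z) (2 ^ p)).
{ rewrite zsum_halves. ring. }
rewrite EZ, EP.
assert (Bn : forall n, (Rabs (IZR n) <= INR (2 ^ p))%R ->
   (Cmod (pole_sq u n - g n / RtoC (q * q)) <= 4800 / (q * q))%R).
{ intros n Hn. assert (Hun := Hu n).
  set (x := (u + period n) / RtoC q).
  assert (Hx0 : x <> 0).
  { unfold x. intros E. apply Hun. replace (u + period n) with ((u + period n) / RtoC q * RtoC q) by (field; auto).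
    rewrite E. ring. }
  replace (pole_sq u n) with (/ (x * x) / RtoC (q * q)) by (unfold x, pole_sq; rewrite RtoC_mult; field; auto).
  replace (/ (x * x) / RtoC (q * q) - g n / RtoC (q * q)) with (- ((phi x - / (x * x)) / RtoC (q * q)))
    by (unfold g; fold x; field; split; auto; apply RtoC_neq_0; nra).
  rewrite Cmod_opp, Cmod_div by (apply RtoC_neq_0; nra).
  rewrite Cmod_RtoC_pos by nra. apply Rmult_le_compat_r; [apply Rlt_le, Rinv_0_lt_compat; nra|].
  assert (Ex : x = ((Re u / q)%R, ((Im u + 2 * PI * IZR n) / q)%R)).
  { unfold x, period. destruct u. unfold Cdiv. Csolve; field; lra. }
  assert (HP4 := PI_4). assert (HP1 := PI_ge_1).
  apply phi_near_pole; auto; rewrite Ex; simpl; unfold Rdiv; rewrite Rabs_mult, (Rabs_pos_eq (/ q))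
    by (apply Rlt_le, Rinv_0_lt_compat; lra); apply Rle_div_l; try lra.
  - generalize (Re_le_Cmod u) (Cmod_ge_0 u). lra.
  - eapply Rle_trans; [apply Rabs_triang|].
    rewrite !Rabs_mult, (Rabs_pos_eq 2), (Rabs_pos_eq PI) by lra.
    assert (Eqh : (q = 2 * INR (2 ^ p))%R) by (rewrite INR_pow2; reflexivity).
    assert (Hi := Im_le_Cmod u).
    assert (2 * PI * Rabs (IZR n) <= PI * q)%R by (rewrite Eqh; nra).
    nra. }
set (H := (2 ^ p)%nat) in *.
assert (EqH : q = (2 * INR H)%R) by (unfold H; rewrite INR_pow2; reflexivity).
replace (csum (fun k => pole_sq u (Z.of_nat k)) H + csum (fun k => pole_sq u (- Z.of_nat (S k))%Z) H -
   (csum (fun k => g (Z.of_nat k)) H + csum (fun k => g (- Z.of_nat (S k))%Z) H) / RtoC (q * q))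
 with (csum (fun k => pole_sq u (Z.of_nat k) - g (Z.of_nat k) / RtoC (q * q)) H
     + csum (fun k => pole_sq u (- Z.of_nat (S k))%Z - g (- Z.of_nat (S k))%Z / RtoC (q * q)) H).
- eapply Rle_trans; [apply Cmod_triangle|].
  assert (C1 : forall (v : nat -> C) c, (forall k, (k < H)%nat -> (Cmod (v k) <= c)%R) -> (Cmod (csum v H) <= INR H * c)%R).
  { clear. intros v c. induction H as [|n IH]; intros Hv.
    - simpl. rewrite Cmod_0. lra.
    - rewrite S_INR. cbn [csum]. eapply Rle_trans; [apply Cmod_triangle|].
      specialize (IH (fun k Hk => Hv k (Nat.lt_lt_succ_r _ _ Hk))). specialize (Hv n ltac:(lia)). lra. }
  assert (X1 := C1 (fun k => pole_sq u (Z.of_nat k) - g (Z.of_nat k) / RtoC (q * q)) (4800 / (q * q))%R).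
  assert (X2 := C1 (fun k => pole_sq u (- Z.of_nat (S k))%Z - g (- Z.of_nat (S k))%Z / RtoC (q * q)) (4800 / (q * q))%R).
  apply Rle_trans with (INR H * (4800 / (q * q)) + INR H * (4800 / (q * q)))%R.
  + apply Rplus_le_compat; [apply X1|apply X2]; intros k Hk; apply Bn.
    * rewrite Rabs_IZR_nat. apply le_INR. lia.
    * rewrite Rabs_IZR_opp_nat. apply le_INR. lia.
  + apply Req_le. rewrite EqH. field. lra.
- rewrite !csum_minus.
  assert (X : forall v, csum (fun k => v k / RtoC (q * q)) H = csum v H / RtoC (q * q)).
  { intros v. unfold Cdiv. rewrite Cmult_comm, <- csum_scal. apply csum_ext. intros; ring. }
  rewrite !X. field. apply RtoC_neq_0. nra.
Qed.

(** The error bound is uniform for [u] in a bounded region, however close to the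
    poles: this permits termwise integration along segments. *)
Lemma partial_fractions u M : nonpole u -> (0 < M)%nat -> (Cmod u <= INR M)%R ->
  (Cmod (zsum (pole_sq u) M - phi u) <= 2 / INR M)%R.
Proof.
intros Hu HM HuM.
assert (HM' : (0 < INR M)%R) by now apply lt_0_INR.
assert (Hpow : forall p, (p <= 2 ^ p)%nat).
{ intros p. apply Nat.lt_le_incl, Nat.pow_gt_lin_r. lia. }
assert (Hp : is_lim_seq (fun p => (/ 2 ^ p)%R) 0).
{ apply is_lim_seq_ext with (fun p => ((/ 2) ^ p)%R); [intros; apply pow_inv|].
  apply is_lim_seq_geom. rewrite Rabs_pos_eq; lra. }
assert (L : cvg (fun p => zsum (pole_sq u) (2 ^ p)) (phi u)).
{ apply cvg_le with (N := (2 * M)%nat) (b := fun p => (2400 * / 2 ^ p + / 2 ^ p)%R).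
  - intros p Hpm.
    assert (H1 : (Cmod u <= INR (2 ^ p))%R).
    { eapply Rle_trans; [exact HuM|]. apply le_INR. specialize (Hpow p). lia. }
    assert (E : (2 ^ p = INR (2 ^ p))%R) by (now rewrite INR_pow2).
    assert (H1p : (1 <= 2 ^ p)%R) by (apply pow_R1_Rle; lra).
    assert (A := zsum_pole_dyadic u p Hu ltac:(simpl; lra)).
    set (P := pole_sq u (Z.of_nat (2 ^ p))) in *.
    assert (B : (Cmod P <= / 2 ^ p)%R).
    { unfold P. eapply Rle_trans; [apply pole_sq_bound; rewrite Rabs_IZR_nat; lra|].
      rewrite <- INR_IZR_INZ, <- E. apply Rinv_le_contravar; nra. }
    replace (zsum (pole_sq u) (2 ^ p) - phi u) with ((zsum (pole_sq u) (2 ^ p) - P - phi u) + P) by ring.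
    eapply Rle_trans; [apply Cmod_triangle|].
    replace (4800 / 2 ^ S p)%R with (2400 * / 2 ^ p)%R in A by (simpl; field; lra). lra.
  - replace (Finite 0) with (Finite (2400 * 0 + 0)) by (f_equal; ring).
    apply is_lim_seq_plus'; auto. apply (is_lim_seq_scal_l _ 2400 (Finite 0)). exact Hp. }
rewrite Cmod_sym.
apply (cvg_le_limit (fun p => zsum (pole_sq u) (2 ^ p) - zsum (pole_sq u) M) _ _ M).
- apply cvg_minus; [exact L|apply cvg_const].
- intros p Hpm. specialize (Hpow p).
  replace (2 ^ p)%nat with (M + (2 ^ p - M))%nat by lia.
  eapply Rle_trans; [now apply zsum_pole_tail|].
  assert (0 <= 2 / INR (M + (2 ^ p - M)))%R; [|lra].
  apply Rdiv_le_0_compat; [lra|]. apply lt_0_INR. lia.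
Qed.

(** * Stirling's formula *)

(** For d = log (w + 1) - log w, the error of the trapezoidal rule for log on
    [w, w + 1] after the first Euler-Maclaurin correction. *)
Definition stirling_term (w : C) (d : C) : C :=
  (w + 1 / 2) * d - 1 - 1 / (12 * w * (w + 1)).

(** Consider the interval [w, w + t] in place of [w, w + 1].  The error and its
    first derivative in t vanish at t = 0, and the second derivative is
    - t^3 / (6 w (w + t)^3). *)
Lemma stirling_term_bound (w : C) (l : R -> C) m : (0 < m)%R ->
  (forall t, (0 <= t <= 1)%R -> (m <= Cmod (w + RtoC t))%R) ->
  (forall t, (0 <= t <= 1)%R -> Dt l t (/ (w + RtoC t))) ->
  (Cmod (stirling_term w (l 1%R - l 0%R)) <= / m ^ 4)%R.
Proof.
intros Hm Hw Hl.
assert (Hn : forall t, (0 <= t <= 1)%R -> w + RtoC t <> 0).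
{ intros t Ht. apply Cmod_gt_0. specialize (Hw t Ht). lra. }
assert (Hw0 : w <> 0).
{ specialize (Hn 0%R ltac:(lra)). now rewrite Cplus_0_r in Hn. }
assert (Dw : forall t, Dt (fun t => w + RtoC t) t 1).
{ intros t. apply Dt_ext with (fun x => w + RtoC x * 1); [intros; ring|]. apply Dt_affine. }
assert (Did : forall t, Dt RtoC t 1).
{ intros t. apply Dt_ext with (fun x => 0 + RtoC x * 1); [intros; ring|]. apply Dt_affine. }
set (e1 := fun t : R => / 2 * (l t - l 0%R) + (w + RtoC t / 2) * / (w + RtoC t) - 1
   - (/ (12 * w)) * (3 * (RtoC t * RtoC t) * / (w + RtoC t)
        - RtoC t * RtoC t * RtoC t * (/ (w + RtoC t) * / (w + RtoC t)))).
set (e := fun t : R => (w + RtoC t / 2) * (l t - l 0%R) - RtoC t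
   - (/ (12 * w)) * (RtoC t * RtoC t * RtoC t * / (w + RtoC t))).
set (e2 := fun t : R => - (RtoC t * RtoC t * RtoC t) / (6 * w * ((w + RtoC t) * (w + RtoC t) * (w + RtoC t)))).
assert (Di : forall t, (0 <= t <= 1)%R -> Dt (fun t => / (w + RtoC t)) t (- (RtoC 1) / ((w + RtoC t) * (w + RtoC t)))).
{ intros t Ht. apply (Dt_inv (fun t => w + RtoC t)); [now apply Hn|apply Dw]. }
assert (Dh : forall t, Dt (fun t => w + RtoC t / 2) t (/ 2)).
{ intros t. apply Dt_ext with (fun x => w + RtoC x * / 2); [intros; reflexivity|]. apply Dt_affine. }
assert (D2 : forall t, Dt (fun t => RtoC t * RtoC t) t (2 * RtoC t)).
{ intros t. eapply Dt_eq; [apply Dt_mult; apply Did|]. cbv beta. ring. }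
assert (D3 : forall t, Dt (fun t => RtoC t * RtoC t * RtoC t) t (3 * (RtoC t * RtoC t))).
{ intros t. eapply Dt_eq; [apply Dt_mult; [apply D2|apply Did]|]. cbv beta. ring. }
assert (De : forall t, (0 <= t <= 1)%R -> Dt e t (e1 t)).
{ intros t Ht. eapply Dt_eq.
  - apply Dt_minus; [apply Dt_minus; [apply Dt_mult; [apply Dh|apply Dt_minus; [apply Hl; auto|apply Dt_const]]|apply Did]|].
    apply Dt_scal. apply Dt_mult; [apply D3|apply Di; auto].
  - cbv beta. unfold e1. specialize (Hn t Ht). field. auto. }
assert (De1 : forall t, (0 <= t <= 1)%R -> Dt e1 t (e2 t)).
{ intros t Ht. eapply Dt_eq.
  - apply Dt_minus.
    + apply Dt_minus; [|apply Dt_const]. apply Dt_plus.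
      * apply Dt_scal. apply Dt_minus; [apply Hl; auto|apply Dt_const].
      * apply Dt_mult; [apply Dh|apply Di; auto].
    + apply Dt_scal. apply Dt_minus.
      * apply Dt_mult; [apply Dt_scal, D2|apply Di; auto].
      * apply Dt_mult; [apply D3|apply Dt_mult; apply Di; auto].
  - cbv beta. unfold e2. specialize (Hn t Ht). field. auto. }
assert (B2 : forall t, (0 <= t <= 1)%R -> (Cmod (e2 t) <= / 6 * / m ^ 4)%R).
{ intros t Ht. unfold e2. specialize (Hn t Ht).
  assert (Hw1 := Hw t Ht). assert (Hw2 := Hw 0%R ltac:(lra)). rewrite Cplus_0_r in Hw2.
  rewrite Cmod_div by (repeat apply Cmult_neq_0; auto; apply RtoC_neq_0; lra).
  rewrite Cmod_opp, !Cmod_mult, !Cmod_RtoC_pos by lra.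
  set (c := Cmod (w + RtoC t)) in *. set (c0 := Cmod w) in *.
  assert (t * t * t <= 1)%R by nra.
  assert (m ^ 4 <= c0 * (c * c * c))%R.
  { simpl. apply Rmult_le_compat; try nra. replace (m * (m * (m * 1)))%R with (m * m * m)%R by ring.
    assert (m * m <= c * c)%R by nra. nra. }
  assert (0 < m ^ 4)%R by (apply pow_lt; auto).
  rewrite <- Rinv_mult. unfold Rdiv. rewrite <- (Rmult_1_l (/ (6 * m ^ 4))).
  apply Rmult_le_compat; try nra.
  - apply Rlt_le, Rinv_0_lt_compat. nra.
  - apply Rinv_le_contravar; nra. }
assert (B1 := Dt_bound_0 e1 e2 _ ltac:(unfold e1; rewrite Cplus_0_r; field; auto) De1 B2).
assert (B0 := Dt_bound_0 e e1 _ ltac:(unfold e; rewrite Cplus_0_r; field; auto) De B1).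
specialize (B0 1%R ltac:(lra)).
replace (stirling_term w (l 1%R - l 0%R)) with (e 1%R).
- assert (0 < / m ^ 4)%R by (apply Rinv_0_lt_compat, pow_lt; auto). lra.
- unfold e, stirling_term. specialize (Hn 1%R ltac:(lra)). field. auto.
Qed.

Definition wallis (n : nat) : R := RInt (fun x => (sin x ^ n)%R) 0 (PI / 2).

Lemma ex_RInt_sin_pow n : ex_RInt (fun x => (sin x ^ n)%R) 0 (PI / 2).
Proof.
apply (ex_RInt_continuous (V := R_CompleteNormedModule)). intros z _.
apply (ex_derive_continuous (V := R_NormedModule)). auto_derive. trivial.
Qed.

(** Integration of the derivative of - cos x sin^{n+1} x. *)
Lemma wallis_rec n : (INR (n + 2) * wallis (n + 2) = INR (n + 1) * wallis n)%R.
Proof.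
assert (H : is_RInt (fun x => (INR (n + 2) * sin x ^ (n + 2) - INR (n + 1) * sin x ^ n)%R) 0 (PI / 2) 0%R).
{ replace 0%R with (minus (- (cos (PI / 2) * sin (PI / 2) ^ (n + 1))) (- (cos 0 * sin 0 ^ (n + 1))))%R at 2.
  - apply (is_RInt_derive (V := R_CompleteNormedModule) (fun x => (- (cos x * sin x ^ (n + 1)))%R)).
    + intros x _. auto_derive; trivial.
      replace (Init.Nat.pred (n + 1)) with n by lia.
      replace (INR (n + 2)) with (INR (n + 1) + 1)%R by (rewrite !plus_INR; simpl; ring).
      rewrite !pow_add. assert (E := sin2_cos2 x). unfold Rsqr in E.
      replace (cos x * (1 * cos x * (INR (n + 1) * sin x ^ n)))%R
        with ((1 - sin x * sin x) * (INR (n + 1) * sin x ^ n))%R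
        by (replace (1 - sin x * sin x)%R with (cos x * cos x)%R by lra; ring).
      simpl. ring.
    + intros x _. apply (ex_derive_continuous (V := R_NormedModule)). auto_derive. trivial.
  - rewrite cos_PI2, sin_0, pow_i by lia. unfold minus, plus, opp; simpl. ring. }
apply (is_RInt_unique (V := R_CompleteNormedModule)) in H.
rewrite (RInt_minus (V := R_CompleteNormedModule) (fun x => INR (n + 2) * sin x ^ (n + 2))%R (fun x => INR (n + 1) * sin x ^ n)%R) in H.
- rewrite (RInt_scal (V := R_CompleteNormedModule) (fun x => sin x ^ (n + 2))%R), (RInt_scal (V := R_CompleteNormedModule) (fun x => sin x ^ n)%R) in H by apply ex_RInt_sin_pow.
  unfold minus, plus, opp, scal in H; simpl in H. unfold mult in H; simpl in H. unfold wallis. lra.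
- apply (ex_RInt_scal (V := R_NormedModule) (fun x => sin x ^ (n + 2))%R), ex_RInt_sin_pow.
- apply (ex_RInt_scal (V := R_NormedModule) (fun x => sin x ^ n)%R), ex_RInt_sin_pow.
Qed.

Lemma wallis_0 : wallis 0 = (PI / 2)%R.
Proof.
unfold wallis. rewrite (RInt_ext _ (fun _ => 1%R)) by reflexivity.
rewrite RInt_const. unfold scal; simpl; unfold mult; simpl. ring.
Qed.

Lemma wallis_1 : wallis 1 = 1%R.
Proof.
apply is_RInt_unique.
replace 1%R with (minus (- cos (PI / 2)) (- cos 0))%R
  by (rewrite cos_PI2, cos_0; unfold minus, plus, opp; simpl; ring).
apply (is_RInt_derive (V := R_CompleteNormedModule) (fun x => (- cos x)%R)).
- intros x _. auto_derive; trivial. ring.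
- intros x _. apply (ex_derive_continuous (V := R_NormedModule)). auto_derive. trivial.
Qed.

Lemma wallis_decr n : (wallis (S n) <= wallis n)%R.
Proof.
apply RInt_le; try apply ex_RInt_sin_pow.
- generalize PI_RGT_0. lra.
- intros x Hx. assert (0 <= sin x)%R by (apply sin_ge_0; generalize PI_RGT_0; lra).
  simpl. generalize (SIN_bound x) (pow_le _ n H). nra.
Qed.

(** The left-hand side does not depend on n, by the recursion. *)
Lemma wallis_prod n : (INR (n + 1) * wallis (n + 1) * wallis n = PI / 2)%R.
Proof.
induction n.
- simpl (0 + 1)%nat. rewrite wallis_0, wallis_1. simpl. ring.
- replace (S n + 1)%nat with (n + 2)%nat by lia. replace (S n) with (n + 1)%nat by lia.
  rewrite wallis_rec. lra.
Qed.

Lemma wallis_pos n : (0 < wallis n)%R.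
Proof.
assert (A := wallis_prod n).
assert (0 <= wallis n)%R.
{ apply RInt_ge_0; [generalize PI_RGT_0; lra|apply ex_RInt_sin_pow|].
  intros x Hx. apply pow_le, sin_ge_0; generalize PI_RGT_0; lra. }
destruct (Req_dec (wallis n) 0) as [E|E]; [|lra].
rewrite E in A. generalize PI_RGT_0. lra.
Qed.

Lemma wallis_sq_bounds n :
  (PI / 2 <= INR (n + 1) * (wallis n * wallis n) <= PI / 2 * (1 + / INR (n + 1)))%R.
Proof.
assert (A := wallis_prod n). assert (P := wallis_pos n).
assert (D1 := wallis_decr n). assert (D2 := wallis_decr (S n)).
assert (Rec := wallis_rec n). replace (S n) with (n + 1)%nat in * by lia.
replace (S (n + 1)) with (n + 2)%nat in * by lia.
assert (N1 : (1 <= INR (n + 1))%R) by (rewrite plus_INR; simpl; generalize (pos_INR n); lra).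
assert (N2 : (INR (n + 2) = INR (n + 1) + 1)%R) by (rewrite !plus_INR; simpl; lra).
split.
{ rewrite <- A, Rmult_assoc. apply Rmult_le_compat_l; [lra|]. apply Rmult_le_compat_r; lra. }
assert (X : (INR (n + 1) * wallis n * (INR (n + 1) * wallis n) <= PI / 2 * INR (n + 2))%R).
{ rewrite <- A.
  replace (INR (n + 1) * wallis (n + 1) * wallis n * INR (n + 2))%R
    with (INR (n + 1) * wallis n * (INR (n + 2) * wallis (n + 1)))%R by ring.
  apply Rmult_le_compat_l; [nra|]. rewrite <- Rec. apply Rmult_le_compat_l; lra. }
apply Rmult_le_reg_l with (INR (n + 1)); [lra|].
replace (INR (n + 1) * (PI / 2 * (1 + / INR (n + 1))))%R with (PI / 2 * INR (n + 2))%R by (rewrite N2; field; lra).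
lra.
Qed.

(** The central binomial coefficient divided by 4^k. *)
Definition central (k : nat) : R := (INR (fact (2 * k)) / (4 ^ k * (INR (fact k) * INR (fact k))))%R.

Lemma wallis_even k : wallis (2 * k) = (PI / 2 * central k)%R.
Proof.
induction k.
- simpl (2 * 0)%nat. rewrite wallis_0. unfold central. simpl. field.
- replace (2 * S k)%nat with (2 * k + 2)%nat by lia.
  assert (Rec := wallis_rec (2 * k)).
  assert (N0 : INR (2 * k + 2) <> 0%R) by (apply not_0_INR; lia).
  apply Rmult_eq_reg_l with (INR (2 * k + 2)); auto. rewrite Rec, IHk.
  unfold central. replace (2 * S k)%nat with (S (S (2 * k))) by lia.
  rewrite !fact_simpl, !mult_INR.
  replace (2 * k + 2)%nat with (S (S (2 * k))) by lia. replace (2 * k + 1)%nat with (S (2 * k)) by lia.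
  rewrite !S_INR, !mult_INR. simpl (INR 2). simpl (4 ^ S k)%R.
  assert (Hf := INR_fact_neq_0 k). assert (4 ^ k <> 0)%R by (apply pow_nonzero; lra).
  generalize (pos_INR k). intros. field. repeat split; auto; lra.
Qed.

Lemma is_lim_seq_val u (l l' : R) : is_lim_seq u l -> l = l' -> is_lim_seq u l'.
Proof. intros H <-. exact H. Qed.

Lemma is_lim_seq_Rscal c u (l : R) : is_lim_seq u l -> is_lim_seq (fun n => (c * u n)%R) (c * l)%R.
Proof. intros H. apply (is_lim_seq_scal_l u c l H). Qed.

Lemma is_lim_seq_inv_INR : is_lim_seq (fun n => (/ INR n)%R) 0.
Proof.
replace (Finite 0) with (Rbar_inv p_infty) by reflexivity.
apply is_lim_seq_inv; [apply is_lim_seq_INR|discriminate].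
Qed.

Lemma central_lim : is_lim_seq (fun k => (ln (central k) + / 2 * ln (INR (2 * k + 1)))%R) (/ 2 * ln (2 / PI))%R.
Proof.
assert (HP := PI_RGT_0).
assert (Hc : forall k, (0 < central k)%R).
{ intros k. generalize (wallis_pos (2 * k)). rewrite wallis_even. nra. }
assert (HN : forall k, (0 < INR (2 * k + 1))%R) by (intros; apply lt_0_INR; lia).
apply is_lim_seq_ext with (fun k => (/ 2 * ln (INR (2 * k + 1) * (central k * central k)))%R).
{ intros k. specialize (Hc k). rewrite !ln_mult by (auto; nra). field. }
apply is_lim_seq_Rscal.
apply (is_lim_seq_continuous ln).
{ apply continuity_pt_filterlim, (ex_derive_continuous ln). eexists. apply is_derive_ln.
  apply Rdiv_lt_0_compat; lra. }
apply (is_lim_seq_le_le (fun _ => (2 / PI)%R) _ (fun k => (2 / PI * (1 + / INR (2 * k + 1)))%R)).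
- intros k. assert (B := wallis_sq_bounds (2 * k)). rewrite wallis_even in B.
  replace (INR (2 * k + 1) * (PI / 2 * central k * (PI / 2 * central k)))%R
    with (INR (2 * k + 1) * (central k * central k) * (PI / 2 * (PI / 2)))%R in B by ring.
  destruct B as [B1 B2].
  assert (HP2 : (0 < PI / 2 * (PI / 2))%R) by nra.
  split; apply Rmult_le_reg_r with (PI / 2 * (PI / 2))%R; auto.
  + replace (2 / PI * (PI / 2 * (PI / 2)))%R with (PI / 2)%R by (field; lra). exact B1.
  + replace (2 / PI * (1 + / INR (2 * k + 1)) * (PI / 2 * (PI / 2)))%R
      with (PI / 2 * (1 + / INR (2 * k + 1)))%R by (field; generalize (HN k); lra). exact B2.
- apply is_lim_seq_const.
- apply is_lim_seq_val with (2 / PI * (1 + 0))%R; [|ring].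
  apply is_lim_seq_Rscal. apply is_lim_seq_plus'; [apply is_lim_seq_const|].
  apply (is_lim_seq_subseq (fun n => (/ INR n)%R) 0 (fun k => (2 * k + 1)%nat)); [|apply is_lim_seq_inv_INR].
  apply eventually_subseq. intros n. lia.
Qed.

Definition stirling_seq (k : nat) : R :=
  (ln (INR (fact k)) + INR k - (INR k + / 2) * ln (INR k))%R.

Lemma stirling_seq_step k : (0 < k)%nat ->
  (Rabs (stirling_seq k - stirling_seq (S k)) <= 3 / (INR k * INR k))%R.
Proof.
intros Hk. assert (N : (1 <= INR k)%R) by (change 1%R with (INR 1); apply le_INR; lia).
assert (B := stirling_term_bound (RtoC (INR k)) (fun t => RtoC (ln (INR k + t))) (INR k) ltac:(lra)).
assert (E : stirling_term (RtoC (INR k)) (RtoC (ln (INR k + 1)) - RtoC (ln (INR k + 0)))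
   = RtoC (stirling_seq k - stirling_seq (S k) - / (12 * INR k * (INR k + 1)))).
{ unfold stirling_term, stirling_seq. rewrite fact_simpl, mult_INR, ln_mult, S_INR, Rplus_0_r.
  - rewrite <- (RtoC_div 1 2) by lra.
    repeat first [rewrite <- RtoC_plus|rewrite <- RtoC_mult|rewrite <- RtoC_minus].
    rewrite <- RtoC_div by nra. rewrite <- RtoC_minus. f_equal. field. lra.
  - apply lt_0_INR. lia.
  - apply INR_fact_lt_0. }
cbv beta in B; rewrite E in B. clear E.
assert (X : (Rabs (stirling_seq k - stirling_seq (S k) - / (12 * INR k * (INR k + 1))) <= / INR k ^ 4)%R).
{ rewrite <- Cmod_R. apply B.
  - intros t Ht. rewrite <- RtoC_plus, Cmod_RtoC_pos; lra.
  - intros t Ht. rewrite <- RtoC_plus, <- RtoC_inv by lra. split; simpl; auto_derive; try lra; field; lra. }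
assert (Y1 : (/ INR k ^ 4 <= / (INR k * INR k))%R).
{ apply Rinv_le_contravar; [nra|]. simpl. assert (1 <= INR k * INR k)%R by nra. nra. }
assert (Y2 : (0 < / (12 * INR k * (INR k + 1)) <= / (INR k * INR k))%R).
{ split; [apply Rinv_0_lt_compat; nra|]. apply Rinv_le_contravar; nra. }
apply Rabs_le_between in X. apply Rabs_le. unfold Rdiv. lra.
Qed.

Lemma ex_series_inv_sq : ex_series (fun k => (/ (INR (S k) * INR (S k)))%R).
Proof.
assert (T : is_series (fun k => (/ INR (S k) - / INR (S (S k)))%R) 1%R).
{ apply is_series_rsum.
  apply is_lim_seq_ext with (fun n => (1 - / INR (S n))%R).
  - intros n. induction n; [simpl; field|]. cbn [rsum]. rewrite <- IHn. ring.
  - apply is_lim_seq_val with (1 - 0)%R; [|ring]. apply is_lim_seq_minus'; [apply is_lim_seq_const|].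
    apply (is_lim_seq_incr_1 (fun n => (/ INR n)%R)). apply is_lim_seq_inv_INR. }
apply (ex_series_dom _ (fun k => (2 * (/ INR (S k) - / INR (S (S k))))%R)).
- intros n. generalize (INR_S_ge_1 n). intros H.
  rewrite Rabs_pos_eq by (apply Rlt_le, Rinv_0_lt_compat; nra).
  rewrite (S_INR (S n)). set (x := INR (S n)) in *.
  replace (2 * (/ x - / (x + 1)))%R with (/ (x * ((x + 1) / 2)))%R by (field; lra).
  apply Rinv_le_contravar; nra.
- apply ex_series_Rscal.
  now exists 1%R.
Qed.

(** The limit exists since consecutive values differ by O (1 / k^2); Wallis'
    product for the value at 2 k minus twice the value at k identifies it. *)
Lemma stirling : is_lim_seq stirling_seq (/ 2 * ln (2 * PI))%R.
Proof.
assert (HP := PI_RGT_0).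
assert (HL : exists L : R, is_lim_seq stirling_seq L).
{ assert (X : ex_series (fun k => (stirling_seq (S k) - stirling_seq (S (S k)))%R)).
  { apply (ex_series_dom _ (fun k => (3 * / (INR (S k) * INR (S k)))%R)).
    - intros n. apply stirling_seq_step. lia.
    - apply ex_series_Rscal. apply ex_series_inv_sq. }
  destruct X as [l Hl]. apply rsum_lim in Hl. exists (stirling_seq 1 - l)%R.
  apply is_lim_seq_incr_1.
  apply is_lim_seq_ext with (fun n => (stirling_seq 1 - rsum (fun k => (stirling_seq (S k) - stirling_seq (S (S k)))%R) n)%R).
  - intros n.
    assert (E : rsum (fun k => (stirling_seq (S k) - stirling_seq (S (S k)))%R) n = (stirling_seq 1 - stirling_seq (S n))%R).
    { induction n; [simpl; ring|]. cbn [rsum]. rewrite IHn. ring. }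
    rewrite E. ring.
  - apply is_lim_seq_minus'; [apply is_lim_seq_const|exact Hl]. }
destruct HL as [L HL].
assert (H2 : is_lim_seq (fun k => (stirling_seq (2 * k) - 2 * stirling_seq k)%R) (L - 2 * L)%R).
{ apply is_lim_seq_minus'.
  - apply (is_lim_seq_subseq stirling_seq L (fun k => (2 * k)%nat)); auto. apply eventually_subseq. intros; lia.
  - now apply is_lim_seq_Rscal. }
assert (H3 : is_lim_seq (fun k => (stirling_seq (2 * k) - 2 * stirling_seq k)%R) (- (/ 2 * ln (2 * PI)))%R).
{ apply is_lim_seq_ext_loc with (fun k => (ln (central k) + / 2 * ln (INR (2 * k + 1)) - / 2 * ln (2 * (2 + / INR k)))%R).
  - exists 1%nat. intros k Hk. assert (Nk : (0 < INR k)%R) by (apply lt_0_INR; lia).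
    unfold stirling_seq, central.
    assert (F1 := INR_fact_lt_0 k). assert (F2 := INR_fact_lt_0 (2 * k)).
    assert (F4 : (0 < 4 ^ k)%R) by (apply pow_lt; lra).
    rewrite ln_div by (auto; repeat apply Rmult_lt_0_compat; auto).
    rewrite !ln_mult by (auto; try apply Rmult_lt_0_compat; auto; try lra; generalize (Rinv_0_lt_compat _ Nk); lra).
    rewrite ln_pow by lra.
    rewrite mult_INR. simpl (INR 2). replace (1 + 1)%R with 2%R by ring.
    rewrite (ln_mult 2 (INR k)) by lra.
    replace 4%R with (2 * 2)%R by ring. rewrite (ln_mult 2 2) by lra.
    replace (INR (2 * k + 1)) with ((2 + / INR k) * INR k)%R
      by (rewrite plus_INR, mult_INR; simpl; field; lra).
    rewrite (ln_mult (2 + / INR k)) by (auto; generalize (Rinv_0_lt_compat _ Nk); lra).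
    field.
  - replace (- (/ 2 * ln (2 * PI)))%R with (/ 2 * ln (2 / PI) - / 2 * ln (2 * (2 + 0)))%R.
    + apply is_lim_seq_minus'; [apply central_lim|].
      apply is_lim_seq_Rscal.
      apply (is_lim_seq_continuous ln).
      * apply continuity_pt_filterlim, (ex_derive_continuous ln). eexists. apply is_derive_ln. lra.
      * apply is_lim_seq_Rscal. apply is_lim_seq_plus'; [apply is_lim_seq_const|apply is_lim_seq_inv_INR].
    + rewrite ln_div, Rplus_0_r, !ln_mult by lra. field. }
apply is_lim_seq_unique in H2, H3. rewrite H2 in H3. injection H3. intros E.
replace (/ 2 * ln (2 * PI))%R with L by lra. exact HL.
Qed.

(** * Gudermann's series for the factors *)

Lemma Cexp_taylor2 (z : C) : (Cmod z <= 1)%R -> (Cmod (Cexp z - 1 - z) <= 12 * (Cmod z * Cmod z))%R.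
Proof.
intros Hz.
assert (B := Dt_bound_0 (fun t => Cexp (RtoC t * z) - 1 - RtoC t * z)
   (fun t => z * (Cexp (RtoC t * z) - 1)) (6 * (Cmod z * Cmod z))).
replace (Cexp z - 1 - z) with (Cexp (1 * z) - 1 - 1 * z) by (rewrite Cmult_1_l; reflexivity).
replace (12 * (Cmod z * Cmod z))%R with (2 * (6 * (Cmod z * Cmod z)))%R by ring.
apply B; try lra.
- rewrite Cmult_0_l, Cexp_0. ring.
- intros t Ht. eapply Dt_eq.
  + apply Dt_minus; [apply Dt_minus; [apply Dt_exp, Dt_line|apply Dt_const]|apply Dt_line].
  + cbv beta. ring.
- intros t Ht. rewrite Cmod_mult.
  assert (A : (Cmod (RtoC t * z) <= Cmod z)%R).
  { rewrite Cmod_mult, Cmod_RtoC_pos by lra. generalize (Cmod_ge_0 z). nra. }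
  assert (E := Cexp_minus_1_le (RtoC t * z) ltac:(lra)).
  replace (6 * (Cmod z * Cmod z))%R with (Cmod z * (6 * Cmod z))%R by ring.
  apply Rmult_le_compat_l; [apply Cmod_ge_0|lra].
Qed.

Lemma Cprod_Cexp u N : Cprod (fun k => Cexp (u k)) N = Cexp (csum u N).
Proof. induction N; simpl; [now rewrite Cexp_0|]. now rewrite IHN, Cexp_plus. Qed.

Lemma Cprod_ext u v N : (forall k, (k < N)%nat -> u k = v k) -> Cprod u N = Cprod v N.
Proof. induction N; intros H; simpl; auto. rewrite IHN, H by (intros; auto). auto. Qed.

(** As e^z - 1 - z is quadratic in z, the bound of K |eps K| has to come first;
    it uses that e^z - 1 is at least |z| / 2 in modulus. *)
Lemma log_asymp (eps : nat -> C) (c : C) (N0 : nat) :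
  cvg eps 0 ->
  (forall K, (N0 <= K)%nat -> RtoC (INR K) * (Cexp (eps K) - 1) = c) ->
  cvg (fun K => RtoC (INR K) * eps K) c.
Proof.
intros H0 HE.
destruct (proj1 (cvg_spec _ _) H0 (/ 24)%R ltac:(lra)) as [N1 HN1].
apply cvg_le with (N := (N0 + N1)%nat) (b := fun K => (24 * Cmod c * Cmod (eps K - 0))%R).
- intros K HK. specialize (HN1 K ltac:(lia)). specialize (HE K ltac:(lia)).
  replace (eps K - 0) with (eps K) in * by ring.
  set (e := eps K) in *. set (x := Cexp e - 1 - e).
  assert (Hx : (Cmod x <= 12 * (Cmod e * Cmod e))%R) by (apply Cexp_taylor2; lra).
  assert (He := Cmod_ge_0 e). assert (HK0 := pos_INR K).
  assert (E1 : RtoC (INR K) * e = c - RtoC (INR K) * x) by (rewrite <- HE; unfold x; ring).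
  rewrite E1. replace (c - RtoC (INR K) * x - c) with (- (RtoC (INR K) * x)) by ring.
  rewrite Cmod_opp, Cmod_mult, Cmod_RtoC_pos by auto.
  assert (E2 : (INR K * Cmod e <= Cmod c + INR K * Cmod x)%R).
  { rewrite <- (Cmod_RtoC_pos (INR K)) by auto. rewrite <- !Cmod_mult, E1. apply Cmod_triangle_minus. }
  assert (E3 : (INR K * Cmod x <= INR K * (12 * (Cmod e * Cmod e)))%R) by (apply Rmult_le_compat_l; auto).
  assert (E4 : (12 * (Cmod e * Cmod e) <= / 2 * Cmod e)%R) by nra.
  assert (E5 : (INR K * (12 * (Cmod e * Cmod e)) <= INR K * (/ 2 * Cmod e))%R) by (apply Rmult_le_compat_l; auto).
  assert (E6 : (INR K * Cmod e <= 2 * Cmod c)%R) by lra.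
  apply Rle_trans with (1 := E3).
  replace (INR K * (12 * (Cmod e * Cmod e)))%R with (12 * (INR K * Cmod e) * Cmod e)%R by ring.
  apply Rmult_le_compat_r; auto. lra.
- apply is_lim_seq_val with (24 * Cmod c * 0)%R; [|ring]. apply is_lim_seq_Rscal. exact H0.
Qed.

Lemma cvg_RtoC u (l : R) : is_lim_seq u l -> cvg (fun n => RtoC (u n)) (RtoC l).
Proof. intros H. apply cvg_comp. simpl. split; auto. apply is_lim_seq_const. Qed.

Definition gamma_term (w : C) (l : nat -> C) (k : nat) : C :=
  stirling_term (w + RtoC (INR k)) (l (S k) - l k).

(** Summation by parts. *)
Lemma gamma_term_sum (w : C) (l : nat -> C) N : (forall k, w + RtoC (INR k) <> 0) ->
  csum (gamma_term w l) N =
  (w + RtoC (INR N) - 1 / 2) * l N - csum l N - (w - 1 / 2) * l O - RtoC (INR N)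
  - 1 / 12 * (/ w - / (w + RtoC (INR N))).
Proof.
intros Hw. assert (H0 := Hw O). simpl in H0. rewrite Cplus_0_r in H0.
induction N.
- simpl. rewrite Cplus_0_r. ring.
- cbn [csum]. rewrite IHN. unfold gamma_term, stirling_term.
  assert (HN := Hw N). assert (HS := Hw (S N)). rewrite S_INR, RtoC_plus in *.
  field. repeat split; auto.
Qed.

(** Euler's limit for Gamma in terms of logarithms [l k] of [w + k].  Their
    choice is free for 0 < k < oo because summation by parts leaves only
    their exponentials. *)
Lemma gamma_factor (w : C) (l : nat -> C) (H : C) :
  (forall k, Cexp (l k) = w + RtoC (INR k)) ->
  cvg (fun k => l k - RtoC (ln (INR k))) 0 ->
  cvg (csum (gamma_term w l)) H ->
  RtoC (sqrt (2 * PI)) / Gamma w * Cexp ((w - 1 / 2) * l O) * Cexp (1 / (12 * w) - w) = Cexp (- H).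
Proof.
intros Hl Has HH.
assert (Hw : forall k, w + RtoC (INR k) <> 0) by (intros k; rewrite <- Hl; apply Cexp_neq_0).
assert (H0 := Hw O). simpl in H0. rewrite Cplus_0_r in H0.
assert (HP := PI_RGT_0).
(* Asymptotically, l (K + 1) = ln K + (w + 1) / K. *)
set (eps := fun K => l (S K) - RtoC (ln (INR K))).
assert (Heps : cvg eps 0).
{ apply cvg_ext_loc with (N := 1%nat) (u := fun K => (l (K + 1)%nat - RtoC (ln (INR (K + 1)))) + RtoC (ln (1 + / INR K))).
  - intros K HK. unfold eps. rewrite Nat.add_1_r.
    assert (0 < INR K)%R by (apply lt_0_INR; lia).
    replace (ln (INR (S K))) with (ln (INR K) + ln (1 + / INR K))%R.
    + rewrite RtoC_plus. ring.
    + rewrite <- ln_mult; auto.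
      * f_equal. rewrite S_INR. field. lra.
      * generalize (Rinv_0_lt_compat _ H1). lra.
  - replace (RtoC 0) with (RtoC 0 + RtoC (ln (1 + 0))) by (rewrite Rplus_0_r, ln_1; ring).
    apply cvg_plus; [exact (proj2 (cvg_incr _ _ 1) Has)|].
    apply (cvg_RtoC (fun K => ln (1 + / INR K))). apply is_lim_seq_continuous.
    + apply continuity_pt_filterlim, (ex_derive_continuous ln). eexists. apply is_derive_ln. lra.
    + apply is_lim_seq_plus'; [apply is_lim_seq_const|apply is_lim_seq_inv_INR]. }
assert (HKeps : cvg (fun K => RtoC (INR K) * eps K) (w + 1)).
{ apply (log_asymp eps (w + 1) 1); auto.
  intros K HK. unfold eps. assert (0 < INR K)%R by (apply lt_0_INR; lia).
  rewrite Cexp_minus, Hl, Cexp_RtoC, exp_ln by auto. rewrite S_INR, RtoC_plus.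
  field. apply RtoC_neq_0. lra. }
assert (Hinv : cvg (fun K => / (w + RtoC (INR (S K)))) 0).
{ apply cvg_ext_loc with (N := 1%nat) (u := fun K => RtoC (/ INR K) * / Cexp (eps K)).
  - intros K HK. assert (0 < INR K)%R by (apply lt_0_INR; lia).
    unfold eps. rewrite Cexp_minus, Hl, Cexp_RtoC, exp_ln by auto. rewrite RtoC_inv by lra.
    field. split; [apply Hw|apply RtoC_neq_0; lra].
  - replace (RtoC 0) with (RtoC 0 * / Cexp 0) by ring.
    apply cvg_mult; [apply cvg_RtoC, is_lim_seq_inv_INR|].
    apply cvg_inv; [apply Cexp_neq_0|]. now apply cvg_exp. }
set (B := fun K => RtoC (stirling_seq K) + 1 - (w * eps K + RtoC (INR K) * eps K + 1 / 2 * eps K)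
                   - 1 / 12 * / (w + RtoC (INR (S K)))).
assert (HB : cvg B (RtoC (/ 2 * ln (2 * PI)) - w)).
{ replace (RtoC (/ 2 * ln (2 * PI)) - w)
    with (RtoC (/ 2 * ln (2 * PI)) + 1 - (w * 0 + (w + 1) + 1 / 2 * 0) - 1 / 12 * 0) by ring.
  apply cvg_minus; [apply cvg_minus; [apply cvg_plus|apply cvg_plus; [apply cvg_plus|]]|].
  - apply cvg_RtoC, stirling.
  - apply cvg_const.
  - apply cvg_mult; [apply cvg_const|exact Heps].
  - exact HKeps.
  - apply cvg_mult; [apply cvg_const|exact Heps].
  - apply cvg_mult; [apply cvg_const|exact Hinv]. }
set (G := Cexp (H + (w - 1 / 2) * l O + 1 / 12 * / w + (RtoC (/ 2 * ln (2 * PI)) - w))).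
assert (HG : Gamma w = G).
{ apply cvg_Clim_seq.
  apply cvg_ext_loc with (N := 1%nat)
    (u := fun K => Cexp (csum (gamma_term w l) (K + 1) + (w - 1 / 2) * l O + 1 / 12 * / w + B K)).
  - intros K HK. assert (HK0 : (0 < INR K)%R) by (apply lt_0_INR; lia).
    rewrite (Cprod_ext _ (fun k => Cexp (l k))) by (intros; now rewrite Hl).
    rewrite Cprod_Cexp, <- (exp_ln (INR (fact K))), <- Cexp_RtoC, <- Cexp_plus, <- Cexp_minus by apply INR_fact_lt_0.
    f_equal. rewrite Nat.add_1_r, gamma_term_sum by auto.
    unfold B, eps, stirling_seq. specialize (Hw (S K)).
    rewrite S_INR, !RtoC_plus, !RtoC_minus, !RtoC_plus, !RtoC_mult, !RtoC_plus in *.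
    rewrite RtoC_inv by lra. field. auto.
  - apply cvg_exp. apply cvg_plus; [|exact HB].
    apply cvg_plus; [apply cvg_plus|]; try apply cvg_const. now apply cvg_incr. }
assert (Hs : RtoC (sqrt (2 * PI)) = Cexp (RtoC (/ 2 * ln (2 * PI)))).
{ rewrite Cexp_RtoC. f_equal. 
  replace (sqrt (2 * PI)) with (exp (ln (sqrt (2 * PI)))) by (apply exp_ln, sqrt_lt_R0; lra).
  f_equal. rewrite <- Rpower_sqrt by lra. unfold Rpower. now rewrite ln_exp. }
rewrite HG, Hs. unfold G. rewrite <- Cexp_minus, <- !Cexp_plus. f_equal. field. auto.
Qed.

Lemma factor_eq (beta y : C) n (l : nat -> C) (H : C) :
  beta <> 0 ->
  (forall k, Cexp (l k) = warg beta y n + RtoC (INR k)) ->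
  cvg (fun k => l k - RtoC (ln (INR k))) 0 ->
  cvg (csum (gamma_term (warg beta y n) l)) H ->
  factor beta y n (l O) = Cexp (- H).
Proof.
intros Hb Hl Has HH. rewrite <- (gamma_factor _ _ _ Hl Has HH). unfold factor.
assert (Hn : warg beta y n <> 0).
{ generalize (Hl O). simpl. rewrite Cplus_0_r. intros <-. apply Cexp_neq_0. }
f_equal. f_equal. f_equal. unfold warg in *. field. split; auto.
intros E. apply Hn. rewrite E. unfold Cdiv. ring.
Qed.

(** * Continuation along polygons *)

Definition seg (u v : C) (t : R) : C := u + RtoC t * (v - u).

Lemma seg_0 u v : seg u v 0 = u.
Proof. unfold seg. ring. Qed.

Lemma seg_1 u v : seg u v 1 = v.
Proof. unfold seg. ring. Qed.

Lemma Dt_seg u v t : Dt (seg u v) t (v - u).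
Proof. apply Dt_affine. Qed.

Lemma Cmod_seg u v t : (0 <= t <= 1)%R -> (Cmod (seg u v t) <= Cmod u + Cmod v)%R.
Proof.
intros Ht. unfold seg. replace (u + RtoC t * (v - u)) with (RtoC (1 - t) * u + RtoC t * v)
  by (rewrite RtoC_minus; ring).
eapply Rle_trans; [apply Cmod_triangle|]. rewrite !Cmod_mult, !Cmod_RtoC_pos by lra.
generalize (Cmod_ge_0 u) (Cmod_ge_0 v). nra.
Qed.

Lemma Re_seg u v t : Re (seg u v t) = ((1 - t) * Re u + t * Re v)%R.
Proof. unfold seg. rewrite re_plus, re_scal_l, re_minus. ring. Qed.

Lemma Im_seg u v t : Im (seg u v t) = ((1 - t) * Im u + t * Im v)%R.
Proof. unfold seg. rewrite im_plus, im_scal_l, im_minus. ring. Qed.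

(** [continued u F f lam]: the numbers F, f and lam n are values at u of
    Li_2 (e^{-u}), log (1 - e^{-u}) and log (u + 2 pi i n), obtained from the
    principal values at 1 by continuation along a polygon that avoids
    2 pi i Z, the same for all of them.  Continuation along a segment is
    expressed by the differential equations of these functions. *)
Inductive continued : C -> C -> C -> (Z -> C) -> Prop :=
| continued_base :
    continued 1 (li2exp 1) (log1exp 1) (fun n => Clog (1 + period n))
| continued_step (u F f : C) (lam : Z -> C) (v : C) (Ft ft : R -> C) (lt : Z -> R -> C)
    (F' f' : C) (lam' : Z -> C) :
    continued u F f lam ->
    (forall t, (0 <= t <= 1)%R -> nonpole (seg u v t)) ->
    (forall t, (0 <= t <= 1)%R -> Dt Ft t ((v - u) * ft t)) ->
    (forall t, (0 <= t <= 1)%R -> Dt ft t ((v - u) / (Cexp (seg u v t) - 1))) ->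
    (forall n t, (0 <= t <= 1)%R -> Dt (lt n) t ((v - u) / (seg u v t + period n))) ->
    Ft 0%R = F -> ft 0%R = f -> (forall n, lt n 0%R = lam n) ->
    Ft 1%R = F' -> ft 1%R = f' -> (forall n, lt n 1%R = lam' n) ->
    continued v F' f' lam'.

Lemma nonpole_right u : (0 < Re u)%R -> nonpole u.
Proof. intros H. apply nonpole_exp. now apply Cexp_minus_1_neq_0. Qed.

Lemma continued_nonpole u F f lam : continued u F f lam -> nonpole u.
Proof.
intros H. destruct H.
- apply nonpole_right. simpl. lra.
- rewrite <- (seg_1 u v). apply H0. lra.
Qed.

(** g e^{-l} is constant along the path. *)
Lemma Cexp_log_path (l g : R -> C) (g' : R -> C) :
  (forall t, (0 <= t <= 1)%R -> Dt g t (g' t)) ->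
  (forall t, (0 <= t <= 1)%R -> g t <> 0) ->
  (forall t, (0 <= t <= 1)%R -> Dt l t (g' t / g t)) ->
  Cexp (l 0%R) = g 0%R -> Cexp (l 1%R) = g 1%R.
Proof.
intros Hg H0 Hl E.
assert (X : Cexp (- l 1%R) * g 1%R = Cexp (- l 0%R) * g 0%R).
{ apply (Dt_zero_const (fun t => Cexp (- l t) * g t)). intros t Ht.
  eapply Dt_eq.
  - apply Dt_mult; [apply Dt_exp, Dt_opp, Hl|apply Hg]; auto.
  - cbv beta. field. auto. }
rewrite <- E, Cexp_opp_l in X.
replace (g 1%R) with (Cexp (l 1%R) * (Cexp (- l 1%R) * g 1%R)).
- rewrite X. ring.
- rewrite Cmult_assoc, (Cmult_comm (Cexp _)), Cexp_opp_l. ring.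
Qed.

Lemma continued_exp u F f lam : continued u F f lam ->
  (forall n, Cexp (lam n) = u + period n) /\ Cexp f = 1 - Cexp (- u).
Proof.
intros H. induction H as [|u F f lam v Ft ft lt F' f' lam' Hu [IHl IHf] Hp HF Hf Hl F0 f0 l0 F1 f1 l1].
- split.
  + intros n. apply Cexp_Clog. apply nonpole_right. simpl. lra.
  + apply Cexp_log1exp. simpl. lra.
- split.
  + intros n. rewrite <- l1, <- (seg_1 u v).
    apply (Cexp_log_path (lt n) (fun t => seg u v t + period n) (fun _ => v - u)).
    * intros t _. eapply Dt_eq; [apply Dt_plus; [apply Dt_seg|apply Dt_const]|cbv beta; ring].
    * intros t Ht. now apply Hp.
    * intros t Ht. now apply Hl.
    * rewrite seg_0, l0. apply IHl.
  + rewrite <- f1, <- (seg_1 u v).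
    apply (Cexp_log_path ft (fun t => 1 - Cexp (- seg u v t)) (fun t => (v - u) * Cexp (- seg u v t))).
    * intros t _. eapply Dt_eq; [apply Dt_minus; [apply Dt_const|apply Dt_exp, Dt_opp, Dt_seg]|cbv beta; ring].
    * intros t Ht E. apply (proj1 (nonpole_exp _) (Hp t Ht)).
      replace (Cexp (seg u v t) - 1) with (Cexp (seg u v t) * (1 - Cexp (- seg u v t))).
      -- rewrite E. ring.
      -- rewrite Cexp_opp. field. apply Cexp_neq_0.
    * intros t Ht. eapply Dt_eq; [apply Hf; auto|]. rewrite Cexp_opp.
      assert (N := proj1 (nonpole_exp _) (Hp t Ht)). field. split; auto. apply Cexp_neq_0.
    * rewrite seg_0, f0. apply IHf.
Qed.

Lemma continued_right u : (0 < Re u)%R ->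
  continued u (li2exp u) (log1exp u) (fun n => Clog (u + period n)).
Proof.
intros Hu.
assert (Hr : forall t, (0 <= t <= 1)%R -> (0 < Re (seg 1 u t))%R).
{ intros t Ht. rewrite Re_seg. simpl (Re 1). destruct (Req_dec t 0) as [->|]; nra. }
assert (Hrp : forall n t, (0 <= t <= 1)%R -> (0 < Re (seg 1 u t + period n))%R).
{ intros n t Ht. rewrite re_plus. simpl (Re (period n)). specialize (Hr t Ht). lra. }
apply (continued_step _ _ _ _ u (fun t => li2exp (seg 1 u t)) (fun t => log1exp (seg 1 u t))
  (fun n t => Clog (seg 1 u t + period n)) _ _ _ continued_base); try (intros; now rewrite ?seg_0, ?seg_1).
- intros t Ht. now apply nonpole_right, Hr.
- intros t Ht. apply Dt_li2exp; [apply Dt_seg|now apply Hr].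
- intros t Ht. apply Dt_log1exp; [apply Dt_seg|now apply Hr].
- intros n t Ht. apply (Dt_Clog (fun t => seg 1 u t + period n)).
  + eapply Dt_eq; [apply Dt_plus; [apply Dt_seg|apply Dt_const]|cbv beta; ring].
  + left. now apply Hrp.
Qed.

(** The integrand is extended continuously beyond [0, 1], so that the derivative
    of its integral at the end points is two-sided. *)
Lemma antiderivative (h : R -> R) (c : R) :
  (forall t, (0 <= t <= 1)%R -> continuous h t) ->
  exists H : R -> R, H 0%R = c /\ forall t, (0 <= t <= 1)%R -> is_derive H t (h t).
Proof.
intros Hc.
destruct (C0_extension_le h 0 1) as [g [Hg E]].
{ intros t Ht. apply Hc. exact Ht. }
exists (fun t => (c + RInt g 0 t)%R). split.
- rewrite RInt_point. unfold zero; simpl. ring.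
- intros t Ht. rewrite <- E by auto.
  replace (g t) with (plus zero (g t)) by (unfold plus, zero; simpl; ring).
  apply @is_derive_plus; [apply @is_derive_const|].
  apply (is_derive_RInt (V := R_CompleteNormedModule) g _ 0%R).
  + exists (mkposreal 1 Rlt_0_1). intros x _. apply (RInt_correct (V := R_CompleteNormedModule)).
    apply (ex_RInt_continuous (V := R_CompleteNormedModule)). intros z _. apply Hg.
  + apply Hg.
Qed.

Lemma Cantiderivative (g : R -> C) (c : C) :
  (forall t, (0 <= t <= 1)%R -> exists l, Dt g t l) ->
  exists G : R -> C, G 0%R = c /\ forall t, (0 <= t <= 1)%R -> Dt G t (g t).
Proof.
intros Hg.
destruct (antiderivative (fun t => Re (g t)) (Re c)) as [G1 [E1 D1]].
{ intros t Ht. destruct (Hg t Ht) as [l [H _]]. apply (ex_derive_continuous (fun t => Re (g t))). eexists; exact H. }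
destruct (antiderivative (fun t => Im (g t)) (Im c)) as [G2 [E2 D2]].
{ intros t Ht. destruct (Hg t Ht) as [l [_ H]]. apply (ex_derive_continuous (fun t => Im (g t))). eexists; exact H. }
exists (fun t => (G1 t, G2 t)). split.
- rewrite E1, E2. now destruct c.
- intros t Ht. split; simpl; [now apply D1|now apply D2].
Qed.

Lemma continued_extend u F f lam v : continued u F f lam ->
  (forall t, (0 <= t <= 1)%R -> nonpole (seg u v t)) ->
  exists F' f' lam', continued v F' f' lam'.
Proof.
intros H Hp.
destruct (Cantiderivative (fun t => (v - u) / (Cexp (seg u v t) - 1)) f) as [ft [f0 Hf]].
{ intros t Ht. eexists. apply Dt_mult; [apply Dt_const|].
  apply (Dt_inv (fun t => Cexp (seg u v t) - 1)); [apply nonpole_exp, Hp, Ht|].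
  apply Dt_minus; [apply Dt_exp, Dt_seg|apply Dt_const]. }
destruct (Cantiderivative (fun t => (v - u) * ft t) F) as [Ft [F0 HF]].
{ intros t Ht. eexists. apply Dt_scal. apply Hf, Ht. }
assert (Hl : forall n, exists l : R -> C, l 0%R = lam n /\
   forall t, (0 <= t <= 1)%R -> Dt l t ((v - u) / (seg u v t + period n))).
{ intros n. apply Cantiderivative. intros t Ht. eexists. apply Dt_mult; [apply Dt_const|].
  apply (Dt_inv (fun t => seg u v t + period n)); [apply Hp, Ht|].
  apply Dt_plus; [apply Dt_seg|apply Dt_const]. }
set (lt := fun n => proj1_sig (constructive_indefinite_description _ (Hl n))).
assert (Hlt := fun n => proj2_sig (constructive_indefinite_description _ (Hl n))). 
exists (Ft 1%R), (ft 1%R), (fun n => lt n 1%R).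
apply (continued_step u F f lam v Ft ft lt); auto.
- intros n t Ht. apply (Hlt n), Ht.
- intros n. apply (Hlt n).
Qed.

(** Any point is reached horizontally from the right half-plane on a line
    between two poles, followed by a vertical segment if the point lies to the
    left of a pole. *)
Lemma continued_exists u : nonpole u -> exists F f lam, continued u F f lam.
Proof.
intros Hu.
destruct (Rlt_le_dec 0 (Re u)) as [Hr|Hr].
{ do 3 eexists. apply continued_right, Hr. }
assert (HP := PI_RGT_0).
assert (Hor : forall b : R, (forall n, (b + 2 * PI * IZR n <> 0)%R) ->
   exists F f lam, continued (Re u, b) F f lam).
{ intros b Hb. apply (continued_extend _ _ _ _ _ (continued_right (1, b)%R ltac:(simpl; lra))).
  intros t Ht n E. apply (Hb n). apply (f_equal Im) in E.
  rewrite im_plus, Im_seg in E. simpl in E. rewrite <- E. ring. }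
destruct (excluded_middle_informative (forall n, (Im u + 2 * PI * IZR n <> 0)%R)) as [Hb|Hb].
- destruct u. now apply Hor.
- apply not_all_ex_not in Hb. destruct Hb as [m Hm]. apply NNPP in Hm.
  assert (Hlt : (Re u < 0)%R).
  { destruct Hr as [|E]; auto. exfalso. apply (Hu m). destruct u. simpl in *. Csolve; lra. }
  destruct (Hor (Im u + PI)%R) as [F [f [lam H]]].
  { intros n E. assert (E1 : ((IZR n - IZR m) * 2 * PI + 1 * PI = 0)%R) by lra.
    assert (E2 : ((IZR n - IZR m) * 2 = -1)%R).
    { apply Rmult_eq_reg_r with PI; lra. }
    rewrite <- minus_IZR, <- mult_IZR in E2. apply eq_IZR in E2. lia. }
  apply (continued_extend _ _ _ _ _ H).
  intros t Ht n E. apply (f_equal Re) in E. rewrite re_plus, Re_seg in E. simpl in E. lra.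
Qed.

(** * Summation over n *)

(** For the polynomial K (z) = a z^2 + b z + c this is K f' - K' f + K'' F with
    f = log (u + 2 pi i n) and its antiderivative F; likewise [bracket] for
    f = log (1 - e^{-u}) and F = Li_2 (e^{-u}).  The derivative is K f'', as K
    is quadratic. *)
Definition bracket_n (a b c u : C) (lam : Z -> C) (n : Z) : C :=
  (a * (u * u) + b * u + c) / (u + period n) - (2 * a * u + b) * lam n
  + 2 * a * ((u + period n) * (lam n - 1)).

Definition bracket (a b c u F f : C) : C :=
  (a * (u * u) + b * u + c) / (Cexp u - 1) - (2 * a * u + b) * f + 2 * a * F.

Lemma Dt_zsum (g : Z -> R -> C) (dg : Z -> C) t M :
  (forall n, Dt (g n) t (dg n)) -> Dt (fun s => zsum (fun n => g n s) M) t (zsum dg M).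
Proof.
intros H. induction M; cbn [zsum]; [apply H|]. apply Dt_plus; auto. now apply Dt_plus.
Qed.

(** Along each segment of the polygon, the difference of the two sides has as
    derivative a bounded function times the error of the partial fraction
    expansion, which tends to 0 uniformly. *)
Lemma bracket_sum a b c u F f lam : continued u F f lam ->
  cvg (fun M => zsum (fun n => bracket_n a b c u lam n - bracket_n a b c 1 (fun n => Clog (1 + period n)) n) M)
      (bracket a b c u F f - bracket a b c 1 (li2exp 1) (log1exp 1)).
Proof.
intros H. induction H as [|u F f lam v Ft ft lt F' f' lam' Hu IH Hp HF Hf Hl F0 f0 l0 F1 f1 l1].
- replace (bracket a b c 1 (li2exp 1) (log1exp 1) - bracket a b c 1 (li2exp 1) (log1exp 1)) with (RtoC 0) by ring.
  apply cvg_ext with (u := fun _ => RtoC 0); [|apply cvg_const].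
  intros M. induction M; cbn [zsum]; [ring|rewrite <- IHM; ring].
- set (K := fun z : C => a * (z * z) + b * z + c).
  assert (DK : forall t, Dt (fun t => K (seg u v t)) t ((v - u) * (2 * a * seg u v t + b))).
  { intros t. eapply Dt_eq.
    - apply Dt_plus; [apply Dt_plus; [apply Dt_scal, Dt_mult; apply Dt_seg|apply Dt_scal, Dt_seg]|apply Dt_const].
    - cbv beta. ring. }
  assert (DK' : forall t, Dt (fun t => 2 * a * seg u v t + b) t ((v - u) * (2 * a))).
  { intros t. eapply Dt_eq; [apply Dt_plus; [apply Dt_scal, Dt_seg|apply Dt_const]|cbv beta; ring]. }
  assert (Dn : forall n t, (0 <= t <= 1)%R ->
     Dt (fun t => bracket_n a b c (seg u v t) (fun n => lt n t) n) t
        (- ((v - u) * K (seg u v t)) * pole_sq (seg u v t) n)).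
  { intros n t Ht. assert (N := Hp t Ht n).
    assert (Ds : Dt (fun t => seg u v t + period n) t (v - u)).
    { eapply Dt_eq; [apply Dt_plus; [apply Dt_seg|apply Dt_const]|cbv beta; ring]. }
    eapply Dt_eq.
    - apply Dt_plus; [apply Dt_minus|].
      + apply Dt_mult; [apply DK|]. apply (Dt_inv (fun t => seg u v t + period n)); [exact N|exact Ds].
      + apply Dt_mult; [apply DK'|apply Hl, Ht].
      + apply Dt_scal, Dt_mult; [exact Ds|]. apply Dt_minus; [apply Hl, Ht|apply Dt_const].
    - cbv beta. unfold pole_sq, K. field. exact N. }
  assert (Df : forall t, (0 <= t <= 1)%R ->
     Dt (fun t => bracket a b c (seg u v t) (Ft t) (ft t)) t (- ((v - u) * K (seg u v t)) * phi (seg u v t))).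
  { intros t Ht. assert (N := proj1 (nonpole_exp _) (Hp t Ht)).
    eapply Dt_eq.
    - apply Dt_plus; [apply Dt_minus|].
      + apply Dt_mult; [apply DK|]. apply (Dt_inv (fun t => Cexp (seg u v t) - 1)); [exact N|].
        apply Dt_minus; [apply Dt_exp, Dt_seg|apply Dt_const].
      + apply Dt_mult; [apply DK'|apply Hf, Ht].
      + apply Dt_scal, HF, Ht.
    - cbv beta. unfold phi, K. field. exact N. }
  set (R := (Cmod u + Cmod v)%R).
  assert (HR : (0 <= R)%R) by (unfold R; generalize (Cmod_ge_0 u) (Cmod_ge_0 v); lra).
  set (B := (Cmod (v - u) * (Cmod a * (R * R) + Cmod b * R + Cmod c))%R).
  assert (HB : forall t, (0 <= t <= 1)%R -> (Cmod ((v - u) * K (seg u v t)) <= B)%R).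
  { intros t Ht. assert (S := Cmod_seg u v t Ht). fold R in S. assert (S0 := Cmod_ge_0 (seg u v t)).
    rewrite Cmod_mult. apply Rmult_le_compat_l; [apply Cmod_ge_0|].
    unfold K. eapply Rle_trans; [apply Cmod_triangle|]. apply Rplus_le_compat_r.
    eapply Rle_trans; [apply Cmod_triangle|]. rewrite !Cmod_mult.
    apply Rplus_le_compat; apply Rmult_le_compat_l; try apply Cmod_ge_0; auto. apply Rmult_le_compat; auto. }
  destruct (archimed_cor1 (/ (R + 1))) as [N0 [HN0 HN0']]; [apply Rinv_0_lt_compat; lra|].
  assert (HRN : (R <= INR N0)%R).
  { apply Rnot_lt_le. intros HX. assert (0 < INR N0)%R by (apply lt_0_INR; lia).
    assert (/ (R + 1) < / INR N0)%R by (apply Rinv_lt_contravar; nra). lra. }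
  set (G := fun M t => zsum (fun n => bracket_n a b c (seg u v t) (fun n => lt n t) n) M
                       - bracket a b c (seg u v t) (Ft t) (ft t)).
  assert (HG : cvg (fun M => G M 1%R - G M 0%R) 0).
  { apply cvg_le with (N := N0) (b := fun M => (4 * B * / INR M)%R).
    - intros M HM. replace (G M 1%R - G M 0%R - 0) with (G M 1%R - G M 0%R) by ring.
      assert (HM0 : (0 < INR M)%R) by (apply lt_0_INR; lia).
      assert (HMR : (R <= INR M)%R) by (apply Rle_trans with (INR N0); auto; apply le_INR, HM).
      replace (4 * B * / INR M)%R with (2 * (B * (2 / INR M)) * (1 - 0))%R by (field; lra).
      apply Dt_bound with (df := fun t => - ((v - u) * K (seg u v t)) * (zsum (pole_sq (seg u v t)) M - phi (seg u v t))); try lra.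
      + intros t Ht. eapply Dt_eq.
        * apply Dt_minus; [|apply Df, Ht].
          apply (Dt_zsum (fun n t => bracket_n a b c (seg u v t) (fun n => lt n t) n)
             (fun n => - ((v - u) * K (seg u v t)) * pole_sq (seg u v t) n)).
          intros n. apply Dn, Ht.
        * rewrite zsum_scal. ring.
      + intros t Ht. rewrite Cmod_mult, Cmod_opp. apply Rmult_le_compat; try apply Cmod_ge_0; auto.
        apply partial_fractions; [apply Hp, Ht|lia|].
        eapply Rle_trans; [apply Cmod_seg, Ht|exact HMR].
    - apply is_lim_seq_val with (4 * B * 0)%R; [|cbv beta; ring]. apply is_lim_seq_Rscal, is_lim_seq_inv_INR. }
  replace (bracket a b c v F' f' - bracket a b c 1 (li2exp 1) (log1exp 1))
    with ((0 + (bracket a b c u F f - bracket a b c 1 (li2exp 1) (log1exp 1))) + (bracket a b c v F' f' - bracket a b c u F f)) by ring.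
  apply cvg_ext with (2 := cvg_plus _ _ _ _ (cvg_plus _ _ _ _ HG IH) (cvg_const (bracket a b c v F' f' - bracket a b c u F f))).
  intros M. unfold G. rewrite seg_0, seg_1, F0, f0, F1, f1.
  rewrite (zsum_ext (fun n => bracket_n a b c u (fun n => lt n 0%R) n) (bracket_n a b c u lam)) by (intros; unfold bracket_n; now rewrite l0).
  rewrite (zsum_ext (fun n => bracket_n a b c v (fun n => lt n 1%R) n) (bracket_n a b c v lam')) by (intros; unfold bracket_n; now rewrite l1).
  assert (Z : forall p q, zsum (fun n => p n - q n) M = zsum p M - zsum q M).
  { intros p q. clear. induction M; cbn [zsum]; [ring|]. rewrite IHM. ring. }
  rewrite !Z. ring.
Qed.

Lemma bracket_step a b c u F f lam v F' f' lam' :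
  continued u F f lam -> continued v F' f' lam' ->
  cvg (fun M => zsum (fun n => bracket_n a b c v lam' n - bracket_n a b c u lam n) M)
      (bracket a b c v F' f' - bracket a b c u F f).
Proof.
intros Hu Hv.
apply cvg_ext with (u := fun M =>
  zsum (fun n => bracket_n a b c v lam' n - bracket_n a b c 1 (fun n => Clog (1 + period n)) n) M
  - zsum (fun n => bracket_n a b c u lam n - bracket_n a b c 1 (fun n => Clog (1 + period n)) n) M).
- intros M. induction M; cbn [zsum]; [ring|]. rewrite <- IHM. ring.
- replace (bracket a b c v F' f' - bracket a b c u F f) with
    ((bracket a b c v F' f' - bracket a b c 1 (li2exp 1) (log1exp 1))
     - (bracket a b c u F f - bracket a b c 1 (li2exp 1) (log1exp 1))) by ring.
  apply cvg_minus; now apply bracket_sum.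
Qed.

(** * Logarithms of distant factors *)

Lemma warg_im (beta z : C) n : beta <> 0 ->
  (Im ((z + period n) / beta) * (Cmod beta * Cmod beta)
   = Re beta * (2 * PI * IZR n) + (Im z * Re beta - Re z * Im beta))%R.
Proof.
intros Hb. assert (N := Cnorm2_neq_0 _ Hb). rewrite Cmod_sqr.
destruct beta as [p q], z as [x y]. unfold period, Cdiv. simpl in *. field.
intros E. apply N. rewrite <- E. ring.
Qed.

(** The imaginary part of the numerator times the conjugate of beta is dominated
    by 2 pi n Re beta. *)
Lemma warg_im_neq_0 (beta z : C) n : (0 < Re beta)%R ->
  (2 * Cmod z * Cmod beta < Re beta * Rabs (IZR n))%R -> Im ((z + period n) / beta) <> 0%R.
Proof.
intros Hb H E.
assert (Hb0 := Re_pos_neq_0 beta Hb).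
assert (A := warg_im beta z n Hb0). rewrite E, Rmult_0_l in A.
assert (HP := PI_ge_1).
assert (B : (Rabs (Re beta * (2 * PI * IZR n)) = Re beta * Rabs (IZR n) * (2 * PI))%R).
{ rewrite !Rabs_mult, (Rabs_pos_eq (Re beta)), (Rabs_pos_eq 2), (Rabs_pos_eq PI) by lra. ring. }
assert (D : (Rabs (Im z * Re beta - Re z * Im beta) <= 2 * Cmod z * Cmod beta)%R).
{ eapply Rle_trans; [apply Rabs_triang|]. rewrite Rabs_Ropp, !Rabs_mult.
  generalize (Re_le_Cmod z) (Im_le_Cmod z) (Re_le_Cmod beta) (Im_le_Cmod beta)
    (Rabs_pos (Re z)) (Rabs_pos (Im z)) (Rabs_pos (Re beta)) (Rabs_pos (Im beta)). intros.
  assert (Rabs (Im z) * Rabs (Re beta) <= Cmod z * Cmod beta)%R by (apply Rmult_le_compat; auto).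
  assert (Rabs (Re z) * Rabs (Im beta) <= Cmod z * Cmod beta)%R by (apply Rmult_le_compat; auto). lra. }
assert (E1 : (Re beta * (2 * PI * IZR n) = - (Im z * Re beta - Re z * Im beta))%R) by lra.
rewrite E1, Rabs_Ropp in B.
generalize (Rabs_pos (IZR n)) (Cmod_ge_0 z) (Cmod_ge_0 beta). intros.
assert (0 <= Re beta * Rabs (IZR n))%R by nra. nra.
Qed.

Lemma nat_upper (x : R) : exists N : nat, (x < INR N)%R.
Proof.
destruct (INR_unbounded x) as [N HN]. exists N. lra.
Qed.

(** For large n the quotients (z + 2 pi i n) / beta stay off the real axis when z
    runs over the polygon, so that the principal logarithm is continuous there. *)
Lemma continued_far beta u F f lam : (0 < Re beta)%R -> continued u F f lam ->
  exists N : nat, forall n, (INR N <= Rabs (IZR n))%R ->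
    lam n = Clog (warg beta u n) + Clog beta.
Proof.
intros Hb H.
assert (Hb0 := Re_pos_neq_0 beta Hb).
induction H as [|u F f lam v Ft ft lt F' f' lam' Hu [N0 IH] Hp HF Hf Hl F0 f0 l0 F1 f1 l1].
- exists O. intros n _. unfold warg. rewrite Clog_div_right; [ring| |auto].
  rewrite re_plus. simpl. lra.
- destruct (nat_upper (2 * (Cmod u + Cmod v) * Cmod beta / Re beta)) as [N1 HN1].
  exists (N0 + N1)%nat. intros n Hn. rewrite plus_INR in Hn.
  generalize (pos_INR N0) (pos_INR N1). intros.
  rewrite <- l1, <- (seg_1 u v).
  apply (Dt_same_end (lt n) (fun t => Clog (warg beta (seg u v t) n) + Clog beta)
     (fun t => (v - u) / (seg u v t + period n))).
  + intros t Ht. now apply Hl.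
  + intros t Ht. eapply Dt_eq.
    * apply Dt_plus; [|apply Dt_const].
      apply (Dt_Clog (fun t => warg beta (seg u v t) n) t ((v - u) / beta)).
      -- eapply Dt_eq; [apply Dt_mult; [apply Dt_plus; [apply Dt_seg|apply Dt_const]|apply Dt_const]|].
         unfold Cdiv. ring.
      -- right. apply warg_im_neq_0; auto.
         assert (S := Cmod_seg u v t Ht).
         apply Rle_lt_trans with (2 * (Cmod u + Cmod v) * Cmod beta)%R.
         ++ apply Rmult_le_compat_r; [apply Cmod_ge_0|lra].
         ++ apply Rlt_div_l in HN1; [|lra]. nra.
    * unfold warg. field. split; auto. now apply Hp.
  + rewrite seg_0, l0. apply IH. lra.
Qed.

(** * Summation over n and k *)

(** As Re beta > 0, the numbers beta and 2 pi i are linearly independent over the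
    reals: |s beta + 2 pi i n| is at least a multiple of s + |n|. *)
Lemma lattice_lower (beta y : C) : (0 < Re beta)%R ->
  exists (c : R) (N : nat), (0 < c)%R /\
    forall (k : nat) (n : Z) (t : R), (0 <= t <= 1)%R -> (INR N <= INR k + Rabs (IZR n))%R ->
      (c * (INR k + Rabs (IZR n)) <= Cmod (warg beta y n + RtoC (INR k) + RtoC t))%R.
Proof.
intros Hb.
assert (Hb0 := Re_pos_neq_0 beta Hb).
assert (Hbm : (0 < Cmod beta)%R) by now apply Cmod_gt_0.
set (p := Re beta) in *. set (q := Im beta).
set (A := (/ p + (1 + Rabs q / p))%R).
assert (Hip : (0 < / p)%R) by now apply Rinv_0_lt_compat.
assert (Hq : (0 <= Rabs q / p)%R) by (apply Rdiv_le_0_compat; auto; apply Rabs_pos).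
assert (HA : (0 < A)%R) by (unfold A; lra).
destruct (nat_upper (2 * A * Cmod y)) as [N HN].
exists (/ (2 * A * Cmod beta))%R, N.
split; [apply Rinv_0_lt_compat; repeat apply Rmult_lt_0_compat; lra|].
intros k n t Ht Hk.
set (s := (INR k + t)%R). assert (Hk0 := pos_INR k).
assert (Hs : (0 <= s)%R) by (unfold s; lra).
set (X := RtoC s * beta + period n).
assert (EX : warg beta y n + RtoC (INR k) + RtoC t = (y + X) / beta).
{ unfold warg, X, s. rewrite RtoC_plus. field. auto. }
rewrite EX, Cmod_div by auto.
assert (B1 : (s <= Cmod X * / p)%R).
{ apply Rmult_le_reg_r with p; auto. rewrite Rmult_assoc, Rinv_l, Rmult_1_r by lra.
  assert (R1 := Re_le_Cmod X). unfold X in R1 at 1. rewrite re_plus, re_scal_l in R1.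
  change (Re (period n)) with 0%R in R1. fold p in R1.
  generalize (Rle_abs (s * p + 0)). lra. }
assert (B2 : (Rabs (IZR n) <= Cmod X + s * Rabs q)%R).
{ assert (R1 := Im_le_Cmod X). unfold X in R1 at 1. rewrite im_plus, im_scal_l in R1.
  change (Im (period n)) with (2 * PI * IZR n)%R in R1. fold q in R1.
  assert (R2 := Rabs_triang (s * q + 2 * PI * IZR n) (- (s * q))).
  replace (s * q + 2 * PI * IZR n + - (s * q))%R with (2 * PI * IZR n)%R in R2 by ring.
  rewrite Rabs_Ropp, !Rabs_mult, (Rabs_pos_eq 2), (Rabs_pos_eq PI), (Rabs_pos_eq s) in R2 by (auto; generalize PI_ge_1; lra).
  generalize PI_ge_1 (Rabs_pos (IZR n)). intros. nra. }
assert (B3 : (INR k + Rabs (IZR n) <= A * Cmod X)%R).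
{ assert (s * Rabs q <= Cmod X * (Rabs q / p))%R.
  { replace (Cmod X * (Rabs q / p))%R with (Cmod X * / p * Rabs q)%R by (unfold Rdiv; ring).
    apply Rmult_le_compat_r; auto. apply Rabs_pos. }
  unfold A. rewrite Rmult_plus_distr_r, Rmult_plus_distr_r. unfold s in *. lra. }
assert (B4 : (Cmod X <= Cmod (y + X) + Cmod y)%R).
{ replace X with ((y + X) - y) at 1 by ring. apply Cmod_triangle_minus. }
apply le_div; auto.
replace (/ (2 * A * Cmod beta) * (INR k + Rabs (IZR n)) * Cmod beta)%R
  with ((INR k + Rabs (IZR n)) * / (2 * A))%R by (field; lra).
apply Rmult_le_reg_r with (2 * A)%R; [lra|].
rewrite Rmult_assoc, Rinv_l, Rmult_1_r by lra. nra.
Qed.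

(** At k = 0 the value is 0, since / 0 = 0; it serves as a summable bound. *)
Definition inv_sq (k : nat) : R := (/ (INR k * INR k))%R.

Lemma inv_sq_pos k : (0 <= inv_sq k)%R.
Proof.
unfold inv_sq. destruct k.
- simpl. rewrite Rmult_0_l, Rinv_0. lra.
- generalize (INR_S_ge_1 k). intros. apply Rlt_le, Rinv_0_lt_compat. nra.
Qed.

Lemma ex_series_scal_inv_sq c : ex_series (fun k => (c * inv_sq k)%R).
Proof.
apply ex_series_Rscal.
apply ex_series_incr_1. exact ex_series_inv_sq.
Qed.

(** Two of the four powers sum over n by telescoping, and two remain for the sum
    over k. *)
Lemma zsum_bound (g : Z -> C) D (k : nat) M : (1 <= k)%nat -> (0 <= D)%R ->
  (forall n, (Cmod (g n) <= D * / (INR k + Rabs (IZR n)) ^ 4)%R) ->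
  (Cmod (zsum g M) <= 3 * D * inv_sq k)%R.
Proof.
intros Hk HD Hg.
assert (K1 : (1 <= INR k)%R) by (change 1%R with (INR 1); apply le_INR, Hk).
set (x := INR k) in *.
assert (A : (Cmod (zsum g M) <= D * (inv_sq k * (1 + 2 * (/ x - / (x + INR M)))))%R).
{ unfold inv_sq. fold x. induction M.
  - cbn [zsum]. eapply Rle_trans; [apply Hg|]. apply Rmult_le_compat_l; auto.
    rewrite Rabs_R0. simpl (INR 0). rewrite Rplus_0_r, Rminus_diag, Rmult_0_r, Rplus_0_r, Rmult_1_r.
    apply Rinv_le_contravar; [nra|]. simpl. assert (1 <= x * x)%R by nra. nra.
  - cbn [zsum]. eapply Rle_trans; [apply Cmod_triangle|].
    assert (G1 := Hg (Z.of_nat (S M))). assert (G2 := Hg (- Z.of_nat (S M))%Z).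
    rewrite Rabs_IZR_nat in G1. rewrite Rabs_IZR_opp_nat in G2.
    assert (T := Cmod_triangle (g (Z.of_nat (S M))) (g (- Z.of_nat (S M))%Z)).
    assert (HM := pos_INR M). rewrite S_INR in *. set (m := INR M) in *.
    assert (E : (/ (x + (m + 1)) ^ 4 <= / (x * x) * (/ (x + m) - / (x + (m + 1))))%R).
    { replace (/ (x * x) * (/ (x + m) - / (x + (m + 1))))%R
        with (/ ((x * x) * ((x + m) * (x + (m + 1)))))%R by (field; lra).
      apply Rinv_le_contravar; [repeat apply Rmult_lt_0_compat; lra|].
      replace ((x + (m + 1)) ^ 4)%R with (((x + (m + 1)) * (x + (m + 1))) * ((x + (m + 1)) * (x + (m + 1))))%R by ring.
      apply Rmult_le_compat; try nra. }
    assert (E' := Rmult_le_compat_l D _ _ HD E).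
    apply Rle_trans with (D * (/ (x * x) * (1 + 2 * (/ x - / (x + m)))) + 2 * (D * (/ (x * x) * (/ (x + m) - / (x + (m + 1))))))%R; [lra|].
    apply Req_le. ring. }
eapply Rle_trans; [exact A|].
replace (3 * D * inv_sq k)%R with (D * (inv_sq k * 3))%R by ring.
apply Rmult_le_compat_l; auto. apply Rmult_le_compat_l; [apply inv_sq_pos|].
assert (/ x <= 1)%R by (rewrite <- Rinv_1; apply Rinv_le_contravar; lra).
assert (0 < / (x + INR M))%R by (apply Rinv_0_lt_compat; generalize (pos_INR M); lra). lra.
Qed.

Lemma csum_zsum (a : Z -> C) N : csum (fun k => a (Z.of_nat k - Z.of_nat N)%Z) (2 * N + 1) = zsum a N.
Proof.
induction N.
- simpl. ring.
- replace (2 * S N + 1)%nat with (S (S (2 * N + 1))) by lia.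
  rewrite csum_shift. cbn [csum].
  rewrite (csum_ext _ (fun k => a (Z.of_nat k - Z.of_nat N)%Z)) by (intros; f_equal; lia).
  rewrite IHN. cbn [zsum].
  replace (Z.of_nat 0 - Z.of_nat (S N))%Z with (- Z.of_nat (S N))%Z by lia.
  replace (Z.of_nat (S (2 * N + 1)) - Z.of_nat (S N))%Z with (Z.of_nat (S N)) by lia. ring.
Qed.

Lemma Zprod_Cexp (a H : Z -> C) X : (forall n, a n = Cexp (- H n)) -> cvg (zsum H) X -> Zprod a = Cexp (- X).
Proof.
intros Ha HX. apply cvg_Clim_seq.
apply cvg_ext with (u := fun N => Cexp (- zsum H N)); [|now apply cvg_exp, cvg_opp].
intros N. rewrite (Cprod_ext _ (fun k => Cexp (- H (Z.of_nat k - Z.of_nat N)%Z))) by (intros; apply Ha).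
rewrite Cprod_Cexp. f_equal. rewrite <- csum_zsum, csum_opp. reflexivity.
Qed.

(** (1 - coth (y / 2)) / 2 = - 1 / (e^y - 1): this factor is the boundary term of
    the first Euler-Maclaurin correction. *)
Lemma coth_half (beta y : C) : nonpole y ->
  beta * (1 - Ccoth (y / 2)) / 24 = - (beta / 12 * / (Cexp y - 1)).
Proof.
intros H. apply nonpole_exp in H. unfold Ccoth.
assert (E : Cexp y = Cexp (y / 2) * Cexp (y / 2)) by (rewrite <- Cexp_plus; f_equal; field).
rewrite Cexp_opp, E in *. assert (Ha := Cexp_neq_0 (y / 2)). set (a := Cexp (y / 2)) in *.
field. repeat split; auto.
Qed.

(** Applied in two regions: for large k, where beta (w + k) lies in the right
    half-plane, and for large |n|, where w + k is off the real axis. *)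
Lemma principal_term_bound (beta y : C) (n : Z) (k : nat) (c : R) : (0 < c)%R ->
  (0 < INR k + Rabs (IZR n))%R ->
  (forall t, (0 <= t <= 1)%R -> slit (warg beta y n + RtoC (INR k) + RtoC t)) ->
  (forall t, (0 <= t <= 1)%R ->
    (c * (INR k + Rabs (IZR n)) <= Cmod (warg beta y n + RtoC (INR k) + RtoC t))%R) ->
  (Cmod (stirling_term (warg beta y n + RtoC (INR k))
     (Clog (warg beta y n + RtoC (INR (S k))) - Clog (warg beta y n + RtoC (INR k))))
   <= / c ^ 4 * / (INR k + Rabs (IZR n)) ^ 4)%R.
Proof.
intros Hc Hx Hs Hw. set (w := warg beta y n) in *.
set (g := fun t : R => Clog (w + RtoC (INR k) + RtoC t)).
replace (Clog (w + RtoC (INR (S k))) - Clog (w + RtoC (INR k))) with (g 1%R - g 0%R).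
- rewrite <- Rinv_mult, <- Rpow_mult_distr.
  apply stirling_term_bound; auto; [now apply Rmult_lt_0_compat|].
  intros t Ht. eapply Dt_eq.
  + apply (Dt_Clog (fun t => w + RtoC (INR k) + RtoC t) t 1); [|now apply Hs].
    apply Dt_ext with (fun t => (w + RtoC (INR k)) + RtoC t * 1); [intros; ring|apply Dt_affine].
  + unfold Cdiv. ring.
- unfold g. rewrite S_INR, RtoC_plus, Cplus_0_r. f_equal. f_equal. ring.
Qed.

(** log (w + k) - log k = log (1 + w / k), principal values, for large k. *)
Lemma Clog_asymp (w : C) : cvg (fun k => Clog (w + RtoC (INR k)) - RtoC (ln (INR k))) 0.
Proof.
assert (L : cvg (fun k => w * RtoC (/ INR k) + 1) (w * 0 + 1)).
{ apply cvg_plus; [|apply cvg_const]. apply cvg_mult; [apply cvg_const|]. apply cvg_RtoC, is_lim_seq_inv_INR. }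
replace (w * 0 + 1) with (RtoC 1) in L by ring.
destruct (proj1 (cvg_spec _ _) L 1%R Rlt_0_1) as [N HN].
apply cvg_ext_loc with (N := (1 + N)%nat) (u := fun k => Clog (w * RtoC (/ INR k) + 1)).
- intros k Hk. assert (Hk0 : (0 < INR k)%R) by (apply lt_0_INR; lia).
  replace (w + RtoC (INR k)) with (RtoC (INR k) * (w * RtoC (/ INR k) + 1)).
  + rewrite Clog_scal_pos; auto; [ring|]. intros E. specialize (HN k ltac:(lia)).
    rewrite E in HN. replace (0 - 1) with (- RtoC 1) in HN by ring.
    rewrite Cmod_opp, Cmod_1 in HN. lra.
  + rewrite RtoC_inv by lra. field. apply RtoC_neq_0. lra.
- replace (RtoC 0) with (Clog 1) by (rewrite (Clog_RtoC 1), ln_1 by lra; reflexivity).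
  apply cvg_Clog; [simpl; lra|exact L].
Qed.

(** Data are chosen at all points y + k beta: the given ones for k = 0, principal
    ones for large k, and arbitrary continuations in between.  The double
    series is then summed in both orders. *)
Theorem continued_formula (beta y F0 f0 : C) (lam0 : Z -> C) : (0 < Re beta)%R ->
  continued y F0 f0 lam0 ->
  (forall k : nat, nonpole (y + RtoC (INR k) * beta)) ->
  product_formula beta y F0 (Cexp (f0 / 2)) (fun n => lam0 n - Clog beta).
Proof.
intros Hb Hy Hnp.
assert (Hb0 := Re_pos_neq_0 beta Hb).
set (u := fun k : nat => y + RtoC (INR k) * beta) in *.
assert (Hex : forall k, exists d : C * C * (Z -> C),
   continued (u k) (fst (fst d)) (snd (fst d)) (snd d) /\
   (k = O -> d = (F0, f0, lam0)) /\
   (k <> O -> (0 < Re (u k))%R -> d = (li2exp (u k), log1exp (u k), fun n => Clog (u k + period n)))).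
{ intros [|k].
  - exists (F0, f0, lam0). split; [|split; auto; intros X; now destruct X].
    unfold u. simpl. replace (y + 0 * beta) with y by ring. exact Hy.
  - destruct (Rlt_le_dec 0 (Re (u (S k)))) as [Hr|Hr].
    + eexists (_, _, _). split; [apply continued_right, Hr|]. split; [discriminate|reflexivity].
    + destruct (continued_exists _ (Hnp (S k))) as [F [f [lam H]]].
      exists (F, f, lam). split; [exact H|]. split; [discriminate|]. intros _ X. lra. }
set (d := fun k => proj1_sig (constructive_indefinite_description _ (Hex k))).
assert (Hd := fun k => proj2_sig (constructive_indefinite_description _ (Hex k))).
change (forall k, continued (u k) (fst (fst (d k))) (snd (fst (d k))) (snd (d k)) /\
   (k = O -> d k = (F0, f0, lam0)) /\
   (k <> O -> (0 < Re (u k))%R -> d k = (li2exp (u k), log1exp (u k), fun n => Clog (u k + period n)))) in Hd.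
set (F := fun k => fst (fst (d k))). set (f := fun k => snd (fst (d k))).
set (lam := fun k => snd (d k)).
assert (Hc : forall k, continued (u k) (F k) (f k) (lam k)) by (intros k; apply Hd).
assert (HF0 : F O = F0) by (unfold F; now rewrite (proj1 (proj2 (Hd O)) eq_refl)).
assert (Hf0 : f O = f0) by (unfold f; now rewrite (proj1 (proj2 (Hd O)) eq_refl)).
assert (Hl0 : lam O = lam0) by (unfold lam; now rewrite (proj1 (proj2 (Hd O)) eq_refl)).
(* For k >= K1 the points y + k beta lie in the right half-plane. *)
destruct (nat_upper (Rabs (Re y) / Re beta)) as [K1 HK1].
assert (Hright : forall k t, (K1 <= k)%nat -> (0 <= t)%R -> (0 < Re (y + RtoC (INR k + t) * beta))%R).
{ intros k t Hk Ht. rewrite re_plus, re_scal_l. apply Rlt_div_l in HK1; auto.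
  apply le_INR in Hk. generalize (Rle_abs (- Re y)). rewrite Rabs_Ropp. nra. }
assert (Hur : forall k, (K1 <= k)%nat -> (0 < Re (u k))%R).
{ intros k Hk. unfold u. rewrite <- (Rplus_0_r (INR k)). apply Hright; auto. lra. }
assert (HlamR : forall k, (S K1 <= k)%nat -> lam k = fun n => Clog (u k + period n)).
{ intros k Hk. unfold lam. rewrite (proj2 (proj2 (Hd k))); auto. lia. apply Hur. lia. }
assert (HFR : forall k, (S K1 <= k)%nat -> F k = li2exp (u k)).
{ intros k Hk. unfold F. rewrite (proj2 (proj2 (Hd k))); auto. lia. apply Hur. lia. }
assert (HfR : forall k, (S K1 <= k)%nat -> f k = log1exp (u k)).
{ intros k Hk. unfold f. rewrite (proj2 (proj2 (Hd k))); auto. lia. apply Hur. lia. }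
set (w := fun n => warg beta y n).
assert (Hw : forall n k, w n + RtoC (INR k) = (u k + period n) / beta).
{ intros n k. unfold w, warg, u. field. auto. }
set (l := fun n k => lam k n - Clog beta).
set (h := fun n => gamma_term (w n) (l n)).
assert (Hexp : forall n k, Cexp (l n k) = w n + RtoC (INR k)).
{ intros n k. unfold l. rewrite Cexp_minus, Cexp_Clog by auto.
  rewrite (proj1 (continued_exp _ _ _ _ (Hc k))). symmetry. apply Hw. }
assert (Hlr : forall n k, (S K1 <= k)%nat -> l n k = Clog (w n + RtoC (INR k))).
{ intros n k Hk. unfold l. rewrite HlamR, Hw, Clog_div_right; auto.
  rewrite re_plus. change (Re (period n)) with 0%R. specialize (Hur k ltac:(lia)). lra. }
assert (Has : forall n, cvg (fun k => l n k - RtoC (ln (INR k))) 0).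
{ intros n. eapply cvg_ext_loc with (N := S K1); [|apply (Clog_asymp (w n))].
  intros k Hk. now rewrite Hlr. }
destruct (lattice_lower beta y Hb) as [c [N [Hc0 HN]]].
set (K0 := (S K1 + N)%nat).
set (D := (/ c ^ 4)%R).
assert (HD : (0 <= D)%R) by (apply Rlt_le, Rinv_0_lt_compat, pow_lt; auto).
assert (Hh : forall n k, (K0 <= k)%nat -> (Cmod (h n k) <= D * / (INR k + Rabs (IZR n)) ^ 4)%R).
{ intros n k Hk. unfold h, gamma_term. rewrite !Hlr by (unfold K0 in Hk; lia).
  assert (Hk0 : (0 < INR k)%R) by (apply lt_0_INR; unfold K0 in Hk; lia).
  generalize (Rabs_pos (IZR n)). intros Hn. apply principal_term_bound; auto; [lra| |].
  - intros t Ht. assert (Hr := Hright k t ltac:(unfold K0 in Hk; lia) (proj1 Ht)).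
    replace (warg beta y n + RtoC (INR k) + RtoC t) with ((y + RtoC (INR k + t) * beta + period n) / beta)
      by (unfold warg; rewrite RtoC_plus; field; auto).
    apply slit_div_right; auto. rewrite re_plus. change (Re (period n)) with 0%R. lra.
  - intros t Ht. apply HN; auto. assert (INR N <= INR k)%R by (apply le_INR; unfold K0 in Hk; lia). lra. }
assert (HS : forall M k, (K0 <= k)%nat -> (Cmod (zsum (fun n => h n k) M) <= 3 * D * inv_sq k)%R).
{ intros M k Hk. apply zsum_bound; auto. unfold K0 in Hk. lia. }
assert (HB0 : forall k, (0 <= 3 * D * inv_sq k)%R).
{ intros k. generalize (inv_sq_pos k). intros. nra. }
assert (HH : forall n, exists H, cvg (csum (h n)) H).
{ intros n. apply (csum_cvg_dominated _ (fun k => (3 * D * inv_sq k)%R) K0); auto.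
  - intros k Hk. specialize (HS O k Hk). specialize (Hh n k Hk).
    apply Rle_trans with (1 := Hh). 
    assert (K2 : (1 <= INR k)%R) by (change 1%R with (INR 1); apply le_INR; unfold K0 in Hk; lia).
    assert (/ (INR k + Rabs (IZR n)) ^ 4 <= inv_sq k)%R.
    { apply Rinv_le_contravar; [nra|]. generalize (Rabs_pos (IZR n)). intros.
      replace ((INR k + Rabs (IZR n)) ^ 4)%R with (((INR k + Rabs (IZR n)) * (INR k + Rabs (IZR n))) * ((INR k + Rabs (IZR n)) * (INR k + Rabs (IZR n))))%R by ring.
      assert (INR k * INR k <= (INR k + Rabs (IZR n)) * (INR k + Rabs (IZR n)))%R by nra.
      assert (1 <= INR k * INR k)%R by nra. nra. }
    generalize (inv_sq_pos k). intros. nra.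
  - apply ex_series_scal_inv_sq. }
set (H := fun n => proj1_sig (constructive_indefinite_description _ (HH n))).
assert (HHl : forall n, cvg (csum (h n)) (H n)) by (intros n; exact (proj2_sig (constructive_indefinite_description _ (HH n)))).
set (g := fun k => / (Cexp (u k) - 1)).
set (E := fun k => (F (S k) - F k) / beta - (f k + f (S k)) / 2 + beta / 12 * (g (S k) - g k)).
assert (HE : forall k, cvg (fun M => zsum (fun n => h n k) M) (E k)).
{ intros k.
  (* K (z) = (z - u)^2 / (2 beta) - (z - u) / 2 + beta / 12: at both ends
     K = beta / 12, and K' = -1/2 at u, K' = 1/2 at u + beta. *)
  assert (A := bracket_step (/ (2 * beta)) (- (u k / beta) - / 2) (u k * u k / (2 * beta) + u k / 2 + beta / 12)
    _ _ _ _ _ _ _ _ (Hc k) (Hc (S k))).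
  assert (Eu : u (S k) = u k + beta) by (unfold u; rewrite S_INR, RtoC_plus; ring).
  replace (E k) with (bracket (/ (2 * beta)) (- (u k / beta) - / 2) (u k * u k / (2 * beta) + u k / 2 + beta / 12) (u (S k)) (F (S k)) (f (S k))
     - bracket (/ (2 * beta)) (- (u k / beta) - / 2) (u k * u k / (2 * beta) + u k / 2 + beta / 12) (u k) (F k) (f k)).
  - apply cvg_ext with (2 := A). intros M. apply zsum_ext. intros n.
    assert (N1 := continued_nonpole _ _ _ _ (Hc k) n). assert (N2 := continued_nonpole _ _ _ _ (Hc (S k)) n).
    unfold h, gamma_term, stirling_term, bracket_n, l. rewrite Hw. rewrite Eu in *.
    field. repeat split; auto.
    replace (u k + period n + beta) with (u k + beta + period n) by ring. exact N2.
  - assert (N1 := proj1 (nonpole_exp _) (continued_nonpole _ _ _ _ (Hc k))).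
    assert (N2 := proj1 (nonpole_exp _) (continued_nonpole _ _ _ _ (Hc (S k)))).
    unfold E, bracket, g. rewrite Eu in *. field. repeat split; auto. }
assert (HEX : exists X, cvg (csum E) X).
{ apply (csum_cvg_dominated _ (fun k => (3 * D * inv_sq k)%R) K0); auto.
  - intros k Hk. apply (cvg_le_limit _ _ _ O (HE k)). intros M _. auto.
  - apply ex_series_scal_inv_sq. }
destruct HEX as [X HX].
assert (HZ : cvg (zsum H) X).
{ apply (tannery (fun M k => zsum (fun n => h n k) M) E (fun k => (3 * D * inv_sq k)%R) K0); auto.
  - apply ex_series_scal_inv_sq.
  - intros M. induction M; cbn [zsum]; [apply HHl|].
    apply cvg_ext with (u := fun K => csum (fun k => zsum (fun n => h n k) M) K
       + (csum (h (Z.of_nat (S M))) K + csum (h (- Z.of_nat (S M))%Z) K)).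
    + intros K. rewrite <- !csum_plus. reflexivity.
    + apply cvg_plus; auto. now apply cvg_plus. }
assert (HZp : Zprod (fun n => factor beta y n (lam0 n - Clog beta)) = Cexp (- X)).
{ apply Zprod_Cexp with H; auto. intros n. rewrite <- Hl0. apply (factor_eq beta y n (l n)); auto. apply HHl. }
assert (Hx0 : cvg (fun k => Cexp (- u k)) 0).
{ apply cvg_le with (N := O) (b := fun k => (exp (- Re y) * exp (- Re beta) ^ k)%R).
  - intros k _. replace (Cexp (- u k) - 0) with (Cexp (- u k)) by ring.
    rewrite Cmod_Cexp. unfold u. rewrite re_opp, re_plus, re_scal_l.
    replace (- (Re y + INR k * Re beta))%R with (- Re y + INR k * - Re beta)%R by ring.
    rewrite exp_plus. apply Req_le. f_equal.
    clear. induction k; [simpl; now rewrite Rmult_0_l, exp_0|].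
    rewrite S_INR. simpl. rewrite <- IHk, <- exp_plus. f_equal. ring.
  - apply is_lim_seq_val with (exp (- Re y) * 0)%R; [|ring]. apply is_lim_seq_Rscal.
    apply is_lim_seq_geom. rewrite Rabs_pos_eq by (apply Rlt_le, exp_pos).
    rewrite <- exp_0. apply exp_increasing. lra. }
assert (HF : cvg F 0).
{ apply cvg_ext_loc with (N := S K1) (u := fun k => li2exp (u k)); [intros; now rewrite HFR|].
  now apply li2exp_cvg_0. }
assert (Hf : cvg f 0).
{ apply cvg_ext_loc with (N := S K1) (u := fun k => log1exp (u k)); [intros; now rewrite HfR|].
  now apply log1exp_cvg_0. }
assert (Hg : cvg g 0).
{ apply cvg_ext with (u := fun k => Cexp (- u k) * / (1 - Cexp (- u k))).
  - intros k. unfold g. assert (N1 := proj1 (nonpole_exp _) (continued_nonpole _ _ _ _ (Hc k))).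
    rewrite Cexp_opp. field. split; auto. apply Cexp_neq_0.
  - replace (RtoC 0) with (RtoC 0 * / (1 - 0)) by ring.
    apply cvg_mult; auto. apply cvg_inv; [|apply cvg_minus; auto; apply cvg_const].
    replace (1 - 0) with (RtoC 1) by ring. apply C1_nz. }
assert (HEs : forall K, csum E K = (F K - F0) / beta - csum f K + (f0 - f K) / 2 + beta / 12 * (g K - g O)).
{ intros K. induction K.
  - simpl. rewrite HF0, Hf0. field. auto.
  - cbn [csum]. rewrite IHK. unfold E. field. auto. }
unfold product_formula. rewrite HZp.
rewrite coth_half by apply (continued_nonpole _ _ _ _ Hy). rewrite <- !Cexp_plus.
apply cvg_Clim_seq.
apply cvg_ext with (u := fun K => Cexp ((F K - F0) / beta + (f0 - f K) / 2 + beta / 12 * (g K - g O) - csum E K)).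
- intros K. rewrite (Cprod_ext _ (fun k => Cexp (f k))).
  + rewrite Cprod_Cexp. f_equal. rewrite HEs. ring.
  + intros k _. rewrite (proj2 (continued_exp _ _ _ _ (Hc k))). f_equal. apply Cexp_shift_pow.
- apply cvg_exp.
  replace (- (beta / 12 * / (Cexp y - 1)) - F0 / beta + f0 / 2 + - X)
    with ((0 - F0) * / beta + (f0 - 0) * / 2 + beta / 12 * (0 - g O) - X).
  + apply cvg_minus; [|exact HX]. apply cvg_plus; [apply cvg_plus|].
    * apply cvg_mult; [|apply cvg_const]. apply cvg_minus; [exact HF|apply cvg_const].
    * apply cvg_mult; [|apply cvg_const]. apply cvg_minus; [apply cvg_const|exact Hf].
    * apply cvg_mult; [apply cvg_const|]. apply cvg_minus; [exact Hg|apply cvg_const].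
  + unfold g. replace (u O) with y by (unfold u; simpl; ring). unfold Cdiv. ring.
Qed.

(** * Absolute convergence *)

Lemma Zprod_abs_convergent_intro (a : Z -> C) C0 N :
  (forall n, (INR N <= Rabs (IZR n))%R -> (Cmod (a n - 1) <= C0 * inv_sq (Z.abs_nat n))%R) ->
  Zprod_abs_convergent a.
Proof.
intros H.
assert (L : forall g : nat -> Z, (forall k, Rabs (IZR (g k)) = INR k) -> (forall k, Z.abs_nat (g k) = k) ->
   ex_series (fun k => Cmod (a (g k) - 1))).
{ intros g Hg1 Hg2. apply (ex_series_incr_n _ N).
  apply (ex_series_dom _ (fun k => (C0 * inv_sq (N + k))%R)).
  - intros k. rewrite Rabs_pos_eq by apply Cmod_ge_0.
    rewrite <- (Hg2 (N + k)%nat) at 2. apply H. rewrite Hg1. apply le_INR. lia.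
  - apply (ex_series_incr_n (fun k => (C0 * inv_sq k)%R) N). apply ex_series_scal_inv_sq. }
split; apply L; intros k; first [apply Rabs_IZR_nat | apply Rabs_IZR_opp_nat | lia].
Qed.

Lemma rsum_inv_pow4 (x : R) K : (1 <= x)%R ->
  (rsum (fun k => / (INR k + x) ^ 4)%R K <= / (x * x) * (2 / x - 2 / (INR K + x)))%R.
Proof.
intros Hx. induction K.
- simpl. rewrite Rplus_0_l, Rminus_diag. lra.
- cbn [rsum]. rewrite S_INR. generalize (pos_INR K). intros HK. set (m := INR K) in *.
  assert (E : (/ (m + x) ^ 4 <= / (x * x) * (2 / (m + x) - 2 / (m + 1 + x)))%R).
  { replace (/ (x * x) * (2 / (m + x) - 2 / (m + 1 + x)))%R
      with (/ ((x * x) * ((m + x) * ((m + 1 + x) / 2))))%R by (field; lra).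
    apply Rinv_le_contravar; [repeat apply Rmult_lt_0_compat; lra|].
    replace ((m + x) ^ 4)%R with (((m + x) * (m + x)) * ((m + x) * (m + x)))%R by ring.
    apply Rmult_le_compat; nra. }
  apply Rle_trans with (/ (x * x) * (2 / x - 2 / (m + x)) + / (x * x) * (2 / (m + x) - 2 / (m + 1 + x)))%R; [lra|].
  apply Req_le. ring.
Qed.

Lemma Rabs_IZR_abs_nat n : Rabs (IZR n) = INR (Z.abs_nat n).
Proof. rewrite <- abs_IZR, INR_IZR_INZ, Zabs2Nat.id_abs. reflexivity. Qed.

(** For large |n| all w_n + k are off the real axis, and the sum over k of the
    bounds of [principal_term_bound] is O (1 / n^2). *)
Lemma far_factor (beta y : C) : (0 < Re beta)%R ->
  exists (C0 : R) (N : nat), forall n, (INR N <= Rabs (IZR n))%R ->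
    (Cmod (factor beta y n (Clog (warg beta y n)) - 1) <= C0 * inv_sq (Z.abs_nat n))%R.
Proof.
intros Hb. assert (Hb0 := Re_pos_neq_0 beta Hb).
destruct (lattice_lower beta y Hb) as [c [N1 [Hc HN1]]].
set (D := (/ c ^ 4)%R).
assert (HD : (0 < D)%R) by (apply Rinv_0_lt_compat, pow_lt; auto).
destruct (nat_upper (2 * Cmod y * Cmod beta / Re beta)) as [N2 HN2].
(* |n| >= 2 D makes the sum over k at most 1, where e^z - 1 = O (|z|). *)
destruct (nat_upper (2 * D)) as [N3 HN3].
exists (12 * D)%R, (1 + (N1 + (N2 + N3)))%nat. intros n Hn.
rewrite !plus_INR in Hn. simpl (INR 1) in Hn.
generalize (pos_INR N1) (pos_INR N2) (pos_INR N3). intros P1 P2 P3.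
set (x := Rabs (IZR n)) in *.
assert (Hx : (1 <= x)%R) by lra.
assert (Him : Im (warg beta y n) <> 0%R).
{ apply warg_im_neq_0; auto. apply Rlt_div_l in HN2; auto. fold x. nra. }
set (w := warg beta y n) in *.
assert (Hslit : forall s : R, slit (w + RtoC s)).
{ intros s. right. rewrite im_plus. change (Im (RtoC s)) with 0%R. lra. }
set (l := fun k : nat => Clog (w + RtoC (INR k))).
assert (Hh : forall k, (Cmod (gamma_term w l k) <= D * / (INR k + x) ^ 4)%R).
{ intros k. generalize (pos_INR k). intros Hk. apply principal_term_bound; auto; [fold x; lra| |].
  - intros t _. rewrite <- Cplus_assoc, <- RtoC_plus. apply Hslit.
  - intros t Ht. apply HN1; auto. fold x. lra. }
assert (Hsum : forall K, (Cmod (csum (gamma_term w l) K) <= 2 * D * / (x * x))%R).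
{ intros K. eapply Rle_trans; [apply csum_le; intros k _; apply Hh|].
  assert (E : rsum (fun k => (D * / (INR k + x) ^ 4)%R) K = (D * rsum (fun k => (/ (INR k + x) ^ 4)%R) K)%R).
  { clear. induction K; simpl; [ring|]. simpl in IHK. rewrite IHK. ring. }
  rewrite E. assert (A := rsum_inv_pow4 x K Hx).
  assert (HK := pos_INR K).
  assert (B : (2 / x - 2 / (INR K + x) <= 2)%R).
  { assert (0 <= 2 / (INR K + x))%R by (apply Rdiv_le_0_compat; lra).
    assert (2 / x <= 2)%R by (apply Rle_div_l; lra). lra. }
  assert (Hxx : (0 < / (x * x))%R) by (apply Rinv_0_lt_compat; nra).
  apply Rle_trans with (D * (/ (x * x) * 2))%R; [|lra].
  apply Rmult_le_compat_l; [lra|]. apply Rle_trans with (1 := A). apply Rmult_le_compat_l; lra. }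
destruct (csum_cvg_dominated (gamma_term w l) (fun k => (D * inv_sq k)%R) 1) as [H HH].
- intros k Hk. apply Rle_trans with (1 := Hh k). apply Rmult_le_compat_l; [lra|].
  assert (K2 : (1 <= INR k)%R) by (change 1%R with (INR 1); apply le_INR; lia).
  apply Rinv_le_contravar; [nra|].
  replace ((INR k + x) ^ 4)%R with (((INR k + x) * (INR k + x)) * ((INR k + x) * (INR k + x)))%R by ring.
  assert (INR k * INR k <= (INR k + x) * (INR k + x))%R by nra.
  assert (1 <= INR k * INR k)%R by nra. nra.
- intros k. generalize (inv_sq_pos k). intros. nra.
- apply ex_series_scal_inv_sq.
- assert (BH : (Cmod H <= 2 * D * / (x * x))%R) by (apply (cvg_le_limit _ _ _ O HH); auto).
  assert (EF : factor beta y n (Clog w) = Cexp (- H)).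
  { replace (Clog w) with (l O) by (unfold l; simpl; now rewrite Cplus_0_r).
    apply factor_eq; auto.
    - intros k. apply Cexp_Clog, slit_neq_0, Hslit.
    - apply Clog_asymp. }
  rewrite EF.
  assert (Hx2 : (2 * D * / (x * x) <= 1)%R).
  { apply Rmult_le_reg_r with (x * x)%R; [nra|]. rewrite Rmult_assoc, Rinv_l by nra. nra. }
  eapply Rle_trans; [apply Cexp_minus_1_le; rewrite Cmod_opp; lra|].
  rewrite Cmod_opp. unfold inv_sq. rewrite <- Rabs_IZR_abs_nat. fold x. lra.
Qed.

Lemma Zprod_abs_convergent_far beta y (l : Z -> C) N : (0 < Re beta)%R ->
  (forall n, (INR N <= Rabs (IZR n))%R -> l n = Clog (warg beta y n)) ->
  Zprod_abs_convergent (fun n => factor beta y n (l n)).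
Proof.
intros Hb Hl. destruct (far_factor beta y Hb) as [C0 [N1 H]].
apply (Zprod_abs_convergent_intro _ C0 (N + N1)). intros n Hn. rewrite plus_INR in Hn.
generalize (pos_INR N) (pos_INR N1). intros. rewrite Hl by lra. apply H. lra.
Qed.

(** * Zeros of both sides *)

Lemma Cprod_zero (u : nat -> C) j N : (j < N)%nat -> u j = 0 -> Cprod u N = 0.
Proof.
intros Hj Hu. induction N; [lia|]. simpl. destruct (Nat.eq_dec j N) as [->|].
- rewrite Hu. ring.
- rewrite IHN by lia. ring.
Qed.

Lemma Gamma_pole k : Gamma (- RtoC (INR k)) = 0.
Proof.
apply cvg_Clim_seq. apply cvg_ext_loc with (N := k) (u := fun _ => RtoC 0); [|apply cvg_const].
intros n Hn. rewrite (Cprod_zero _ k) by (try lia; ring).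
unfold Cdiv. replace (/ RtoC 0) with (RtoC 0); [ring|].
Csolve; unfold Rdiv; rewrite ?Ropp_0; ring.
Qed.

(** On the left the k-th factor vanishes, and on the right the n-th one, where
    1 / Gamma has a zero. *)
Lemma product_formula_zero (beta y D s : C) (l : Z -> C) (k : nat) (n : Z) : beta <> 0 ->
  y + RtoC (INR k) * beta + period n = 0 -> product_formula beta y D s l.
Proof.
intros Hb E. unfold product_formula.
assert (E1 : qPochhammer (Cexp (- y)) (Cexp (- beta)) = 0).
{ apply cvg_Clim_seq. apply cvg_ext_loc with (N := S k) (u := fun _ => RtoC 0); [|apply cvg_const].
  intros N HN. symmetry. apply (Cprod_zero _ k); [lia|].
  rewrite Cexp_shift_pow. replace (- (y + RtoC (INR k) * beta)) with (period n).
  - rewrite Cexp_period. ring.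
  - replace (period n) with (y + RtoC (INR k) * beta + period n - (y + RtoC (INR k) * beta)) by ring.
    rewrite E. ring. }
assert (E2 : Zprod (fun m => factor beta y m (l m)) = 0).
{ apply cvg_Clim_seq. apply cvg_ext_loc with (N := Z.abs_nat n) (u := fun _ => RtoC 0); [|apply cvg_const].
  intros N HN. symmetry. apply (Cprod_zero _ (Z.to_nat (n + Z.of_nat N))); [lia|].
  replace (Z.of_nat (Z.to_nat (n + Z.of_nat N)) - Z.of_nat N)%Z with n by lia.
  unfold factor. replace (warg beta y n) with (- RtoC (INR k)).
  - rewrite Gamma_pole. unfold Cdiv at 1. replace (/ RtoC 0) with (RtoC 0); [ring|].
    Csolve; unfold Rdiv; rewrite ?Ropp_0; ring.
  - unfold warg. replace (y + period n) with (y + RtoC (INR k) * beta + period n - RtoC (INR k) * beta) by ring.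
    rewrite E. field. auto. }
rewrite E1, E2. ring.
Qed.

(** * Branches on a domain *)

Lemma Dt_ext_loc (f g : R -> C) t l d : (0 < d)%R ->
  (forall x, (Rabs (x - t) < d)%R -> f x = g x) -> Dt f t l -> Dt g t l.
Proof.
intros Hd H [H1 H2].
assert (L : locally t (fun x => f x = g x)).
{ exists (mkposreal d Hd). intros x Hx. apply H. exact Hx. }
split; [eapply is_derive_ext_loc; [|exact H1]|eapply is_derive_ext_loc; [|exact H2]];
  apply filter_imp with (2 := L); intros x ->; reflexivity.
Qed.

Lemma seg_open (U : C -> Prop) u v t : open U -> U (seg u v t) ->
  exists d, (0 < d)%R /\ forall x, (Rabs (x - t) < d)%R -> U (seg u v x).
Proof.
intros HU H. rewrite open_C_iff in HU. destruct (HU _ H) as [d [Hd Hb]].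
assert (Hc := Cmod_ge_0 (v - u)).
exists (d / (Cmod (v - u) + 1))%R. split; [apply Rdiv_lt_0_compat; lra|].
intros x Hx. apply Hb. unfold seg.
replace (u + RtoC x * (v - u) - (u + RtoC t * (v - u))) with (RtoC (x - t) * (v - u)) by (rewrite RtoC_minus; ring).
rewrite Cmod_mult, Cmod_R. apply Rlt_div_r in Hx; [|lra]. generalize (Rabs_pos (x - t)). nra.
Qed.

(** The indicator function of V is locally constant along the segment. *)
Lemma seg_connected (U V W : C -> Prop) u v : open U -> open V -> open W ->
  (forall z, U z -> V z \/ W z) -> (forall z, U z -> ~ (V z /\ W z)) ->
  (forall t, (0 <= t <= 1)%R -> U (seg u v t)) -> V u -> V v.
Proof.
intros HU HV HW Hc Hd Hs Hu.
set (ind := fun t => if excluded_middle_informative (V (seg u v t)) then RtoC 1 else RtoC 0).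
assert (E : ind 1%R = ind 0%R).
{ apply Dt_zero_const. intros t Ht.
  destruct (seg_open U u v t HU (Hs t Ht)) as [d [Hd0 HdU]].
  destruct (Hc _ (Hs t Ht)) as [HVt|HWt].
  - destruct (seg_open V u v t HV HVt) as [e [He HeV]].
    apply Dt_ext_loc with (fun _ => RtoC 1) e; auto; [|apply Dt_const].
    intros x Hx. unfold ind. destruct (excluded_middle_informative _) as [|N]; auto. now destruct (N (HeV x Hx)).
  - destruct (seg_open W u v t HW HWt) as [e [He HeW]].
    apply Dt_ext_loc with (fun _ => RtoC 0) (Rmin d e); [now apply Rmin_glb_lt| |apply Dt_const].
    intros x Hx. unfold ind. destruct (excluded_middle_informative _) as [HVx|]; auto.
    exfalso. apply (Hd (seg u v x)).
    + apply HdU. rmin Hx.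
    + split; auto. apply HeW. rmin Hx. }
unfold ind in E. rewrite seg_0, seg_1 in E.
destruct (excluded_middle_informative (V v)); auto.
destruct (excluded_middle_informative (V u)); [|contradiction].
injection E. intros. lra.
Qed.

Definition right_half (z : C) : Prop := (0 < Re z)%R.

Lemma open_right_half : open right_half.
Proof.
apply open_C_iff. intros z Hz. exists (Re z). split; auto. intros z' H.
assert (A := Re_le_Cmod (z' - z)). rewrite re_minus in A.
assert (B := Rle_lt_trans _ _ _ A H). apply Rabs_def2 in B. unfold right_half in *. lra.
Qed.

Lemma seg_right u v t : right_half u -> right_half v -> (0 <= t <= 1)%R -> right_half (seg u v t).
Proof.
unfold right_half. intros Hu Hv Ht. rewrite Re_seg. destruct (Req_dec t 0) as [->|]; nra.
Qed.

(** Differentiation in the direction of the real axis, which stays in the right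
    half-plane. *)
Lemma Cder_eq_right (f g : C -> C) (l m z : C) :
  (forall y, right_half y -> f y = g y) -> right_half z ->
  Cder f z l -> Dt (fun t => g (seg z (z + 1) t)) 0%R m -> l = m.
Proof.
intros E Hz Hf Hg.
destruct (seg_open right_half z (z + 1) 0%R open_right_half) as [d [Hd HdU]]; [now rewrite seg_0|].
apply (Dt_unique (fun t => f (seg z (z + 1) t)) 0%R).
- eapply Dt_eq; [apply (Cder_Dt f (seg z (z + 1))); [rewrite seg_0; exact Hf|apply Dt_seg]|]. ring.
- apply Dt_ext_loc with (fun t => g (seg z (z + 1) t)) d; auto.
  intros x Hx. symmetry. apply E, HdU, Hx.
Qed.

(** (e^z - 1) D'' (z) - 1 is analytic on U and vanishes on the right half-plane. *)
Lemma Li2_branch_ode (U : C -> Prop) (D : C -> C) :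
  branch_domain U -> is_Li2_branch U D -> (forall z, U z -> nonpole z) ->
  (forall z, right_half z -> Cdrv D z = log1exp z) /\
  (forall z, U z -> Cder D z (Cdrv D z)) /\
  (forall z, U z -> Cder (Cdrv D) z (/ (Cexp z - 1))).
Proof.
intros [HU [HUc HUr]] HD Hnp.
assert (Ha : forall z, U z -> locally_CPS D z) by (intros z Hz; now apply analytic_at_CPS, (proj1 HD)).
assert (H1 : forall z, right_half z -> Cdrv D z = log1exp z).
{ intros z Hz. apply (Cder_eq_right D li2exp _ _ z); auto.
  - intros y Hy. apply (Li2_branch_right U); auto.
  - now apply locally_CPS_Cder, Ha, HUr.
  - eapply Dt_eq; [apply Dt_li2exp; [apply Dt_seg|now rewrite seg_0]|]. rewrite seg_0. ring. }
assert (H2 : forall z, right_half z -> Cdrv (Cdrv D) z = / (Cexp z - 1)).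
{ intros z Hz. apply (Cder_eq_right (Cdrv D) log1exp _ _ z); auto.
  - now apply locally_CPS_Cder, locally_CPS_Cdrv, Ha, HUr.
  - eapply Dt_eq; [apply Dt_log1exp; [apply Dt_seg|now rewrite seg_0]|].
    rewrite seg_0. assert (X := Cexp_minus_1_neq_0 z Hz). field. exact X. }
split; [exact H1|]. split; [intros z Hz; now apply locally_CPS_Cder, Ha|].
assert (HI : forall z, U z -> (Cexp z - 1) * Cdrv (Cdrv D) z - 1 = 0).
{ apply (identity_theorem U (fun z => (Cexp z - 1) * Cdrv (Cdrv D) z - 1) 1 1%R); auto.
  - intros z Hz. apply (locally_CPS_add_const (fun z => (Cexp z - 1) * Cdrv (Cdrv D) z) (- RtoC 1)).
    apply (locally_CPS_mult (fun z => Cexp z - 1) (Cdrv (Cdrv D))).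
    + apply (locally_CPS_add_const Cexp (- RtoC 1)), locally_CPS_exp.
    + now apply locally_CPS_Cdrv, locally_CPS_Cdrv, Ha.
  - apply HUr. simpl. lra.
  - lra.
  - intros z Hz. assert (Hr : right_half z).
    { assert (A := Re_le_Cmod (z - 1)). rewrite re_minus in A.
      assert (B := Rle_lt_trans _ _ _ A Hz). apply Rabs_def2 in B. unfold right_half. simpl in B. lra. }
    rewrite H2 by auto. assert (X := Cexp_minus_1_neq_0 z Hr). field. exact X. }
intros z Hz. assert (X := proj1 (nonpole_exp z) (Hnp z Hz)).
replace (/ (Cexp z - 1)) with (Cdrv (Cdrv D) z).
- now apply locally_CPS_Cder, locally_CPS_Cdrv, Ha.
- specialize (HI z Hz).
  replace (Cdrv (Cdrv D) z) with (((Cexp z - 1) * Cdrv (Cdrv D) z - 1 + 1) / (Cexp z - 1)) by (field; exact X).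
  rewrite HI. field. exact X.
Qed.

(** Differentiability along segments is common to analytic branches, given by
    power series, and to the principal logarithm off its cut. *)
Definition seg_log_branch (beta : C) (n : Z) (U : C -> Prop) (l : C -> C) : Prop :=
  (forall u v t, U (seg u v t) -> exists m, Dt (fun x => l (seg u v x)) t m) /\
  (forall y, U y -> Cexp (l y) = warg beta y n) /\
  (forall (y : C) (x : R), U y -> (0 < x)%R -> warg beta y n = RtoC x -> l y = RtoC (ln x)).

Lemma Dt_warg beta u v n t : Dt (fun x => warg beta (seg u v x) n) t ((v - u) / beta).
Proof.
eapply Dt_eq; [apply Dt_mult; [apply Dt_plus; [apply Dt_seg|apply Dt_const]|apply Dt_const]|].
cbv beta. unfold Cdiv. ring.
Qed.

(** Differentiate exp (l) = w. *)
Lemma seg_log_branch_Dt beta n U l u v t : beta <> RtoC 0 -> open U -> seg_log_branch beta n U l ->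
  U (seg u v t) -> Dt (fun x => l (seg u v x)) t ((v - u) / (seg u v t + period n)).
Proof.
intros Hb HU [Hd [He _]] Ht.
destruct (Hd u v t Ht) as [m Hm].
destruct (seg_open U u v t HU Ht) as [d [Hd0 HdU]].
assert (E : m * Cexp (l (seg u v t)) = (v - u) / beta).
{ apply (Dt_unique (fun x => warg beta (seg u v x) n) t); [|apply Dt_warg].
  apply Dt_ext_loc with (fun x => Cexp (l (seg u v x))) d; auto.
  now apply Dt_exp. }
rewrite He in E by auto.
assert (N : seg u v t + period n <> 0).
{ intros X. apply (Cexp_neq_0 (l (seg u v t))). rewrite He by auto. unfold warg. rewrite X. field. exact Hb. }
eapply Dt_eq; [exact Hm|].
replace m with (m * warg beta (seg u v t) n / warg beta (seg u v t) n).
- rewrite E. unfold warg. field. auto.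
- unfold warg. field. auto.
Qed.

Lemma is_log_branch_seg beta n U l : is_log_branch beta n U l -> seg_log_branch beta n U l.
Proof.
intros [Ha [He Hr]]. split; [|auto]. intros u v t Ht.
eexists. apply (Cder_Dt l (seg u v)); [|apply Dt_seg].
apply locally_CPS_Cder, analytic_at_CPS, Ha, Ht.
Qed.

(** The property is transported along segments in U: the branches satisfy the
    differential equations in the definition of [continued].  So the set where
    it holds and its complement in U are open, and it holds at 1. *)
Lemma branches_continued (beta : C) (U : C -> Prop) (D s : C -> C) (l : Z -> C -> C) :
  (0 < Re beta)%R -> branch_domain U -> is_Li2_branch U D -> is_sqrt_branch U s ->
  (forall n, seg_log_branch beta n U (l n)) ->
  forall y, U y -> continued y (D y) (Cdrv D y) (fun n => l n y + Clog beta) /\ s y = Cexp (Cdrv D y / 2).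
Proof.
intros Hb HUd HD Hs Hl.
assert (Hb0 := Re_pos_neq_0 beta Hb).
assert (Hnp : forall z, U z -> nonpole z).
{ intros z Hz n E. apply (Cexp_neq_0 (l n z)). rewrite (proj1 (proj2 (Hl n))) by auto.
  unfold warg. rewrite E. field. exact Hb0. }
destruct (Li2_branch_ode U D HUd HD Hnp) as [HD1r [HD1 HD2]].
destruct HUd as [HU [HUc HUr]]. destruct Hs as [Hsa [Hsq Hsp]].
assert (Hld : forall n u v t, U (seg u v t) ->
   Dt (fun x => l n (seg u v x) + Clog beta) t ((v - u) / (seg u v t + period n))).
{ intros n u v t Ht. eapply Dt_eq; [apply Dt_plus; [apply seg_log_branch_Dt with beta U; auto|apply Dt_const]|]. ring. }
set (A := fun y => continued y (D y) (Cdrv D y) (fun n => l n y + Clog beta) /\ s y = Cexp (Cdrv D y / 2)).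
assert (Hseg : forall u v, (forall t, (0 <= t <= 1)%R -> U (seg u v t)) -> A u -> A v).
{ intros u v Huv [Hu Hsu].
  assert (DD1 : forall t, (0 <= t <= 1)%R -> Dt (fun t => Cdrv D (seg u v t)) t ((v - u) / (Cexp (seg u v t) - 1))).
  { intros t Ht. eapply Dt_eq; [apply (Cder_Dt (Cdrv D) (seg u v)); [apply HD2, Huv, Ht|apply Dt_seg]|].
    unfold Cdiv. ring. }
  split.
  - apply (continued_step _ _ _ _ v (fun t => D (seg u v t)) (fun t => Cdrv D (seg u v t))
      (fun n t => l n (seg u v t) + Clog beta) _ _ _ Hu); try (intros; now rewrite ?seg_0, ?seg_1); auto.
    intros t Ht. eapply Dt_eq; [apply (Cder_Dt D (seg u v)); [apply HD1, Huv, Ht|apply Dt_seg]|]. ring.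
  - assert (E : s (seg u v 1) * Cexp (- (Cdrv D (seg u v 1) / 2)) = s (seg u v 0) * Cexp (- (Cdrv D (seg u v 0) / 2))).
    { apply (Dt_zero_const (fun t => s (seg u v t) * Cexp (- (Cdrv D (seg u v t) / 2)))).
      intros t Ht. assert (HUt := Huv t Ht).
      assert (Ds : Dt (fun x => s (seg u v x)) t (Cdrv s (seg u v t) * (v - u))).
      { apply (Cder_Dt s (seg u v)); [|apply Dt_seg]. now apply locally_CPS_Cder, analytic_at_CPS, Hsa. }
      set (m := Cdrv s (seg u v t) * (v - u)) in *.
      destruct (seg_open U u v t HU HUt) as [d [Hd0 HdU]].
      assert (E2 : 2 * s (seg u v t) * m = (v - u) * Cexp (- seg u v t)).
      { apply (Dt_unique (fun x => 1 - Cexp (- seg u v x)) t).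
        - apply Dt_ext_loc with (fun x => s (seg u v x) * s (seg u v x)) d; auto.
          + intros x Hx. rewrite <- Hsq by now apply HdU. simpl. ring.
          + eapply Dt_eq; [apply Dt_mult; exact Ds|]. cbv beta. ring.
        - eapply Dt_eq; [apply Dt_minus; [apply Dt_const|apply Dt_exp, Dt_opp, Dt_seg]|]. cbv beta. ring. }
      assert (E3 : s (seg u v t) * s (seg u v t) = 1 - Cexp (- seg u v t)).
      { rewrite <- Hsq by auto. simpl. ring. }
      assert (N := proj1 (nonpole_exp _) (Hnp _ HUt)). assert (Ne := Cexp_neq_0 (seg u v t)).
      assert (Ns : s (seg u v t) <> 0).
      { intros X. rewrite X, Cexp_opp in E3. apply N.
        replace (Cexp (seg u v t) - 1) with (Cexp (seg u v t) * (1 - / Cexp (seg u v t))) by (field; auto).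
        rewrite <- E3. ring. }
      assert (Em : m = s (seg u v t) * ((v - u) / (Cexp (seg u v t) - 1)) / 2).
      { replace m with (2 * s (seg u v t) * m * s (seg u v t) / (2 * (s (seg u v t) * s (seg u v t)))) by (field; exact Ns).
        rewrite E2, E3, Cexp_opp. field. repeat split; auto. }
      eapply Dt_eq.
      - apply Dt_mult; [exact Ds|]. apply Dt_exp, Dt_opp.
        apply (Dt_mult (fun t => Cdrv D (seg u v t)) (fun _ => / 2)); [now apply DD1|apply Dt_const].
      - cbv beta. rewrite Em. field. exact N. }
    rewrite seg_0, seg_1, Hsu, <- Cexp_plus in E.
    replace (Cdrv D u / 2 + - (Cdrv D u / 2)) with (RtoC 0) in E by ring. rewrite Cexp_0 in E.
    replace (s v) with (s v * Cexp (- (Cdrv D v / 2)) * Cexp (Cdrv D v / 2)).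
    + rewrite E. ring.
    + rewrite <- Cmult_assoc, Cexp_opp_l. ring. }
assert (H1r : right_half 1) by (unfold right_half; simpl; lra).
assert (HU1 : U 1) by now apply HUr.
assert (HA1 : A 1).
{ split.
  - assert (E1 : D 1 = li2exp 1) by now apply (Li2_branch_right U).
    assert (E3 : (fun n => l n 1 + Clog beta) = (fun n => Clog (1 + period n))).
    { apply functional_extensionality. intros n.
      (* At this point w = 1, where the normalization gives the value 0. *)
      set (z := beta + period (- n)).
      assert (Hz : right_half z) by (unfold right_half, z; rewrite re_plus; simpl; lra).
      assert (Ez : z + period n = beta) by (unfold z; rewrite period_opp; ring).
      assert (Hzt : forall t, (0 <= t <= 1)%R -> right_half (seg z 1 t)) by (intros; now apply seg_right).
      rewrite <- (seg_1 z 1).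
      apply (Dt_same_end (fun t => l n (seg z 1 t) + Clog beta) (fun t => Clog (seg z 1 t + period n))
         (fun t => (1 - z) / (seg z 1 t + period n))).
      - intros t Ht. apply Hld, HUr, Hzt, Ht.
      - intros t Ht. apply (Dt_Clog (fun t => seg z 1 t + period n)).
        + eapply Dt_eq; [apply Dt_plus; [apply Dt_seg|apply Dt_const]|cbv beta; ring].
        + left. rewrite re_plus. specialize (Hzt t Ht). unfold right_half in Hzt. simpl (Re (period n)). lra.
      - rewrite seg_0, Ez, (proj2 (proj2 (Hl n)) z 1%R); [rewrite ln_1; ring|now apply HUr|lra|].
        unfold warg. rewrite Ez. field. exact Hb0. }
    rewrite E1, HD1r, E3 by exact H1r. apply continued_base.
  - rewrite HD1r by exact H1r.
    destruct (Hsp 1%R Rlt_0_1) as [r [Hr Er]].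
    assert (Ei := Im_log1exp_RtoC 1 Rlt_0_1).
    set (a := Re (log1exp 1)).
    assert (Ea : log1exp 1 = RtoC a) by (unfold a; destruct (log1exp 1); simpl in *; Csolve; auto).
    assert (E2 := Hsq 1 HU1). rewrite <- (Cexp_log1exp 1 H1r), Er, Ea, Cexp_RtoC in E2.
    rewrite Ea, Er. rewrite <- RtoC_div by lra. rewrite Cexp_RtoC. f_equal.
    assert (E3 : (r * r = exp (a / 2) * exp (a / 2))%R).
    { rewrite <- exp_plus. replace (a / 2 + a / 2)%R with a by field.
      apply RtoC_inj. rewrite <- E2, RtoC_mult. simpl. ring. }
    generalize (exp_pos (a / 2)). intros. nra. }
assert (Hball : forall z, U z -> exists d, (0 < d)%R /\ forall u v t,
   (Cmod (u - z) < d)%R -> (Cmod (v - z) < d)%R -> (0 <= t <= 1)%R -> U (seg u v t)).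
{ intros z Hz. assert (HU' := proj1 (open_C_iff U) HU z Hz). destruct HU' as [d [Hd HdU]].
  exists d. split; auto. intros u v t Hu Hv Ht. apply HdU.
  replace (seg u v t - z) with (RtoC (1 - t) * (u - z) + RtoC t * (v - z)) by (unfold seg; rewrite RtoC_minus; ring).
  eapply Rle_lt_trans; [apply Cmod_triangle|]. rewrite !Cmod_mult, !Cmod_RtoC_pos by lra.
  destruct (Req_dec t 0) as [->|]; nra. }
destruct (HUc (fun z => U z /\ A z) (fun z => U z /\ ~ A z)) as [HV|HW].
- apply open_C_iff. intros z [Hz HAz]. destruct (Hball z Hz) as [d [Hd Hd']]. exists d. split; auto.
  intros z' Hz'. assert (Z0 : (Cmod (z - z) < d)%R) by (replace (z - z) with (RtoC 0) by ring; now rewrite Cmod_0).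
  split; [|apply (Hseg z); auto].
  rewrite <- (seg_0 z' z'). apply Hd'; auto; lra.
- apply open_C_iff. intros z [Hz HAz]. destruct (Hball z Hz) as [d [Hd Hd']]. exists d. split; auto.
  intros z' Hz'. assert (Z0 : (Cmod (z - z) < d)%R) by (replace (z - z) with (RtoC 0) by ring; now rewrite Cmod_0).
  split; [|intros HA'; apply HAz, (Hseg z'); auto].
  rewrite <- (seg_0 z' z'). apply Hd'; auto; lra.
- intros z Hz. destruct (excluded_middle_informative (A z)); auto.
- intros z Hz [[_ X] [_ Y]]. auto.
- intros y Hy. now apply HV.
- exfalso. now apply (HW 1 HU1).
Qed.

Lemma branch_formula (beta : C) (U : C -> Prop) (D s : C -> C) (l : Z -> C -> C) (y : C) :
  (0 < Re beta)%R -> branch_domain U -> is_Li2_branch U D -> is_sqrt_branch U s ->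
  (forall n, seg_log_branch beta n U (l n)) -> U y ->
  Zprod_abs_convergent (fun n => factor beta y n (l n y)) /\
  product_formula beta y (D y) (s y) (fun n => l n y).
Proof.
intros Hb HU HD Hs Hl Hy.
assert (Hb0 := Re_pos_neq_0 beta Hb).
destruct (branches_continued beta U D s l Hb HU HD Hs Hl y Hy) as [Hc Es].
split.
- destruct (continued_far beta _ _ _ _ Hb Hc) as [N HN].
  apply Zprod_abs_convergent_far with N; auto. intros n Hn.
  replace (l n y) with (l n y + Clog beta - Clog beta) by ring. rewrite (HN n Hn). ring.
- destruct (excluded_middle_informative (forall k : nat, nonpole (y + RtoC (INR k) * beta))) as [Hnp|Hnp].
  + rewrite Es.
    replace (fun n => l n y) with (fun n => (fun n => l n y + Clog beta) n - Clog beta).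
    * now apply continued_formula.
    * apply functional_extensionality. intros n. ring.
  + apply not_all_ex_not in Hnp. destruct Hnp as [k Hk].
    apply not_all_ex_not in Hk. destruct Hk as [n Hn]. apply NNPP in Hn.
    now apply (product_formula_zero beta y (D y) (s y) _ k n).
Qed.

(** * The complement of the wedges *)

(** A point outside the closed cone is strictly on the wrong side of one of its
    two boundary lines, or of the imaginary axis. *)
Lemma wedge_separation (beta y : C) (n : Z) : (0 < Re beta)%R ->
  (forall s t : R, (0 <= s)%R -> (0 <= t)%R -> y <> period n - (RtoC s + RtoC t * beta)) ->
  exists d, (0 < d)%R /\ forall z, (Cmod (z - y) < d)%R ->
    forall s t : R, (0 <= s)%R -> (0 <= t)%R -> z <> period n - (RtoC s + RtoC t * beta).
Proof.
intros Hb Hy. set (p := Re beta) in *. set (q := Im beta).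
assert (Hlin : forall a c k : R,
   (0 < a * Re y + c * Im y + k)%R ->
   (forall s t : R, (0 <= s)%R -> (0 <= t)%R -> (a * (- (s + t * p)) + c * (2 * PI * IZR n - t * q) + k <= 0)%R) ->
   exists d, (0 < d)%R /\ forall z, (Cmod (z - y) < d)%R ->
    forall s t : R, (0 <= s)%R -> (0 <= t)%R -> z <> period n - (RtoC s + RtoC t * beta)).
{ intros a c k H0 H. set (e := (a * Re y + c * Im y + k)%R) in *.
  assert (Ha := Rabs_pos a). assert (Hc := Rabs_pos c).
  exists (e / (Rabs a + Rabs c + 1))%R. split; [apply Rdiv_lt_0_compat; lra|].
  intros z Hz s t Hs Ht E. apply Rlt_div_r in Hz; [|lra].
  specialize (H s t Hs Ht).
  assert (Er : Re z = (- (s + t * p))%R).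
  { rewrite E, re_minus, re_plus, re_scal_l. simpl. unfold p. unfold Re. ring. }
  assert (Ei : Im z = (2 * PI * IZR n - t * q)%R).
  { rewrite E, im_minus, im_plus, im_scal_l. simpl. unfold q. unfold Im. ring. }
  rewrite <- Er, <- Ei in H.
  assert (A1 := Re_le_Cmod (z - y)). assert (A2 := Im_le_Cmod (z - y)). rewrite re_minus in A1. rewrite im_minus in A2.
  assert (B1 : (Rabs (a * (Re z - Re y)) <= Rabs a * Cmod (z - y))%R) by (rewrite Rabs_mult; apply Rmult_le_compat_l; auto).
  assert (B2 : (Rabs (c * (Im z - Im y)) <= Rabs c * Cmod (z - y))%R) by (rewrite Rabs_mult; apply Rmult_le_compat_l; auto).
  apply Rabs_le_between in B1, B2. generalize (Cmod_ge_0 (z - y)). unfold e in *. intros. nra. }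
assert (Hyy : forall s t, (0 <= s)%R -> (0 <= t)%R -> Re y = (- (s + t * p))%R -> Im y = (2 * PI * IZR n - t * q)%R -> False).
{ intros s t Hs Ht E1 E2. apply (Hy s t Hs Ht). unfold p, q in *. destruct y as [y1 y2], beta as [b1 b2]. simpl in *.
  Csolve; lra. }
destruct (Rlt_le_dec 0 (Re y)) as [Hr|Hr].
{ apply (Hlin 1 0 0)%R; [lra|]. intros s t Hs Ht. nra. }
destruct (Rtotal_order q 0) as [Hq|[Hq|Hq]].
- destruct (Rlt_le_dec (Im y) (2 * PI * IZR n)) as [Hi|Hi].
  + apply (Hlin 0 (-1) (2 * PI * IZR n))%R; [lra|]. intros s t Hs Ht. nra.
  + apply (Hlin 1 (- (p / q)) (p / q * (2 * PI * IZR n)))%R.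
    * apply Rnot_le_lt. intros X.
      apply (Hyy (- Re y - (Im y - 2 * PI * IZR n) * (p / - q)) ((Im y - 2 * PI * IZR n) / - q))%R.
      -- replace (p / - q)%R with (- (p / q))%R by (field; lra). lra.
      -- apply Rdiv_le_0_compat; lra.
      -- field. lra.
      -- field. lra.
    * intros s t Hs Ht.
      replace (1 * - (s + t * p) + - (p / q) * (2 * PI * IZR n - t * q) + p / q * (2 * PI * IZR n))%R with (- s)%R by (field; lra). lra.
- destruct (Rtotal_order (Im y) (2 * PI * IZR n)) as [Hi|[Hi|Hi]].
  + apply (Hlin 0 (-1) (2 * PI * IZR n))%R; [lra|]. intros s t Hs Ht. rewrite Hq. lra.
  + exfalso. apply (Hyy (- Re y) 0)%R; lra.
  + apply (Hlin 0 1 (- (2 * PI * IZR n)))%R; [lra|]. intros s t Hs Ht. rewrite Hq. lra.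
- destruct (Rlt_le_dec (2 * PI * IZR n) (Im y)) as [Hi|Hi].
  + apply (Hlin 0 1 (- (2 * PI * IZR n)))%R; [lra|]. intros s t Hs Ht. nra.
  + apply (Hlin 1 (- (p / q)) (p / q * (2 * PI * IZR n)))%R.
    * apply Rnot_le_lt. intros X.
      apply (Hyy (- Re y - (2 * PI * IZR n - Im y) * (p / q)) ((2 * PI * IZR n - Im y) / q))%R.
      -- lra.
      -- apply Rdiv_le_0_compat; lra.
      -- field. lra.
      -- field. lra.
    * intros s t Hs Ht.
      replace (1 * - (s + t * p) + - (p / q) * (2 * PI * IZR n - t * q) + p / q * (2 * PI * IZR n))%R with (- s)%R by (field; lra). lra.
Qed.

Lemma off_wedges_right beta y : (0 < Re beta)%R -> right_half y -> off_wedges beta y.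
Proof.
intros Hb Hy n s t Hs Ht E. unfold right_half in Hy.
rewrite E, re_minus, re_plus, re_scal_l in Hy. simpl in Hy. nra.
Qed.

Lemma off_wedges_shift beta y (r : R) : (0 <= r)%R -> off_wedges beta y -> off_wedges beta (y + RtoC r).
Proof.
intros Hr H n s t Hs Ht E. apply (H n (s + r)%R t); auto; [lra|].
replace y with (y + RtoC r - RtoC r) by ring. rewrite E, RtoC_plus. ring.
Qed.

(** Each wedge is closed, and only finitely many of them meet a disc of radius 1
    around y. *)
Lemma open_off_wedges beta : (0 < Re beta)%R -> open (off_wedges beta).
Proof.
intros Hb. apply open_C_iff. intros y Hy.
(* For z in the n-th wedge, t <= |z| / Re beta and so |n| is at most
   |z| (1 + |Im beta| / Re beta). *)
destruct (nat_upper ((Cmod y + 1) * (1 + Rabs (Im beta) / Re beta))) as [N HN].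
assert (Hfar : forall z n s t, (Cmod (z - y) < 1)%R -> (N < Z.abs_nat n)%nat -> (0 <= s)%R -> (0 <= t)%R ->
   z <> period n - (RtoC s + RtoC t * beta)).
{ intros z n s t Hz Hn Hs Ht E.
  assert (Hm : (Cmod z <= Cmod y + 1)%R).
  { replace z with (y + (z - y)) by ring. generalize (Cmod_triangle y (z - y)). lra. }
  assert (A1 := Re_le_Cmod z). assert (A2 := Im_le_Cmod z).
  rewrite E, re_minus, re_plus, re_scal_l in A1 at 1. rewrite E, im_minus, im_plus, im_scal_l in A2 at 1.
  change (Re (period n)) with 0%R in A1. change (Re (RtoC s)) with s in A1.
  change (Im (period n)) with (2 * PI * IZR n)%R in A2. change (Im (RtoC s)) with 0%R in A2.
  apply Rabs_le_between in A1.
  assert (T : (t <= Cmod z / Re beta)%R) by (apply le_div; nra).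
  assert (B := Rabs_triang (2 * PI * IZR n - (0 + t * Im beta)) (t * Im beta)).
  replace (2 * PI * IZR n - (0 + t * Im beta) + t * Im beta)%R with (2 * PI * IZR n)%R in B by ring.
  rewrite !Rabs_mult, (Rabs_pos_eq 2), (Rabs_pos_eq PI), (Rabs_pos_eq t) in B by (auto; generalize PI_ge_1; lra).
  assert (T2 : (t * Rabs (Im beta) <= Cmod z / Re beta * Rabs (Im beta))%R) by (apply Rmult_le_compat_r; auto; apply Rabs_pos).
  rewrite Rabs_IZR_abs_nat in B. assert (HnN : (INR N <= INR (Z.abs_nat n))%R) by (apply le_INR; lia).
  assert (T3 : (Cmod z * (1 + Rabs (Im beta) / Re beta) <= (Cmod y + 1) * (1 + Rabs (Im beta) / Re beta))%R).
  { apply Rmult_le_compat_r; auto. assert (0 <= Rabs (Im beta) / Re beta)%R by (apply Rdiv_le_0_compat; auto; apply Rabs_pos). lra. }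
  replace (Cmod z / Re beta * Rabs (Im beta))%R with (Cmod z * (Rabs (Im beta) / Re beta))%R in T2 by (unfold Rdiv; ring).
  generalize PI_ge_1 (pos_INR (Z.abs_nat n)). intros. nra. }
assert (Hfin : forall M, exists d, (0 < d)%R /\ forall z, (Cmod (z - y) < d)%R -> forall n s t, (Z.abs_nat n < M)%nat ->
   (0 <= s)%R -> (0 <= t)%R -> z <> period n - (RtoC s + RtoC t * beta)).
{ induction M as [|M [d [Hd HdM]]].
  - exists 1%R. split; [lra|]. intros; lia.
  - destruct (wedge_separation beta y (Z.of_nat M) Hb (Hy _)) as [d1 [Hd1 H1]].
    destruct (wedge_separation beta y (- Z.of_nat M) Hb (Hy _)) as [d2 [Hd2 H2]].
    exists (Rmin d (Rmin d1 d2)). split; [repeat apply Rmin_glb_lt; auto|].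
    intros z Hz n s t Hn Hs Ht.
    assert (Z0 : (Cmod (z - y) < d)%R) by (rmin Hz).
    assert (Z12 : (Cmod (z - y) < Rmin d1 d2)%R) by (rmin Hz).
    assert (Z1 : (Cmod (z - y) < d1)%R) by (rmin Z12).
    assert (Z2 : (Cmod (z - y) < d2)%R) by (rmin Z12).
    destruct (Nat.lt_ge_cases (Z.abs_nat n) M) as [Hlt|Hge]; [now apply HdM|].
    assert (Hn2 : n = Z.of_nat M \/ n = (- Z.of_nat M)%Z) by lia.
    destruct Hn2 as [-> | ->]; auto. }
destruct (Hfin (S N)) as [d [Hd HdN]].
exists (Rmin d 1). split; [apply Rmin_glb_lt; lra|].
intros z Hz n s t Hs Ht.
destruct (Nat.lt_ge_cases N (Z.abs_nat n)) as [Hlt|Hge].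
- apply Hfar; auto. rmin Hz.
- apply HdN; auto; [|lia]. rmin Hz.
Qed.

(** A point off the wedges can be moved horizontally to the right half-plane, and
    from there to 1, without meeting a wedge. *)
Lemma off_wedges_domain beta : (0 < Re beta)%R -> branch_domain (off_wedges beta).
Proof.
intros Hb. assert (HO := open_off_wedges beta Hb).
split; [exact HO|]. split; [|intros; now apply off_wedges_right].
assert (Hstar : forall V W : C -> Prop, open V -> open W ->
   (forall z, off_wedges beta z -> V z \/ W z) -> (forall z, off_wedges beta z -> ~ (V z /\ W z)) ->
   V (RtoC 1) -> forall z, off_wedges beta z -> V z).
{ intros V W HV HW Hc Hd H1 z Hz.
  set (r := (Rabs (Re z) + 1)%R).
  assert (Hr : (0 <= r)%R) by (unfold r; generalize (Rabs_pos (Re z)); lra).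
  assert (Hzr : right_half (z + RtoC r)).
  { unfold right_half. rewrite re_plus. simpl. unfold r. generalize (Rle_abs (- Re z)). rewrite Rabs_Ropp. lra. }
  apply (seg_connected (off_wedges beta) V W (z + RtoC r) z); auto.
  - intros t Ht. replace (seg (z + RtoC r) z t) with (z + RtoC ((1 - t) * r)).
    + apply off_wedges_shift; auto. apply Rmult_le_pos; lra.
    + unfold seg. rewrite RtoC_mult, RtoC_minus. ring.
  - apply (seg_connected (off_wedges beta) V W 1); auto.
    intros t Ht. apply off_wedges_right; auto. apply seg_right; auto. unfold right_half. simpl. lra. }
intros V W HV HW Hc Hd.
destruct (Hc (RtoC 1)) as [H1|H1].
- apply off_wedges_right; auto. unfold right_half. simpl. lra.
- left. now apply (Hstar V W).
- right. apply (Hstar W V); auto.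
  + intros z Hz. destruct (Hc z Hz); auto.
  + intros z Hz [X Y]. now apply (Hd z Hz).
Qed.

Lemma off_wedges_cut_plane beta y : off_wedges beta y -> cut_plane y.
Proof.
intros H n t Ht E. apply (H n (- t)%R 0%R); [lra|lra|]. rewrite E, RtoC_opp. ring.
Qed.

(** w is a negative real number or 0 only on the ray 2 pi i Z - beta R_{>= 0},
    which is an edge of a wedge. *)
Lemma Clog_warg_branch beta n : (0 < Re beta)%R ->
  seg_log_branch beta n (off_wedges beta) (fun y => Clog (warg beta y n)).
Proof.
intros Hb. assert (Hb0 := Re_pos_neq_0 beta Hb).
assert (Hs : forall y, off_wedges beta y -> slit (warg beta y n)).
{ intros y Hy. destruct (Rlt_le_dec 0 (Re (warg beta y n))) as [Hr|Hr]; [now left|].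
  right. intros Hi. apply (Hy (- n)%Z 0%R (- Re (warg beta y n))%R); [lra|lra|].
  assert (E : warg beta y n = RtoC (Re (warg beta y n))).
  { revert Hi. generalize (warg beta y n). intros [a b]. simpl. intros ->. reflexivity. }
  rewrite RtoC_opp, <- E, period_opp. unfold warg. field. exact Hb0. }
split; [|split].
- intros u v t Ht. eexists. apply (Dt_Clog (fun x => warg beta (seg u v x) n)); [apply Dt_warg|now apply Hs].
- intros y Hy. apply Cexp_Clog, slit_neq_0, Hs, Hy.
- intros y x _ Hx E. rewrite E. now apply Clog_RtoC.
Qed.

(* First part: absolute convergence, with principal logarithms.
   Second part: the identity, with the standard branches of Li_2(e^{-y}) and
   (1 - e^{-y})^{1/2} and with principal logarithms.
   Third part: the same at any y in C \ 2 pi i Z, for the branches obtained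
   by analytic continuation of the standard ones within any domain. *)
Theorem mainTheorem1 (beta y : C) (hbeta : (0 < Re beta)%R)
    (hy : forall n : Z, y <> period n) :
  Zprod_abs_convergent (fun n => factor beta y n (Clog (warg beta y n)))
  /\
  (forall Li2exp sqrt1exp : C -> C,
     is_Li2_branch cut_plane Li2exp ->
     is_sqrt_branch cut_plane sqrt1exp ->
     off_wedges beta y ->
     product_formula beta y (Li2exp y) (sqrt1exp y)
       (fun n => Clog (warg beta y n)))
  /\
  (forall (U : C -> Prop) (Li2exp sqrt1exp : C -> C) (logw : Z -> C -> C),
     branch_domain U ->
     is_Li2_branch U Li2exp ->
     is_sqrt_branch U sqrt1exp ->
     (forall n, is_log_branch beta n U (logw n)) ->
     U y ->
     Zprod_abs_convergent (fun n => factor beta y n (logw n y)) /\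
     product_formula beta y (Li2exp y) (sqrt1exp y) (fun n => logw n y)).
Proof.
split; [|split].
- apply Zprod_abs_convergent_far with O; auto.
- intros D s [HDa HDs] [Hsa [Hsq Hsp]] Hy.
  assert (Hcut := off_wedges_cut_plane beta).
  apply (branch_formula beta (off_wedges beta) D s (fun n y => Clog (warg beta y n)) y); auto.
  + now apply off_wedges_domain.
  + split; [intros z Hz; apply HDa|intros z Hz; apply HDs]; eauto.
  + split; [intros z Hz; apply Hsa; eauto|]. split; [intros z Hz; apply Hsq; eauto|exact Hsp].
  + intros n. now apply Clog_warg_branch.
- intros U D s l HU HD Hs Hl Hy.
  apply (branch_formula beta U D s l y); auto.
  intros n. now apply is_log_branch_seg.
Qed.
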